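(* Let $\frac12<\alpha\le1$, and let $r>0$, $\epsilon>0$, $T>0$ be arbitrary. Then there exists $\theta_0\in L^2(\mathbb{R}^2)$ with $\|\theta_0\|_{L^2}=r$ such that, if $\theta(t)$ is the solution with initial data $\theta_0$ of $$\theta_t+(u\cdot\nabla)\theta+(-\Delta)^{\alpha}\theta=0,\qquad \theta(x,0)=\theta_0(x),\qquad x\in\mathbb{R}^2,\ t>0,$$ then $$\frac{\|\theta(T)\|_{L^2}}{\|\theta_0\|_{L^2}}\ge 1-\epsilon .$$
   Context: All spaces are over $\mathbb{R}^2$. Here $\theta=\theta(x,t)$ is a real scalar function, and the divergence-free velocity $u$ is determined by $\theta$ through the stream function $\psi$: $u=\left(-\frac{\partial\psi}{\partial x_2},\frac{\partial\psi}{\partial x_1}\right)$ and $\Lambda\psi=-\theta$, where $\Lambda=(-\Delta)^{1/2}$ is the Fourier multiplier with symbol $|\xi|$ (so $(-\Delta)^\alpha=\Lambda^{2\alpha}$ has symbol $|\xi|^{2\alpha}$). ''Solution'' means a global weak (distributional) solution such that for every $T>0$, $\theta\in L^\infty([0,T];L^2)\cap L^2([0,T];H^{\alpha})$; such solutions exist for every $\theta_0\in L^2$ (Resnick). It is a standing convention that the solutions considered obey the maximum principle $\|\theta(t)\|_{L^p}\le\|\theta_0\|_{L^p}$, $t\ge0$, $1<p\le\infty$ (whenever $\theta_0\in L^p$), and the energy bound $\int_s^t\|\Lambda^\alpha\theta(\tau)\|_{L^2}^2\,d\tau\le C$ for all $0<s<t$, with $C$ independent of $s,t$. *)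

(* Defs.v *)
From HB Require Import structures.
From mathcomp Require Import all_boot all_order all_algebra.
From mathcomp Require Import complex.
From mathcomp Require Import all_classical all_reals all_analysis.

Set Implicit Arguments.
Unset Strict Implicit.
Unset Printing Implicit Defensive.

Import Order.TTheory GRing.Theory Num.Theory.
Import numFieldNormedType.Exports.

Local Open Scope classical_set_scope.
Local Open Scope ring_scope.
Local Open Scope complex_scope.

Section QuasiGeostrophic.
Variable R : realType.

Implicit Types (x xi : R * R) (f g : R * R -> R) (F G : R * R -> R[i]).

Local Notation plane := (measurableTypeR R * measurableTypeR R)%type.

Definition leb2 : {measure set plane -> \bar R} :=
  (@lebesgue_measure R \x @lebesgue_measure R)%E.

Definition Lpnorm (p : \bar R) f : \bar R := ('N[leb2]_p[EFin \o f])%E.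

Definition L2norm f : \bar R := Lpnorm 2%:E f.

Definition dot x xi : R := x.1 * xi.1 + x.2 * xi.2.

(* The norm provided by the library on R * R is the sup norm. *)
Definition enorm x : R := Num.sqrt (x.1 ^+ 2 + x.2 ^+ 2).

Definition cexpi (a : R) : R[i] := cos a +i* sin a.

Definition Cintegral F : R[i] :=
  (\int[leb2]_x complex.Re (F x)) +i* (\int[leb2]_x complex.Im (F x)).

Definition CL2 F : Prop :=
  (fun x => complex.Re (F x)) \in Lfun leb2 2%:E /\
  (fun x => complex.Im (F x)) \in Lfun leb2 2%:E.

Definition toC f : R * R -> R[i] := fun x => (f x)%:C.

Definition fourier F : R * R -> R[i] :=
  fun xi => Cintegral (fun x => F x * cexpi (- dot x xi)).

Definition inv_fourier F : R * R -> R[i] :=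
  fun x => ((2 * pi) ^- 2)%:C * Cintegral (fun xi => F xi * cexpi (dot x xi)).

Definition truncate (N : nat) F : R * R -> R[i] :=
  fun x => if enorm x <= N%:R then F x else 0.

(* F is the Fourier-Plancherel transform of f: the integral defining [fourier]
   need not converge for f in L^2, and F is the limit in L^2 of the transforms
   of the truncations of f. *)
Definition is_fourierL2 f F : Prop :=
  [/\ f \in Lfun leb2 2%:E, CL2 F &
    (fun N : nat =>
      (\int[leb2]_xi
        ((Normc.normc (fourier (truncate N (toC f)) xi - F xi)) ^+ 2)%:E)%E)
      @ \oo --> 0%E].

(* g = m(D) f in L^2, for a real symbol m. *)
Definition is_multiplier (m : R * R -> R) f g : Prop :=
  exists F G : R * R -> R[i],
    [/\ is_fourierL2 f F, is_fourierL2 g G &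
      {ae leb2, forall xi, G xi = (m xi)%:C * F xi}].

Definition riesz_symbol (s : R) : R * R -> R := fun xi => enorm xi `^ s.

Definition bessel_symbol (s : R) : R * R -> R :=
  fun xi => (1 + enorm xi ^+ 2) `^ (s / 2).

(* (u1, u2) = (- d psi / d x2, d psi / d x1) and Lambda psi = - th.  For th in
   L^2 the stream function psi belongs only to the homogeneous space of order
   one (it need not be in L^2, and is determined up to a constant), so it is
   represented by its Fourier transform [psih], a measurable function. *)
Definition is_velocity (th u1 u2 : R * R -> R) : Prop :=
  exists thh psih u1h u2h : R * R -> R[i],
    [/\ is_fourierL2 th thh, is_fourierL2 u1 u1h, is_fourierL2 u2 u2h,
        measurable_fun
          [set: plane] (fun xi => complex.Re (psih xi)) /\
        measurable_fun
          [set: plane] (fun xi => complex.Im (psih xi)) &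
        {ae leb2, forall xi,
          [/\ (enorm xi)%:C * psih xi = - thh xi,
              u1h xi = - ((0 +i* xi.2) * psih xi) &
              u2h xi = (0 +i* xi.1) * psih xi]}].

(* (-Delta)^a of a test function, by Fourier inversion. *)
Definition frac_laplacian (a : R) f : R * R -> R :=
  fun x => complex.Re (inv_fourier
    (fun xi => (riesz_symbol (2 * a) xi)%:C * fourier (toC f) xi) x).

Definition smooth (V : normedModType R) (phi : V -> R) : Prop :=
  forall s : seq V,
    let dphi := foldr (fun v (h : V -> R) => fun z => 'D_v h z) phi s in
    continuous dphi /\ forall z v, derivable dphi z v.

Definition test_function (phi : R * (R * R) -> R) : Prop :=
  smooth phi /\ compact (closure [set z | phi z != 0]).

Definition dt (phi : R * (R * R) -> R) z : R := 'D_(1, (0, 0)) phi z.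
Definition dx1 (phi : R * (R * R) -> R) z : R := 'D_(0, (1, 0)) phi z.
Definition dx2 (phi : R * (R * R) -> R) z : R := 'D_(0, (0, 1)) phi z.

(* The equation and the initial condition, tested on [0, +oo[ x R^2 (test
   functions need not vanish at t = 0).  Since u is divergence free,
   (u . grad) th = div (th u). *)
Definition weak_equation (a : R) (th0 : R * R -> R)
    (th u1 u2 : R -> R * R -> R) : Prop :=
  forall phi, test_function phi ->
    \int[lebesgue_measure]_(t in `[0, +oo[) \int[leb2]_x
      (th t x * (dt phi (t, x)
                 + u1 t x * dx1 phi (t, x) + u2 t x * dx2 phi (t, x)
                 - frac_laplacian a (fun y => phi (t, y)) x))
    + \int[leb2]_x (th0 x * phi (0, x)) = 0.

Definition space_time_measurable (v : R -> R * R -> R) : Prop :=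
  measurable_fun
    [set z : (measurableTypeR R * plane)%type | 0 <= z.1] (fun z => v z.1 z.2).

Record qg_solution (a : R) (th0 : R * R -> R) (th : R -> R * R -> R) : Prop := {
  qg_measurable : space_time_measurable th;
  qg_LinfL2 : forall T : R, 0 < T -> exists M : R,
    {ae lebesgue_measure, forall t : R, 0 <= t <= T -> (L2norm (th t) <= M%:E)%E};
  qg_L2Ha : exists Jth : R -> R * R -> R,
    {ae lebesgue_measure, forall t : R, 0 < t ->
      is_multiplier (bessel_symbol a) (th t) (Jth t)} /\
    forall T : R, 0 < T ->
      (\int[lebesgue_measure]_(t in `[0%R, T]) (L2norm (Jth t) ^+ 2) < +oo)%E;
  qg_equation : exists u1 u2 : R -> R * R -> R,
    [/\ space_time_measurable u1, space_time_measurable u2,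
        {ae lebesgue_measure, forall t : R, 0 < t -> is_velocity (th t) (u1 t) (u2 t)} &
        weak_equation a th0 th u1 u2];
  (* An element of L^oo(0, T; L^2) has no value at a given time: [th] is the
     representative that is weakly continuous in L^2. *)
  qg_weakly_continuous : forall g, g \in Lfun leb2 2%:E ->
    {within `[0, +oo[, continuous (fun t : R => \int[leb2]_x (th t x * g x))};
  qg_initial : {ae leb2, forall x, th 0 x = th0 x};
  qg_maximum_principle : forall p : \bar R, (1 < p)%E ->
    th0 \in Lfun leb2 p ->
    forall t : R, 0 <= t -> (Lpnorm p (th t) <= Lpnorm p th0)%E;
  qg_energy : exists Lth : R -> R * R -> R,
    {ae lebesgue_measure, forall t : R, 0 < t ->
      is_multiplier (riesz_symbol a) (th t) (Lth t)} /\
    exists C : R, forall s t : R, 0 < s -> s < t ->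
      (\int[lebesgue_measure]_(tau in `[s, t]) (L2norm (Lth tau) ^+ 2) <= C%:E)%E
}.

End QuasiGeostrophic.

(* Main.v *)
Require Import Defs.
From HB Require Import structures.
From mathcomp Require Import all_boot all_order all_algebra.
From mathcomp Require Import complex.
From mathcomp Require Import all_classical all_reals all_analysis.
From mathcomp Require Import measurable_realfun.
From mathcomp Require Import ring lra.
Set Implicit Arguments.
Unset Strict Implicit.
Unset Printing Implicit Defensive.
Import Order.TTheory GRing.Theory Num.Theory.
Import numFieldNormedType.Exports.
Local Open Scope classical_set_scope.
Local Open Scope ring_scope.

(** A datum that is flat on a large set hardly changes before the time [T].  Take
    th0 = r e(x1) e(x2), where [e] is a smooth plateau whose square has integral
    one, with |e| <= 1 and |e'| <= [delta] pointwise and with e' and e'' at most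
    [delta] in L^2 ([flat_bump_exists]).  Let A(t) be the integral of th(t) e(x1) e(x2), so
    that A(0) = r.  Formally A'(t) is the integral of th(t) against
    u . grad (e e) - (-Delta)^alpha (e e), and both terms are of order [delta]:

    - each component of [u] has at most twice the L^2 norm of [th]
      ([velocity_energy_le]), which the maximum principle keeps at most [r], and
      the components of grad (e e) are at most [delta];
    - the L^2 norm of (-Delta)^alpha (e e) is of order [delta]
      ([frac_laplacian_energy]), because for 1/2 < alpha <= 1 its symbol is at
      most |xi| + |xi|^2, hence is controlled by one or two derivatives of [e].

    Hence A(T) >= r - O(delta).  As the integral of (th(T) - r e e)^2 is
    nonnegative, the square of the norm of th(T) is at least 2 r A(T) - r^2, which
    is r^2 (1 - O(delta)).

    The solution is weak, so the bound on A' is used in integrated form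
    ([pairing_persists]): the test function is chi(t) e(x1) e(x2), where [chi] is
    one on [0, T] and drops to zero right after [T]; its derivative then weighs
    the values of A near [T], which weak continuity identifies with A(T).

    The two energy bounds compare a function with its Fourier transform, so they
    rest on Plancherel's identity ([plancherel]).  Damp the frequencies by
    exp (- s (|k1| + |k2|)).  By Fubini the damped energy of the transform of
    [f] is the double integral of f(x) f(y) K(x, y), where K is a product of two
    Poisson kernels of mass 2 pi ([weighted_transform_energy]); writing
    2 f(x) f(y) = f(x)^2 + f(y)^2 - (f(x) - f(y))^2 turns it into the energy of
    [f] times (2 pi)^2, less half of an oscillation ([double_energy]).  The
    oscillation of a square integrable function tends to zero with s: on the line
    by density of continuous functions ([oscillation1_vanishing]), in the plane by
    changing one coordinate at a time ([oscillation2_vanishing]). *)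

(** * Integration of real functions *)

Notation plane R := (measurableTypeR R * measurableTypeR R)%type.
Notation leb R := (@lebesgue_measure R).
Notation energy mu f := (\int[mu]_x (f x ^+ 2)%:E)%E.
Notation integrableR mu f := (mu.-integrable setT (EFin \o f)).

(** The plane measure with its sigma-finiteness attached, which Fubini's theorem
    on the product of two planes asks for. *)
Definition mu2 (R : realType) : set (plane R) -> \bar R := leb2 R.

HB.instance Definition _ (R : realType) := Measure.on (leb2 R : set (plane R) -> \bar R).
HB.instance Definition _ (R : realType) := Measure.copy (@mu2 R) (leb2 R : set (plane R) -> \bar R).

Lemma mu2_sigma_finite (R : realType) : sigma_finite setT (@mu2 R).
Proof.
have /sigma_finiteP[F [TF ndF Foo]] :=
  @sigma_finiteT _ _ _ (leb R).
exists (fun n => F n `*` F n).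
  rewrite -setXTT TF predeqE => -[x y]; split => /=.
    move=> [/= [n _ Fnx] [k _ Gky]]; exists (maxn n k) => //; split.
    - by move: x Fnx; exact/subsetPset/ndF/leq_maxl.
    - by move: y Gky; exact/subsetPset/ndF/leq_maxr.
  by move=> [n _ []/= ? ?]; split; exists n.
move=> k; have [? ?] := Foo k.
split; first exact: measurableX.
have -> : @mu2 R (F k `*` F k) =
    (leb R (F k) * leb R (F k))%E.
  exact: product_measure1E.
by rewrite lte_mul_pinfty// ge0_fin_numE.
Qed.

HB.instance Definition _ (R : realType) :=
  Measure_isSigmaFinite.Build _ _ _ (@mu2 R) (@mu2_sigma_finite R).

Lemma normrM_le_weighted (R : realType) (d p q : R) : 0 < d ->
  `|p * q| <= d / 2 * p ^+ 2 + (2 * d)^-1 * q ^+ 2.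
Proof.
move=> d0; rewrite normrM -(real_normK (num_real p)) -(real_normK (num_real q)).
move: (`|p|) (`|q|) => {}p {}q; rewrite -subr_ge0.
have -> : d / 2 * p ^+ 2 + (2 * d)^-1 * q ^+ 2 - p * q = (2 * d)^-1 * (d * p - q) ^+ 2.
  by field; rewrite gt_eqF.
by rewrite mulr_ge0 ?sqr_ge0// invr_ge0 mulr_ge0// ltW.
Qed.

Section one_measure.
Context (d : measure_display) (T : measurableType d) (R : realType)
  (mu : {measure set T -> \bar R}).

Lemma integrable_dominated (f g : T -> R) :
  measurable_fun setT f -> (forall x, `|f x| <= g x) ->
  integrableR mu g -> integrableR mu f.
Proof.
move=> mf fg; apply: le_integrable => //; first exact/measurable_EFinP.
by move=> x _ /=; rewrite lee_fin (le_trans (fg x))// ler_norm.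
Qed.

Lemma integrable_measurable (f : T -> R) :
  integrableR mu f -> measurable_fun setT f.
Proof. by move=> /measurable_int /measurable_EFinP. Qed.

Lemma EFin_Rintegral (f : T -> R) :
  integrableR mu f ->
  (\int[mu]_x f x)%:E = (\int[mu]_x (f x)%:E)%E.
Proof. by move=> fi; rewrite /Rintegral fineK//; exact: integrable_fin_num. Qed.

Lemma integrableRZ (c : R) (f : T -> R) :
  integrableR mu f -> integrableR mu (fun x => c * f x).
Proof. by move=> /(integrableZl measurableT c); apply: eq_integrable. Qed.

Lemma integrableRD (f g : T -> R) :
  integrableR mu f -> integrableR mu g ->
  integrableR mu (fun x => f x + g x).
Proof. by move=> fi /(integrableD measurableT fi); apply: eq_integrable. Qed.

Lemma integrableRB (f g : T -> R) :
  integrableR mu f -> integrableR mu g ->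
  integrableR mu (fun x => f x - g x).
Proof. by move=> fi /(integrableB measurableT fi); apply: eq_integrable. Qed.

Lemma integrable_mul_bounded (f a : T -> R) (C : R) :
  integrableR mu f -> measurable_fun setT a ->
  (forall x, `|a x| <= C) ->
  integrableR mu (fun x => f x * a x).
Proof.
move=> fi ma aC; have mf := integrable_measurable fi.
apply: (@integrable_dominated _ (fun x => C * `|f x|)).
- exact: measurable_funM.
- by move=> z; rewrite normrM mulrC ler_wpM2r.
- exact: (integrableRZ C (integrable_norm fi)).
Qed.

Lemma normr_Rintegral_mul_le (f a : T -> R) :
  integrableR mu f -> measurable_fun setT a ->
  (forall x, `|a x| <= 1) ->
  `|\int[mu]_x (f x * a x)| <= \int[mu]_x `|f x|.
Proof.
move=> fi ma a1; have ifa := integrable_mul_bounded fi ma a1.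
apply: le_trans (le_normr_Rintegral measurableT ifa) _.
apply: le_Rintegral => //; first exact: integrable_norm.
- exact: integrable_norm.
- by move=> x _; rewrite normrM ler_piMr.
Qed.

Lemma le_integralD (H H1 H2 : T -> R) (c : R) :
  measurable_fun setT H -> measurable_fun setT H1 -> measurable_fun setT H2 ->
  (forall x, 0 <= H x) -> (forall x, 0 <= H1 x) -> (forall x, 0 <= H2 x) ->
  0 <= c -> (forall x, H x <= c * (H1 x + H2 x)) ->
  (\int[mu]_x (H x)%:E <=
   c%:E * (\int[mu]_x (H1 x)%:E + \int[mu]_x (H2 x)%:E))%E.
Proof.
move=> mH mH1 mH2 H0 H10 H20 c0 HH.
rewrite -ge0_integralD//; last 4 first.
- by move=> x _; rewrite lee_fin.
- exact/measurable_EFinP.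
- by move=> x _; rewrite lee_fin.
- exact/measurable_EFinP.
rewrite -ge0_integralZl//; last 2 first.
- by apply: emeasurable_funD; exact/measurable_EFinP.
- by move=> x _; rewrite lee_fin addr_ge0.
apply: ge0_le_integral => //.
- by move=> x _; rewrite lee_fin.
- exact/measurable_EFinP.
- by apply: measurable_funeM; apply: emeasurable_funD; exact/measurable_EFinP.
- by move=> x _; rewrite -EFinD -EFinM lee_fin.
Qed.

Lemma ae_impl (P Q : T -> Prop) :
  {ae mu, forall x, P x} -> (forall x, P x -> Q x) -> {ae mu, forall x, Q x}.
Proof. by move=> h PQ; apply: filterS h => x; exact: PQ. Qed.

Lemma Lfun_measurable (p : \bar R) (f : T -> R) :
  f \in Lfun mu p -> measurable_fun setT f.
Proof. by rewrite inE => /andP[]; rewrite inE. Qed.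

Lemma Lfun2_sqr_lty (f : T -> R) :
  f \in Lfun mu 2%:E -> (energy mu f < +oo)%E.
Proof.
move=> /Lfun2_integrable_sqr/integrableP[_]; apply: le_lt_trans.
by rewrite le_eqVlt; apply/orP; left; apply/eqP; apply: eq_integral => x _ /=;
  rewrite ger0_norm ?sqr_ge0.
Qed.

Lemma ae_impl2 (P Q S : T -> Prop) :
  {ae mu, forall x, P x} -> {ae mu, forall x, Q x} -> (forall x, P x -> Q x -> S x) ->
  {ae mu, forall x, S x}.
Proof. by move=> hP hQ PQS; apply: filterS2 hP hQ => x; exact: PQS. Qed.

(** The weighted form of Young's inequality replaces that of Cauchy and Schwarz: when
    [g] has size [c], both terms are of order [c]. *)
Lemma Rintegral_mul_le (f g : T -> R) (c a b : R) : 0 < c ->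
  measurable_fun setT f -> measurable_fun setT g ->
  (energy mu f <= a%:E)%E ->
  (energy mu g <= (c ^+ 2 * b)%:E)%E ->
  integrableR mu (fun x => f x * g x) /\
  `|\int[mu]_x (f x * g x)| <= c * (a + b) / 2.
Proof.
move=> c0 mf mg fa gb.
have sqr_int (h : T -> R) (s : R) : measurable_fun setT h ->
    (energy mu h <= s%:E)%E ->
    integrableR mu (fun x => h x ^+ 2) /\ \int[mu]_x (h x ^+ 2) <= s.
  move=> mh hs; have ih : integrableR mu (fun x => h x ^+ 2).
    apply/integrableP; split; first by apply/measurable_EFinP; exact: measurable_funX.
    apply: le_lt_trans (ltry s); apply: le_trans hs.
    by rewrite le_eqVlt; apply/orP; left; apply/eqP; apply: eq_integral => x _ /=;
      rewrite ger0_norm ?sqr_ge0.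
  by split => //; rewrite -lee_fin EFin_Rintegral.
have [if2 fs] := sqr_int _ _ mf fa; have [ig2 gs] := sqr_int _ _ mg gb.
pose h x := c / 2 * f x ^+ 2 + (2 * c)^-1 * g x ^+ 2.
have if2c : integrableR mu (fun x => c / 2 * f x ^+ 2).
  exact: integrableRZ if2.
have ig2c : integrableR mu (fun x => (2 * c)^-1 * g x ^+ 2).
  exact: integrableRZ ig2.
have ih : integrableR mu h.
  exact: integrableRD if2c ig2c.
have fgh x : `|f x * g x| <= h x by exact: normrM_le_weighted.
have ifg : integrableR mu (fun x => f x * g x).
  by apply: integrable_dominated ih => //; exact: measurable_funM.
split=> //; apply: le_trans (le_normr_Rintegral measurableT ifg) _.
apply: (@le_trans _ _ (\int[mu]_x h x)).
  by apply: le_Rintegral => //; exact: integrable_norm.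
rewrite RintegralD// !RintegralZl//.
apply: (@le_trans _ _ (c / 2 * a + (2 * c)^-1 * (c ^+ 2 * b))).
  apply: lerD; apply: ler_wpM2l => //; first by rewrite divr_ge0// ltW.
  by rewrite invr_ge0 mulr_ge0// ltW.
rewrite le_eqVlt; apply/orP; left; apply/eqP; field; by rewrite gt_eqF.
Qed.

Lemma Rintegral_ae_close (D : set T) (X Y U : T -> R) : measurable D ->
  measurable_fun D X -> mu.-integrable D (EFin \o Y) -> mu.-integrable D (EFin \o U) ->
  (forall x, D x -> 0 <= U x) ->
  {ae mu, forall x, D x -> `|X x - Y x| <= U x} ->
  `|\int[mu]_(x in D) X x - \int[mu]_(x in D) Y x| <= \int[mu]_(x in D) U x.
Proof.
move=> mD mX iY iU U0 XYU.
have mY : measurable_fun D Y by exact/measurable_EFinP/(measurable_int mu).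
have mU : measurable_fun D U by exact/measurable_EFinP/(measurable_int mu).
pose Z x := X x - Y x; have mZ : measurable_fun D Z by exact: measurable_funB.
have ZU : (\int[mu]_(x in D) `|Z x|%:E <= \int[mu]_(x in D) (U x)%:E)%E.
  apply: ae_ge0_le_integral => //.
  - by apply/measurable_EFinP; exact: measurableT_comp.
  - exact/measurable_EFinP.
have Uoo : (\int[mu]_(x in D) (U x)%:E < +oo)%E by exact: integrable_lty.
have iZ : mu.-integrable D (EFin \o Z).
  apply/integrableP; split; first exact/measurable_EFinP.
  exact: le_lt_trans Uoo.
have iX : X = (fun x => Y x + Z x) by apply/funext => x; rewrite /Z addrC subrK.
have -> : \int[mu]_(x in D) X x = \int[mu]_(x in D) (Y x + Z x) by rewrite -iX.
rewrite RintegralD// addrAC subrr add0r.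
apply: le_trans (le_normr_Rintegral mD iZ) _.
have nZ := integrable_norm iZ.
rewrite /Rintegral; apply: fine_le => //.
- exact: (integrable_fin_num mD nZ).
- exact: (integrable_fin_num mD iU).
Qed.

End one_measure.

Lemma measurable_Rintegral2 (d1 d2 : measure_display) (T1 : measurableType d1)
    (T2 : measurableType d2) (R : realType)
    (m2 : {sigma_finite_measure set T2 -> \bar R}) (F : T1 * T2 -> R) :
  measurable_fun setT F -> measurable_fun setT (fun x => \int[m2]_y F (x, y)).
Proof.
move=> mF; have mEF : measurable_fun setT (EFin \o F) by exact/measurable_EFinP.
apply: measurableT_comp => //.
have -> : (fun x => \int[m2]_y (F (x, y))%:E)%E =
   ((fun x => \int[m2]_y (EFin \o F)^\+ (x, y)) \-
    (fun x => \int[m2]_y (EFin \o F)^\- (x, y)))%E.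
  apply/funext => x; rewrite [LHS]integralE.
  congr (_ - _)%E; apply: eq_integral => y _.
    by rewrite !funeposE.
  by rewrite !funenegE.
apply: emeasurable_funB.
- by apply: measurable_fun_fubini_tonelli_F => //; exact: measurable_funepos.
- by apply: measurable_fun_fubini_tonelli_F => //; exact: measurable_funeneg.
Qed.

Section two_measures.
Context (d1 d2 : measure_display) (T1 : measurableType d1) (T2 : measurableType d2)
  (R : realType) (m1 : {sigma_finite_measure set T1 -> \bar R})
  (m2 : {sigma_finite_measure set T2 -> \bar R}).

Lemma measurable_Rintegral1 (F : T1 * T2 -> R) :
  measurable_fun setT F -> measurable_fun setT (fun y => \int[m1]_x F (x, y)).
Proof.
move=> mF.
exact: (measurable_Rintegral2 m1 (measurableT_comp mF (@measurable_swap _ _ T2 T1))).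
Qed.

Lemma Rintegral_prod12 (F : T1 * T2 -> R) :
  integrableR (m1 \x m2)%E F ->
  \int[m1]_x \int[m2]_y F (x, y) = \int[(m1 \x m2)%E]_z F z.
Proof.
move=> iF; rewrite /Rintegral -(integral12_prod_meas1 iF); congr fine.
have mF := integrable_measurable iF.
apply: ae_eq_integral => //.
- by apply/measurable_EFinP; exact: measurable_Rintegral2.
- exact: (measurable_fubini_F iF).
- have := ae_integrable1 iF; apply: filterS => x ix _ /=.
  by rewrite /Rintegral fineK //; exact: integrable_fin_num ix.
Qed.

Lemma Rintegral_prod21 (F : T1 * T2 -> R) :
  integrableR (m1 \x m2)%E F ->
  \int[m2]_y \int[m1]_x F (x, y) = \int[(m1 \x m2)%E]_z F z.
Proof.
move=> iF; rewrite /Rintegral -(integral21_prod_meas1 iF); congr fine.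
have mF := integrable_measurable iF.
apply: ae_eq_integral => //.
- by apply/measurable_EFinP; exact: measurable_Rintegral1.
- exact: (measurable_fubini_G iF).
- have := ae_integrable2 iF; apply: filterS => y iy _ /=.
  by rewrite /Rintegral fineK //; exact: integrable_fin_num iy.
Qed.

Lemma Rintegral_Fubini (F : T1 * T2 -> R) :
  integrableR (m1 \x m2)%E F ->
  \int[m1]_x \int[m2]_y F (x, y) = \int[m2]_y \int[m1]_x F (x, y).
Proof. by move=> iF; rewrite Rintegral_prod12// Rintegral_prod21. Qed.

Lemma integrable_Rintegral2 (F : T1 * T2 -> R) :
  integrableR (m1 \x m2)%E F ->
  integrableR m1 (fun x => \int[m2]_y F (x, y)).
Proof.
move=> iF; have mF := integrable_measurable iF.
apply: le_integrable (integrable_fubini_F iF) => //.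
  by apply/measurable_EFinP; exact: measurable_Rintegral2.
move=> x _; rewrite /= /Rintegral /fubini_F /=.
by case: (integral _ _ _) => [r||] //=; rewrite normr0 leey.
Qed.

Lemma integrable_tensor (f : T1 -> R) (g : T2 -> R) :
  integrableR m1 f -> integrableR m2 g ->
  integrableR (m1 \x m2)%E (fun z => f z.1 * g z.2).
Proof.
move=> fi gi.
have mf := integrable_measurable fi; have mg := integrable_measurable gi.
apply/integrable12ltyP.
  apply/measurable_EFinP; apply: measurable_funM.
    exact: measurableT_comp mf measurable_fst.
  exact: measurableT_comp mg measurable_snd.
have E x : (\int[m2]_y `|(f x * g y)%:E| =
    `|(f x)%:E| * \int[m2]_y `|(g y)%:E|)%E.
  rewrite -ge0_integralZl//.
  - by apply: eq_integral => y _; rewrite -abseM.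
  - by apply/measurable_EFinP; exact: measurableT_comp.
rewrite /=; under eq_integral do rewrite E.
rewrite ge0_integralZr//.
- move/integrableP : fi => [_ fi]; move/integrableP : gi => [_ gi].
  by apply: lte_mul_pinfty => //; rewrite ?integral_ge0// ge0_fin_numE ?integral_ge0.
- by apply/measurable_EFinP; exact: measurableT_comp.
- by rewrite integral_ge0.
Qed.

Lemma integrable_tensor_bounded (f : T1 -> R) (g : T2 -> R)
    (a : T1 * T2 -> R) (C : R) :
  integrableR m1 f -> integrableR m2 g ->
  measurable_fun setT a -> (forall z, `|a z| <= C) ->
  integrableR (m1 \x m2)%E (fun z => f z.1 * g z.2 * a z).
Proof.
move=> fi gi ma aC.
have ifg := integrable_tensor fi gi.
have mfg := integrable_measurable ifg.
apply: (@integrable_dominated _ _ _ _ _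
   (fun z => C * `|f z.1 * g z.2|)).
- exact: measurable_funM.
- by move=> z; rewrite normrM mulrC ler_wpM2r.
- exact: (integrableRZ C (integrable_norm ifg)).
Qed.

(** The weighted energy of the transform of [f] by [a] and [b] is the quadratic form
    on [f] of the kernel that [a] and [b] generate.  The two integrals over the first
    variable are separated one at a time, since each inner integral is a bounded
    function, so that Fubini's theorem is only needed for two variables. *)
Lemma weighted_transform_energy (f : T1 -> R) (w : T2 -> R)
    (a b : T1 * T2 -> R) (K : T1 -> T1 -> R) :
  integrableR m1 f -> integrableR m2 w ->
  measurable_fun setT a -> measurable_fun setT b ->
  (forall z, `|a z| <= 1) -> (forall z, `|b z| <= 1) ->
  (forall x y,
    \int[m2]_k (w k * (a (x, k) * a (y, k) + b (x, k) * b (y, k))) = K x y) ->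
  \int[m2]_k (w k * ((\int[m1]_x (f x * a (x, k))) ^+ 2
                     + (\int[m1]_x (f x * b (x, k))) ^+ 2)) =
  \int[m1]_x \int[m1]_y (f x * f y * K x y).
Proof.
move=> fi wi ma mb a1 b1 KE.
have mf := integrable_measurable fi; have mw := integrable_measurable wi.
pose A k := \int[m1]_x (f x * a (x, k)); pose B k := \int[m1]_x (f x * b (x, k)).
pose N := \int[m1]_x `|f x|.
have ma2 k : measurable_fun setT (fun x => a (x, k)) by exact: measurable_fun_pair1.
have mb2 k : measurable_fun setT (fun x => b (x, k)) by exact: measurable_fun_pair1.
have ma1 x : measurable_fun setT (fun k => a (x, k)) by exact: measurable_fun_pair2.
have mb1 x : measurable_fun setT (fun k => b (x, k)) by exact: measurable_fun_pair2.
have AN k : `|A k| <= N by exact: normr_Rintegral_mul_le.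
have BN k : `|B k| <= N by exact: normr_Rintegral_mul_le.
have mA : measurable_fun setT A.
  apply: (@measurable_Rintegral1 (fun z => f z.1 * a z)).
  by apply: measurable_funM => //; exact: measurableT_comp mf measurable_fst.
have mB : measurable_fun setT B.
  apply: (@measurable_Rintegral1 (fun z => f z.1 * b z)).
  by apply: measurable_funM => //; exact: measurableT_comp mf measurable_fst.
pose G (z : T1 * T2) := f z.1 * w z.2 * (a z * A z.2 + b z * B z.2).
have iG : integrableR (m1 \x m2)%E G.
  apply: (@integrable_tensor_bounded _ _ _ (N + N)) => //.
    apply: measurable_funD; apply: measurable_funM => //.
      exact: measurableT_comp mA measurable_snd.
    exact: measurableT_comp mB measurable_snd.
  move=> z; apply: le_trans (ler_normD _ _) _; rewrite !normrM.
  by apply: lerD; rewrite -[leRHS]mul1r ler_pM.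
transitivity (\int[m2]_k \int[m1]_x G (x, k)).
  apply: eq_Rintegral => k _; rewrite -/(A k) -/(B k) /G /=.
  have ifa := integrable_mul_bounded fi (ma2 k) (fun x => a1 (x, k)).
  have ifb := integrable_mul_bounded fi (mb2 k) (fun x => b1 (x, k)).
  rewrite (_ : (fun x => _) = (fun x => w k * A k * (f x * a (x, k)) +
                                  w k * B k * (f x * b (x, k)))); last first.
    by apply/funext => x; ring.
  rewrite RintegralD//.
  - by rewrite !RintegralZl// -/(A k) -/(B k); ring.
  - exact: (integrableRZ (w k * A k) (ifa)).
  - exact: (integrableRZ (w k * B k) (ifb)).
rewrite -Rintegral_Fubini//.
apply: eq_Rintegral => x _.
pose H (z : T1 * T2) := f z.1 * w z.2 * (a (x, z.2) * a z + b (x, z.2) * b z).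
have iH : integrableR (m1 \x m2)%E H.
  apply: (@integrable_tensor_bounded _ _ _ (1 + 1)) => //.
    apply: measurable_funD; apply: measurable_funM => //.
      exact: measurableT_comp (ma1 x) measurable_snd.
    exact: measurableT_comp (mb1 x) measurable_snd.
  move=> z; apply: le_trans (ler_normD _ _) _; rewrite !normrM.
  by apply: lerD; rewrite -[leRHS]mul1r ler_pM.
have wab y : m2.-integrable setT (EFin \o
   (fun k => w k * (a (x, k) * a (y, k) + b (x, k) * b (y, k)))).
  apply: (@integrable_mul_bounded _ _ _ _ _ _ (1 + 1)) => //.
    by apply: measurable_funD; apply: measurable_funM.
  move=> k; apply: le_trans (ler_normD _ _) _; rewrite !normrM.
  by apply: lerD; rewrite -[leRHS]mul1r ler_pM.
have waAB : m2.-integrable setT (EFin \o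
   (fun k => w k * (a (x, k) * A k + b (x, k) * B k))).
  apply: (@integrable_mul_bounded _ _ _ _ _ _ (N + N)) => //.
    by apply: measurable_funD; apply: measurable_funM.
  move=> k; apply: le_trans (ler_normD _ _) _; rewrite !normrM.
  by apply: lerD; rewrite -[leRHS]mul1r ler_pM.
transitivity (f x * \int[m2]_k \int[m1]_y H (y, k)).
  rewrite (_ : \int[m2]_k G (x, k) =
      f x * \int[m2]_k (w k * (a (x, k) * A k + b (x, k) * B k))); last first.
    by rewrite -RintegralZl//; apply: eq_Rintegral => k _; rewrite /G /=; ring.
  congr (_ * _); apply: eq_Rintegral => k _; rewrite /H /=.
  have ifa := integrable_mul_bounded fi (ma2 k) (fun x => a1 (x, k)).
  have ifb := integrable_mul_bounded fi (mb2 k) (fun x => b1 (x, k)).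
  rewrite [in RHS](_ : (fun y => _) = (fun y => w k * a (x, k) * (f y * a (y, k)) +
                                  w k * b (x, k) * (f y * b (y, k)))); last first.
    by apply/funext => y; ring.
  rewrite RintegralD//.
  - by rewrite !RintegralZl// -/(A k) -/(B k); ring.
  - exact: (integrableRZ (w k * a (x, k)) (ifa)).
  - exact: (integrableRZ (w k * b (x, k)) (ifb)).
rewrite -Rintegral_Fubini// -RintegralZl//; last exact: integrable_Rintegral2.
apply: eq_Rintegral => y _; rewrite -KE -mulrA; congr (_ * _).
by rewrite -RintegralZl//; apply: eq_Rintegral => k _; rewrite /H /=; ring.
Qed.

Lemma le_double_integralD
    (H H1 H2 : T1 * T2 -> R) (c : R) :
  measurable_fun setT H -> measurable_fun setT H1 -> measurable_fun setT H2 ->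
  (forall x, 0 <= H x) -> (forall x, 0 <= H1 x) -> (forall x, 0 <= H2 x) ->
  0 <= c -> (forall x, H x <= c * (H1 x + H2 x)) ->
  (\int[m1]_x \int[m2]_y (H (x, y))%:E <=
   c%:E * (\int[m1]_x \int[m2]_y (H1 (x, y))%:E +
           \int[m1]_x \int[m2]_y (H2 (x, y))%:E))%E.
Proof.
move=> mH mH1 mH2 H0 H10 H20 c0 HH.
have E (G : T1 * T2 -> R) : measurable_fun setT G -> (forall x, 0 <= G x) ->
    (\int[m1]_x \int[m2]_y (G (x, y))%:E = \int[m1 \x m2]_z (G z)%:E)%E.
  by move=> mG G0; rewrite (fubini_tonelli1 (EFin \o G))//; exact/measurable_EFinP.
by rewrite !E//; exact: le_integralD.
Qed.

Lemma measurable_integral2 (G : T1 * T2 -> R) :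
  measurable_fun setT G -> (forall z, 0 <= G z) ->
  measurable_fun setT (fun x => \int[m2]_y (G (x, y))%:E)%E.
Proof.
move=> mG G0; apply: (measurable_fun_fubini_tonelli_F (EFin \o G)).
  exact/measurable_EFinP.
by move=> z; rewrite /= lee_fin.
Qed.

Lemma measurable_integral1 (G : T1 * T2 -> R) :
  measurable_fun setT G -> (forall z, 0 <= G z) ->
  measurable_fun setT (fun y => \int[m1]_x (G (x, y))%:E)%E.
Proof.
move=> mG G0; apply: (measurable_fun_fubini_tonelli_G (EFin \o G)).
  exact/measurable_EFinP.
by move=> z; rewrite /= lee_fin.
Qed.

End two_measures.

(** * Energy against a symmetric kernel *)

Lemma normrM_le_sqrD (R : realType) (p q : R) : `|p * q| <= p ^+ 2 + q ^+ 2.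
Proof.
rewrite ler_norml; have := sqr_ge0 (p + q); have := sqr_ge0 (p - q).
by rewrite !expr2; nra.
Qed.

Section kernels.
Context (d : measure_display) (T : measurableType d) (R : realType)
  (m : {sigma_finite_measure set T -> \bar R}).

Lemma integral_kernel_left
    (g : T -> R) (K : T -> T -> R) (M : R) :
  measurable_fun setT g -> (forall x, 0 <= g x) ->
  measurable_fun setT (fun z : T * T => K z.1 z.2) -> (forall x y, 0 <= K x y) ->
  0 <= M -> (forall x, \int[m]_y (K x y)%:E = M%:E)%E ->
  (\int[m]_x \int[m]_y (g x * K x y)%:E = M%:E * \int[m]_x (g x)%:E)%E.
Proof.
move=> mg g0 mK K0 M0 KM.
rewrite -ge0_integralZl//; last 2 first.
- exact/measurable_EFinP.
- by move=> x _; rewrite lee_fin.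
apply: eq_integral => x _.
under eq_integral do rewrite EFinM.
rewrite ge0_integralZl//; last 3 first.
- by apply/measurable_EFinP; exact: (measurable_fun_pair2 (f := fun z : T * T => K z.1 z.2)).
- by move=> y _; rewrite lee_fin.
- by rewrite lee_fin.
by rewrite KM muleC.
Qed.

Lemma integral_kernel_right
    (g : T -> R) (K : T -> T -> R) (M : R) :
  measurable_fun setT g -> (forall x, 0 <= g x) ->
  measurable_fun setT (fun z : T * T => K z.1 z.2) -> (forall x y, 0 <= K x y) ->
  (forall x y, K x y = K y x) ->
  0 <= M -> (forall x, \int[m]_y (K x y)%:E = M%:E)%E ->
  (\int[m]_x \int[m]_y (g y * K x y)%:E = M%:E * \int[m]_x (g x)%:E)%E.
Proof.
move=> mg g0 mK K0 KC M0 KM.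
rewrite (fubini_tonelli (fun z : T * T => (g z.2 * K z.1 z.2)%:E))//=.
- rewrite -(integral_kernel_left mg g0 mK K0 M0 KM).
  by apply: eq_integral => x _; apply: eq_integral => y _; rewrite KC.
- apply/measurable_EFinP; apply: measurable_funM => //.
  exact: measurableT_comp mg measurable_snd.
- by move=> z; rewrite lee_fin mulr_ge0.
Qed.

(** Polarisation: 2 f(x) f(y) = f(x)^2 + f(y)^2 - (f(x) - f(y))^2, and each square is
    integrated against a kernel of constant mass.  The last term stays an extended
    real, so that it can be compared with bounds obtained by Tonelli's theorem. *)
Lemma double_energy
    (f : T -> R) (K : T -> T -> R) (M : R) :
  measurable_fun setT f -> measurable_fun setT (fun z : T * T => K z.1 z.2) ->
  (forall x y, 0 <= K x y) -> (forall x y, K x y = K y x) ->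
  (forall x, \int[m]_y (K x y)%:E = M%:E)%E ->
  0 <= M -> (energy m f < +oo)%E ->
  ((2 * \int[m]_x \int[m]_y (f x * f y * K x y))%:E
   + \int[m]_x \int[m]_y ((f x - f y) ^+ 2 * K x y)%:E
   = (2 * M)%:E * energy m f)%E.
Proof.
move=> mf mK K0 KC KM M0 f2.
pose F1 (z : T * T) := f z.1 ^+ 2 * K z.1 z.2.
pose F2 (z : T * T) := f z.2 ^+ 2 * K z.1 z.2.
pose F3 (z : T * T) := f z.1 * f z.2 * K z.1 z.2.
pose D (z : T * T) := (f z.1 - f z.2) ^+ 2 * K z.1 z.2.
have mf1 : measurable_fun setT (fun z : T * T => f z.1).
  exact: measurableT_comp mf measurable_fst.
have mf2 : measurable_fun setT (fun z : T * T => f z.2).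
  exact: measurableT_comp mf measurable_snd.
have mF1 : measurable_fun setT F1.
  by apply: measurable_funM => //; exact: measurable_funX.
have mF2 : measurable_fun setT F2.
  by apply: measurable_funM => //; exact: measurable_funX.
have mF3 : measurable_fun setT F3.
  by apply: measurable_funM => //; exact: measurable_funM.
have mD : measurable_fun setT D.
  by apply: measurable_funM => //; apply: measurable_funX; exact: measurable_funB.
have mff : measurable_fun setT (fun x => f x ^+ 2) by exact: measurable_funX.
have int1 : (\int[m]_x \int[m]_y (F1 (x, y))%:E = M%:E * energy m f)%E.
  exact: (integral_kernel_left mff (fun x => sqr_ge0 (f x)) mK K0 M0 KM).
have F10 z : 0 <= F1 z by rewrite mulr_ge0 ?sqr_ge0.
have F20 z : 0 <= F2 z by rewrite mulr_ge0 ?sqr_ge0.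
have D0 z : 0 <= D z by rewrite mulr_ge0 ?sqr_ge0.
have int2 : (\int[m]_y \int[m]_x (F2 (x, y))%:E = M%:E * energy m f)%E.
  rewrite -int1; apply: eq_integral => x _; apply: eq_integral => y _.
  by rewrite /F1 /F2 /= KC.
have Moo : (M%:E * energy m f < +oo)%E by rewrite lte_mul_pinfty.
have iF1 : integrableR (m \x m)%E F1.
  apply/integrable12ltyP; first exact/measurable_EFinP.
  rewrite (le_lt_trans _ Moo)// -int1.
  under eq_integral do under eq_integral do rewrite /= ger0_norm//.
  exact: lexx.
have iF2 : integrableR (m \x m)%E F2.
  apply/integrable21ltyP; first exact/measurable_EFinP.
  rewrite (le_lt_trans _ Moo)// -int2.
  under eq_integral do under eq_integral do rewrite /= ger0_norm//.
  exact: lexx.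
have iF12 : integrableR (m \x m)%E (fun z => F1 z + F2 z).
  exact: integrableRD iF1 iF2.
have iF3 : integrableR (m \x m)%E F3.
  apply: (integrable_dominated mF3 _ iF12) => z.
  rewrite /F1 /F2 /F3 -mulrDl normrM (ger0_norm (K0 _ _)) ler_wpM2r//.
  exact: normrM_le_sqrD.
have iF23 : integrableR (m \x m)%E (fun z => 2 * F3 z).
  exact: integrableRZ iF3.
have DE : D = (fun z => F1 z + F2 z - 2 * F3 z).
  by apply/funext => z; rewrite /D /F1 /F2 /F3; ring.
have iD : integrableR (m \x m)%E D.
  rewrite DE; exact: integrableRB iF12 iF23.
have tF1 : (\int[m \x m]_z (F1 z)%:E = M%:E * energy m f)%E.
  by rewrite -int1 (fubini_tonelli1 (EFin \o F1))//; exact/measurable_EFinP.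
have tF2 : (\int[m \x m]_z (F2 z)%:E = M%:E * energy m f)%E.
  by rewrite -int2 (fubini_tonelli2 (EFin \o F2))//; exact/measurable_EFinP.
have tD : (\int[m \x m]_z (D z)%:E =
    \int[m]_x \int[m]_y ((f x - f y) ^+ 2 * K x y)%:E)%E.
  by rewrite (fubini_tonelli1 (EFin \o D))//; exact/measurable_EFinP.
rewrite -tD -(EFin_Rintegral iD) (Rintegral_prod12 iF3) -EFinD.
rewrite EFinM -muleA -tF1 -(EFin_Rintegral iF1) -EFinM; congr EFin.
rewrite [X in 2 * _ + X](_ : _ = \int[(m \x m)%E]_z (F1 z + F2 z - 2 * F3 z)); last first.
  by apply: eq_Rintegral => z _; rewrite DE.
rewrite RintegralB// RintegralD// RintegralZl//.
have -> : \int[(m \x m)%E]_z F2 z = \int[(m \x m)%E]_z F1 z.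
  by rewrite /Rintegral tF1 tF2.
by ring.
Qed.

End kernels.

(** * The Poisson kernel on the line *)

Section poisson_kernel.
Context (R : realType).

Lemma integral_half_line (f F : R -> R) (l : R) :
  (forall x, 0 <= f x) -> continuous f -> (forall x : R, is_derive x 1 F (f x)) ->
  F x @[x --> +oo] --> l ->
  (\int[leb R]_(x in `[0%R, +oo[) (f x)%:E = (l - F 0)%:E)%E.
Proof.
move=> f0 cf dF Fl.
have cF : continuous F.
  by move=> x; apply/differentiable_continuous/derivable1_diffP; case: (dF x).
rewrite (@ge0_continuous_FTC2y _ f F 0 l)//.
- exact: continuous_subspaceT.
- by apply: cvg_at_right_filter; exact: cF.
- by move=> x _; rewrite derive1E; apply: derive_val.
Qed.

Lemma integral_line_split (f : R -> R) :
  measurable_fun setT f -> (forall x, 0 <= f x) ->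
  (\int[leb R]_x (f x)%:E =
   \int[leb R]_(x in `[0%R, +oo[) (f x)%:E +
   \int[leb R]_(x in `[0%R, +oo[) (f (- x))%:E)%E.
Proof.
move=> mf f0.
have mEf D : measurable_fun D (EFin \o f).
  by apply/measurable_EFinP; exact: measurable_funTS.
rewrite (@ge0_integration_by_substitution0 _ (fun x => (f (- x))%:E)); last 2 first.
- by apply/measurable_EFinP; exact: measurableT_comp.
- by move=> r; rewrite lee_fin.
under [X in (_ + X)%E]eq_integral do rewrite opprK.
rewrite -(integral_itv_obnd_cbnd (mEf _)).
rewrite -ge0_integral_setU//=.
- congr (integral _ _ _); apply/seteqP; split => // x _ /=.
  by rewrite !in_itv/= andbT; case: (ltP 0 x) => ?; [left|right].
- exact: mEf.
- by move=> x _; rewrite lee_fin.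
- apply/disj_setPS => x /=; rewrite !in_itv/= andbT => -[x0].
  by rewrite leNgt x0.
Qed.

Lemma integral_line (f F : R -> R) (l1 l2 : R) :
  (forall x, 0 <= f x) -> continuous f -> (forall x : R, is_derive x 1 F (f x)) ->
  F x @[x --> +oo] --> l1 -> F (- x) @[x --> +oo] --> l2 ->
  (\int[leb R]_x (f x)%:E = (l1 - l2)%:E)%E.
Proof.
move=> f0 cf dF Fl1 Fl2.
rewrite integral_line_split//; last exact: continuous_measurable_fun.
rewrite (integral_half_line f0 cf dF Fl1).
have dG (x : R) : is_derive x 1 (fun x => - F (- x)) (f (- x)).
  have h : is_derive x 1 (F \o -%R) (f (- x) * - 1).
    by apply: is_derive1_comp; exact: dF.
  have -> : f (- x) = - (f (- x) * - 1) by ring.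
  exact: is_deriveN h.
have cg : continuous (fun x => f (- x)).
  by move=> x; apply: continuous_comp; [exact: continuousN|exact: cf].
rewrite (integral_half_line (fun x => f0 (- x)) cg dG (cvgN Fl2)).
by rewrite -EFinD oppr0; congr EFin; ring.
Qed.

Lemma measurable_cos : measurable_fun [set: R] cos.
Proof. by apply: continuous_measurable_fun; exact: continuous_cos. Qed.

Lemma measurable_sin : measurable_fun [set: R] sin.
Proof. by apply: continuous_measurable_fun; exact: continuous_sin. Qed.

(** The factor in frequency is exp (- e |k|) because it has an explicit positive
    transform; it plays the part usually given to a Gaussian. *)
Definition damping (e k : R) : R := expR (- (e * `|k|)).

Definition poisson (e z : R) : R := 2 * e / (e ^+ 2 + z ^+ 2).

Lemma damping_gt0 (e k : R) : 0 < damping e k.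
Proof. exact: expR_gt0. Qed.

Lemma measurable_damping (e : R) :
  measurable_fun setT (@damping e).
Proof.
apply: measurableT_comp => //; apply: measurableT_comp => //.
by apply: measurable_funM => //; exact: measurable_normr.
Qed.

Lemma continuous_of_derive (f g : R -> R) :
  (forall x : R, is_derive x 1 f (g x)) -> continuous f.
Proof.
by move=> df x; apply/differentiable_continuous/derivable1_diffP; case: (df x).
Qed.

Lemma cvgy_expRM (e : R) : 0 < e -> expR (- (e * x)) @[x --> +oo] --> 0.
Proof.
move=> e0; apply: (cvg_comp (fun x => e * x) (fun x => expR (- x)) _ (@cvgr_expR R)).
exact: gt0_cvgMry.
Qed.

(** The factor 1 + cos makes the integrand nonnegative, so an explicit primitive
    gives the integral; the cosine alone is recovered by subtraction. *)
Lemma integral_damping_half (e z b : R) : 0 < e ->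
  (\int[leb R]_(k in `[0%R, +oo[)
     (expR (- (e * k)) * (1 + cos (z * k + b)))%:E =
   (e^-1 + (e * cos b - z * sin b) / (e ^+ 2 + z ^+ 2))%:E)%E.
Proof.
move=> e0.
have ez : 0 < e ^+ 2 + z ^+ 2 by rewrite ltr_wpDr ?sqr_ge0// exprn_gt0.
pose F k := expR (- (e * k)) * (- e^-1 +
  (z * sin (z * k + b) - e * cos (z * k + b)) / (e ^+ 2 + z ^+ 2)).
have dF (k : R) : is_derive k 1 F (expR (- (e * k)) * (1 + cos (z * k + b))).
  apply: is_derive_eq; rewrite /GRing.scale /=.
  by field; rewrite (gt_eqF e0) (gt_eqF ez).
have df (k : R) : is_derive k 1 (fun k => expR (- (e * k)) * (1 + cos (z * k + b)))
   (- expR (- (e * k)) * (e * (1 + cos (z * k + b)) + z * sin (z * k + b))).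
  by apply: is_derive_eq; rewrite /GRing.scale /=; ring.
have f0 k : 0 <= expR (- (e * k)) * (1 + cos (z * k + b)).
  by rewrite mulr_ge0 ?expR_ge0// -lerBlDl sub0r cos_geN1.
have Fl : F k @[k --> +oo] --> 0.
  pose C := e^-1 + (`|z| + e) / (e ^+ 2 + z ^+ 2).
  apply/norm_cvg0P; apply: (@squeeze_cvgr _ _ _ _ (cst 0) (fun k => expR (- (e * k)) * C)).
  + apply: nearW => k; rewrite normr_ge0/= /F normrM ger0_norm ?expR_ge0//.
    rewrite ler_wpM2l ?expR_ge0//; apply: le_trans (ler_normD _ _) _.
    rewrite normrN (ger0_norm (_ : 0 <= e^-1)) ?invr_ge0 ?(ltW e0)// lerD2l normrM.
    rewrite [`|(e ^+ 2 + z ^+ 2)^-1|]ger0_norm ?invr_ge0 ?(ltW ez)//.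
    rewrite ler_wpM2r ?invr_ge0 ?(ltW ez)//.
    apply: le_trans (ler_normB _ _) _; rewrite !normrM (gtr0_norm e0).
    by apply: lerD; rewrite ler_piMr ?(ltW e0)// ler_norml ?sin_geN1 ?sin_le1 ?cos_geN1 ?cos_le1.
  + exact: cvg_cst.
  + by rewrite -[0](mul0r C); apply: cvgMr_tmp; exact: cvgy_expRM.
rewrite (integral_half_line f0 (continuous_of_derive df) dF Fl).
congr EFin; rewrite /F !mulr0 oppr0 expR0 !add0r mul1r opprD opprK.
by rewrite -mulNr opprB.
Qed.

Lemma integral_damping1 (e z b : R) : 0 < e ->
  (\int[leb R]_k (damping e k * (1 + cos (z * k + b)))%:E =
   (2 / e + cos b * poisson e z)%:E)%E.
Proof.
move=> e0.
have ez : 0 < e ^+ 2 + z ^+ 2 by rewrite ltr_wpDr ?sqr_ge0// exprn_gt0.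
have mw := measurable_damping e.
rewrite integral_line_split; last 2 first.
- apply: measurable_funM => //; apply: measurable_funD => //.
  apply: measurableT_comp; first exact: measurable_cos.
  by apply: measurable_funD => //; exact: measurable_funM.
- by move=> k; rewrite mulr_ge0 ?(ltW (damping_gt0 _ _))// -lerBlDl sub0r cos_geN1.
rewrite (_ : (\int[_]_(x in _) _)%E =
   (e^-1 + (e * cos b - z * sin b) / (e ^+ 2 + z ^+ 2))%:E); last first.
  rewrite -(integral_damping_half z b e0); apply: eq_integral => k.
  by rewrite inE/= in_itv/= andbT => k0; rewrite /damping ger0_norm.
rewrite (_ : (\int[_]_(x in _) _)%E =
   (e^-1 + (e * cos b - (- z) * sin b) / (e ^+ 2 + (- z) ^+ 2))%:E); last first.
  rewrite -(integral_damping_half (- z) b e0); apply: eq_integral => k.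
  rewrite inE/= in_itv/= andbT => k0.
  by rewrite /damping normrN ger0_norm// mulrN mulNr.
rewrite -EFinD sqrrN /poisson; congr EFin; field.
by rewrite (gt_eqF e0) (gt_eqF ez).
Qed.

Lemma integral_damping (e : R) : 0 < e ->
  (\int[leb R]_k (damping e k)%:E = (2 / e)%:E)%E.
Proof.
move=> e0; have := integral_damping1 0 (pi / 2) e0.
rewrite cos_pihalf mul0r addr0 => <-; apply: eq_integral => k _.
by rewrite mul0r add0r cos_pihalf addr0 mulr1.
Qed.

Lemma integrable_damping (e : R) : 0 < e ->
  integrableR (leb R) (@damping e).
Proof.
move=> e0; apply/integrableP; split.
  by apply/measurable_EFinP; exact: measurable_damping.
under eq_integral do rewrite /= ger0_norm ?(ltW (damping_gt0 _ _))//.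
by rewrite integral_damping// ltry.
Qed.

Lemma Rintegral_damping_cos (e z b : R) : 0 < e ->
  \int[leb R]_k (damping e k * cos (z * k + b)) =
  cos b * poisson e z.
Proof.
move=> e0; have iw := integrable_damping e0.
have mc : measurable_fun setT (fun k : R => cos (z * k + b)).
  apply: measurableT_comp; first exact: measurable_cos.
  by apply: measurable_funD => //; exact: measurable_funM.
have iwc : integrableR (leb R) (fun k => damping e k * cos (z * k + b)).
  by apply: (integrable_mul_bounded (C := 1) iw mc) => k; rewrite ler_norml cos_geN1 cos_le1.
have : \int[leb R]_k (damping e k * (1 + cos (z * k + b))) =
   2 / e + cos b * poisson e z by rewrite /Rintegral integral_damping1.
rewrite (_ : (fun k => _) = (fun k => damping e k + damping e k * cos (z * k + b))).
  rewrite RintegralD// {1}/Rintegral integral_damping//=.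
  by move=> /addrI.
by apply/funext => k; rewrite mulrDr mulr1.
Qed.

Lemma poisson_gt0 (e z : R) : 0 < e -> 0 < poisson e z.
Proof.
move=> e0; rewrite /poisson divr_gt0 ?mulr_gt0//.
by rewrite ltr_wpDr ?sqr_ge0// exprn_gt0.
Qed.

Lemma poissonC (e x y : R) : poisson e (x - y) = poisson e (y - x).
Proof. by rewrite /poisson -[in RHS]opprB sqrrN. Qed.

Lemma continuous_poisson (e : R) : 0 < e -> continuous (@poisson e).
Proof.
move=> e0 z; apply: cvgM; first exact: cvg_cst.
apply: cvgV.
  by apply: lt0r_neq0; rewrite ltr_wpDr ?sqr_ge0// exprn_gt0.
have dq (w : R) : is_derive w 1 (fun w => e ^+ 2 + w ^+ 2) (2 * w).
  by apply: is_derive_eq; rewrite /GRing.scale /=; ring.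
exact: (continuous_of_derive dq).
Qed.

Lemma measurable_poisson (e : R) : 0 < e ->
  measurable_fun setT (@poisson e).
Proof. by move=> e0; apply: continuous_measurable_fun; exact: continuous_poisson. Qed.

Lemma integral_poisson (e x : R) : 0 < e ->
  (\int[leb R]_y (poisson e (x - y))%:E = (2 * pi)%:E)%E.
Proof.
move=> e0; pose F y : R := 2 * atan ((y - x) / e).
have ez y : 0 < e ^+ 2 + (y - x) ^+ 2 by rewrite ltr_wpDr ?sqr_ge0// exprn_gt0.
have dF (y : R) : is_derive y 1 F (poisson e (x - y)).
  apply: is_derive_eq; rewrite /GRing.scale /= poissonC /poisson.
  field; rewrite (gt_eqF e0)/= (gt_eqF (ez y)) andbT /=.
  by have := ez y; nra.
have Fl : F y @[y --> +oo] --> pi.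
  rewrite [X in _ --> X](_ : pi = 2 * (pi / 2)); last by field.
  apply: cvgMl_tmp.
  apply: (cvg_comp (fun y => (y - x) / e) atan _ (@cvgy_atan R)).
  by apply: gt0_cvgMly; [rewrite invr_gt0|exact: cvg_addrr].
have FNl : F (- y) @[y --> +oo] --> - pi.
  rewrite [X in _ --> X](_ : - pi = 2 * - (pi / 2)); last by field.
  rewrite (_ : (fun y => F (- y)) = (fun y => 2 * - atan ((y + x) / e))); last first.
    by apply/funext => y; rewrite /F -atanN -mulNr opprD.
  apply: cvgMl_tmp; apply: cvgN.
  apply: (cvg_comp (fun y => (y + x) / e) atan _ (@cvgy_atan R)).
  by apply: gt0_cvgMly; [rewrite invr_gt0|exact: cvg_addrr].
have cK : continuous (fun y => poisson e (x - y)).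
  move=> y; apply: (@continuous_comp _ _ _ (fun y => x - y) (@poisson e)).
    by apply: cvgB; [exact: cvg_cst|exact: cvg_id].
  exact: continuous_poisson.
rewrite (integral_line _ cK dF Fl FNl).
- by congr EFin; ring.
- by move=> y; apply/ltW; exact: poisson_gt0.
Qed.

End poisson_kernel.

(** * Oscillation against a kernel *)

(** The mean square difference of [f] at two points, weighted by a kernel.  With an
    approximate identity for kernel it measures the distance from [f] to its
    mollification. *)
Definition oscillation (d : measure_display) (T : measurableType d)
    (R : realType) (m : {measure set T -> \bar R}) (K : T -> T -> R)
    (f : T -> R) : \bar R :=
  (\int[m]_x \int[m]_y ((f x - f y) ^+ 2 * K x y)%:E)%E.

Definition vanishing (R : realType) (u : nat -> \bar R) : Prop :=
  forall eta : R, 0 < eta -> \forall n \near \oo, (u n <= eta%:E)%E.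

Lemma cvg_vanishing (R : realType) (u : nat -> \bar R) :
  u @ \oo --> 0%E -> vanishing u.
Proof.
move=> /fine_cvgP[fu /cvgrPdist_le u0] eta eta0.
near=> n; have fn : u n \is a fin_num by near: n.
rewrite -(fineK fn) lee_fin (le_trans (ler_norm _))//.
have : `|0 - fine (u n)| <= eta by near: n; exact: u0.
by rewrite sub0r normrN.
Unshelve. all: by end_near. Qed.

Lemma vanishing_cvg (R : realType) (u : nat -> \bar R) :
  (forall n, 0 <= u n)%E -> vanishing u -> u @ \oo --> 0%E.
Proof.
move=> u0 vu; apply/fine_cvgP; split.
  have := vu 1 ltr01; apply: filterS => n un.
  by rewrite ge0_fin_numE// (le_lt_trans un)// ltry.
apply/cvgrPdist_le => eta eta0; have := vu eta eta0; apply: filterS => n un.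
rewrite sub0r normrN ger0_norm ?fine_ge0//= -lee_fin fineK//.
by rewrite ge0_fin_numE// (le_lt_trans un)// ltry.
Qed.

Lemma vanishing_le (R : realType) (u v w : nat -> \bar R) (c : R) :
  0 <= c -> (forall n, u n <= c%:E * (v n + w n))%E -> vanishing v -> vanishing w ->
  vanishing u.
Proof.
move=> c0 uvw vv vw eta eta0; pose del := eta / (2 * (c + 1)).
have c1 : 0 < c + 1 by rewrite ltr_wpDl.
have del0 : 0 < del by rewrite divr_gt0 ?mulr_gt0.
near=> n; apply: le_trans (uvw n) _.
have vn : (v n <= del%:E)%E by near: n; exact: vv.
have wn : (w n <= del%:E)%E by near: n; exact: vw.
apply: (@le_trans _ _ (c%:E * (del%:E + del%:E))%E).
  by apply: lee_wpmul2l; rewrite ?lee_fin//; exact: leeD.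
rewrite -EFinD -EFinM lee_fin /del.
rewrite (_ : c * _ = c / (c + 1) * eta); last by field; rewrite (gt_eqF c1).
by rewrite ler_piMl ?(ltW eta0)// ler_pdivrMr// mul1r lerDl.
Unshelve. all: by end_near. Qed.

Lemma oscillation_ge0 (d : measure_display) (T : measurableType d)
    (R : realType) (m : {measure set T -> \bar R}) (K : T -> T -> R)
    (f : T -> R) : (forall x y, 0 <= K x y) -> (0 <= oscillation m K f)%E.
Proof.
move=> K0; apply: integral_ge0 => x _; apply: integral_ge0 => y _.
by rewrite lee_fin mulr_ge0 ?sqr_ge0.
Qed.

Lemma measurable_sqr_diff (d : measure_display) (T : measurableType d)
    (R : realType) (K : T -> T -> R) (f : T -> R) :
  measurable_fun setT f -> measurable_fun setT (fun z : T * T => K z.1 z.2) ->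
  measurable_fun setT (fun z : T * T => (f z.1 - f z.2) ^+ 2 * K z.1 z.2).
Proof.
move=> mf mK; apply: measurable_funM => //; apply: measurable_funX.
by apply: measurable_funB; apply: measurableT_comp mf _;
  [exact: measurable_fst|exact: measurable_snd].
Qed.

Lemma sqrB_le (R : realType) (p q : R) : (p - q) ^+ 2 <= 2 * (p ^+ 2 + q ^+ 2).
Proof. by have := sqr_ge0 (p + q); rewrite !expr2; nra. Qed.

Lemma sqrD_le (R : realType) (p q : R) : (p + q) ^+ 2 <= 2 * (p ^+ 2 + q ^+ 2).
Proof. by have := sqr_ge0 (p - q); rewrite !expr2; nra. Qed.

(** With [oscillation_split], this makes the oscillation continuous in L^2, so that it
    need only be studied on a dense class. *)
Lemma oscillation_le (d : measure_display) (T : measurableType d)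
    (R : realType) (m : {sigma_finite_measure set T -> \bar R})
    (K : T -> T -> R) (M : R) (f : T -> R) :
  measurable_fun setT f -> measurable_fun setT (fun z : T * T => K z.1 z.2) ->
  (forall x y, 0 <= K x y) -> (forall x y, K x y = K y x) ->
  (forall x, \int[m]_y (K x y)%:E = M%:E)%E -> 0 <= M ->
  (oscillation m K f <= (4 * M)%:E * energy m f)%E.
Proof.
move=> mf mK K0 KC KM M0.
have mf2 : measurable_fun setT (fun x => f x ^+ 2) by exact: measurable_funX.
apply: (@le_trans _ _ (2%:E * (\int[m]_x \int[m]_y (f x ^+ 2 * K x y)%:E +
    \int[m]_x \int[m]_y (f y ^+ 2 * K x y)%:E))%E).
  apply: (@le_double_integralD _ _ _ _ _ m m
    (fun z => (f z.1 - f z.2) ^+ 2 * K z.1 z.2)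
    (fun z => f z.1 ^+ 2 * K z.1 z.2) (fun z => f z.2 ^+ 2 * K z.1 z.2)) => //.
  - exact: measurable_sqr_diff.
  - by apply: measurable_funM => //; exact: measurableT_comp mf2 measurable_fst.
  - by apply: measurable_funM => //; exact: measurableT_comp mf2 measurable_snd.
  - by move=> z; rewrite mulr_ge0 ?sqr_ge0.
  - by move=> z; rewrite mulr_ge0 ?sqr_ge0.
  - by move=> z; rewrite mulr_ge0 ?sqr_ge0.
  - by move=> z; rewrite -mulrDl mulrA ler_wpM2r// sqrB_le.
rewrite (integral_kernel_left mf2 (fun x => sqr_ge0 (f x)) mK K0 M0 KM).
rewrite (integral_kernel_right mf2 (fun x => sqr_ge0 (f x)) mK K0 KC M0 KM).
have I0 : (0 <= energy m f)%E.
  by apply: integral_ge0 => x _; rewrite lee_fin sqr_ge0.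
rewrite -ge0_muleDl ?lee_fin// muleA -EFinD -EFinM.
by rewrite (_ : 2 * (M + M) = 4 * M)//; ring.
Qed.

Lemma oscillation_split (d : measure_display) (T : measurableType d)
    (R : realType) (m : {sigma_finite_measure set T -> \bar R})
    (K : T -> T -> R) (f g : T -> R) :
  measurable_fun setT f -> measurable_fun setT g ->
  measurable_fun setT (fun z : T * T => K z.1 z.2) ->
  (forall x y, 0 <= K x y) ->
  (oscillation m K f <= 2%:E * (oscillation m K g +
     oscillation m K (fun x => (f x - g x)%R)))%E.
Proof.
move=> mf mg mK K0.
have mfg : measurable_fun setT (fun x => f x - g x) by exact: measurable_funB.
apply: (@le_double_integralD _ _ _ _ _ m m
    (fun z => (f z.1 - f z.2) ^+ 2 * K z.1 z.2)
    (fun z => (g z.1 - g z.2) ^+ 2 * K z.1 z.2)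
    (fun z => ((f z.1 - g z.1) - (f z.2 - g z.2)) ^+ 2 * K z.1 z.2)) => //.
- exact: measurable_sqr_diff.
- exact: measurable_sqr_diff.
- exact: (measurable_sqr_diff mfg).
- by move=> z; rewrite mulr_ge0 ?sqr_ge0.
- by move=> z; rewrite mulr_ge0 ?sqr_ge0.
- by move=> z; rewrite mulr_ge0 ?sqr_ge0.
- move=> z; rewrite -mulrDl mulrA ler_wpM2r//.
  by apply: le_trans (sqrD_le _ _); rewrite [X in X ^+ 2 <= _](_ : _ =
    (g z.1 - g z.2) + (f z.1 - g z.1 - (f z.2 - g z.2)))//; ring.
Qed.

Definition kernel1 (R : realType) (n : nat) (x y : R) : R :=
  poisson (n.+1%:R^-1) (x - y).

Lemma kernel1_ge0 (R : realType) (n : nat) (x y : R) : 0 <= kernel1 n x y.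
Proof. by apply/ltW; apply: poisson_gt0; rewrite invr_gt0. Qed.

Lemma kernel1C (R : realType) (n : nat) (x y : R) : kernel1 n x y = kernel1 n y x.
Proof. exact: poissonC. Qed.

Lemma measurable_kernel1 (R : realType) (n : nat) :
  measurable_fun [set: measurableTypeR R * measurableTypeR R]
    (fun z => kernel1 n z.1 z.2).
Proof.
apply: (measurableT_comp (@measurable_poisson R (n.+1%:R^-1) _)).
  by rewrite invr_gt0.
by apply: measurable_funB; [exact: measurable_fst|exact: measurable_snd].
Qed.

Lemma integral_kernel1 (R : realType) (n : nat) (x : R) :
  (\int[leb R]_y (kernel1 n x y)%:E = (2 * pi)%:E)%E.
Proof. by apply: integral_poisson; rewrite invr_gt0. Qed.

Lemma poisson_tail (R : realType) (e rho z : R) : 0 < e -> 0 < rho -> rho <= `|z| ->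
  poisson e z <= e * (1 + rho ^- 2) * poisson 1 z.
Proof.
move=> e0 r0 rz; have z2 : rho ^+ 2 <= z ^+ 2.
  by rewrite -(real_normK (num_real z)) lerXn2r ?nnegrE ?(ltW r0).
have r2 : 0 < rho ^+ 2 by exact: exprn_gt0.
have z0 : 0 < z ^+ 2 by exact: lt_le_trans r2 z2.
have z1 : 0 < 1 + z ^+ 2 by rewrite ltr_wpDr ?sqr_ge0.
have ez : 0 < e ^+ 2 + z ^+ 2 by rewrite ltr_wpDr ?sqr_ge0// exprn_gt0.
rewrite /poisson expr1n [leRHS](_ : _ = 2 * e * ((1 + rho ^- 2) / (1 + z ^+ 2))); last first.
  by field; rewrite (gt_eqF r0) (gt_eqF z1).
rewrite ler_wpM2l ?mulr_ge0 ?(ltW e0)//.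
apply: (@le_trans _ _ (z ^+ 2)^-1).
  by rewrite lef_pV2 ?posrE// lerDr sqr_ge0.
rewrite ler_pdivlMr// mulrC ler_pdivrMr// mulrDl mul1r addrC lerD2l.
by rewrite mulrC ler_pdivlMr// mul1r.
Qed.

(** * Oscillation of a square integrable function on the line *)

Section bounded_cutoff.
Context (R : realType).

(** At a point where [f] varies little over a distance [rho], the Poisson average of
    the square difference splits into the part within [rho], bounded by [eta], and
    a tail of order [e]. *)
Lemma integral_poisson_diff_le (f : R -> R) (B e eta rho x : R) :
  measurable_fun setT f -> (forall y, `|f y| <= B) -> 0 < e -> 0 <= eta -> 0 < rho ->
  (forall y, `|x - y| < rho -> (f x - f y) ^+ 2 <= eta) ->
  (\int[leb R]_y ((f x - f y) ^+ 2 * poisson e (x - y))%:E <=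
   (2 * pi * (eta + 4 * B ^+ 2 * (e * (1 + rho ^- 2))))%:E)%E.
Proof.
move=> mf fB e0 eta0 r0 fx.
have B0 : 0 <= B by apply: le_trans (fB 0).
have mp c : 0 < c -> measurable_fun [set: R] (fun y => poisson c (x - y)).
  move=> c0; apply: measurableT_comp; first exact: measurable_poisson.
  exact: measurable_funB.
have p0 c y : 0 < c -> 0 <= poisson c (x - y) by move=> c0; apply/ltW; exact: poisson_gt0.
pose C := 4 * B ^+ 2 * (e * (1 + rho ^- 2)).
have C0 : 0 <= C.
  by rewrite !mulr_ge0 ?sqr_ge0 ?(ltW e0)// addr_ge0// invr_ge0 sqr_ge0.
apply: (@le_trans _ _ (1%:E * (\int[leb R]_y (eta * poisson e (x - y))%:E +
   \int[leb R]_y (C * poisson 1 (x - y))%:E))%E).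
  apply: le_integralD => //.
  - apply: measurable_funM; last exact: mp.
    by apply: measurable_funX; exact: measurable_funB.
  - by apply: measurable_funM => //; exact: mp.
  - by apply: measurable_funM => //; exact: mp.
  - by move=> y; rewrite mulr_ge0 ?sqr_ge0 ?p0.
  - by move=> y; rewrite mulr_ge0 ?p0.
  - by move=> y; rewrite mulr_ge0 ?p0.
  - move=> y; rewrite mul1r; have [xy|xy] := ltP `|x - y| rho.
      apply: le_trans (_ : eta * poisson e (x - y) <= _).
        by rewrite ler_wpM2r ?p0// fx.
      by rewrite lerDl mulr_ge0 ?p0.
    apply: le_trans (_ : C * poisson 1 (x - y) <= _); last first.
      by rewrite lerDr mulr_ge0 ?p0.
    rewrite /C -mulrA; apply: ler_pM; rewrite ?sqr_ge0 ?p0//.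
      apply: le_trans (sqrB_le _ _) _.
      have fy z : (f z) ^+ 2 <= B ^+ 2.
        by rewrite -(real_normK (num_real (f z))) lerXn2r ?nnegrE.
      by have := fy x; have := fy y; lra.
    exact: poisson_tail.
rewrite mul1e.
under eq_integral do rewrite EFinM.
under [X in (_ + X)%E]eq_integral do rewrite EFinM.
rewrite !ge0_integralZl ?lee_fin//; last 4 first.
- by apply/measurable_EFinP; exact: mp.
- by move=> y _; rewrite lee_fin p0.
- by apply/measurable_EFinP; exact: mp.
- by move=> y _; rewrite lee_fin p0.
by rewrite !integral_poisson// -!EFinM -EFinD lee_fin -mulrDl mulrC.
Qed.

Definition cutoff (N : R) (g : R -> R) (x : R) : R :=
  if (- N < x) && (x < N) then g x else 0.

Lemma measurable_cutoff (N : R) (g : R -> R) :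
  measurable_fun setT g -> measurable_fun setT (cutoff N g).
Proof.
move=> mg; apply: measurable_fun_ifT => //.
by apply: measurable_and; apply: measurable_fun_ltr.
Qed.

Lemma lebesgue_measure_ball_lty (N : R) :
  (lebesgue_measure (`](- N)%R, N[%classic : set R) < +oo)%E.
Proof. by rewrite lebesgue_measure_itv/=; case: ifP => _; rewrite ?ltry// -EFinB ltry. Qed.

(** A difference of two values vanishes unless one of the two points lies in the
    interval, and by symmetry of the kernel that point may be taken to be the first;
    dominated convergence then applies on an interval of finite length, where the
    inner average tends to zero at each point. *)
Lemma oscillation_cutoff_vanishing (N B : R) (g : R -> R) :
  continuous g -> (forall x, `|g x| <= B) ->
  vanishing (fun n => oscillation (leb R) (@kernel1 R n) (cutoff N g)).
Proof.
move=> cg gB; set f := cutoff N g.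
have B0 : 0 <= B by apply: le_trans (gB 0).
have mf : measurable_fun setT f.
  by apply: measurable_cutoff; exact: continuous_measurable_fun.
have fB x : `|f x| <= B by rewrite /f /cutoff; case: ifP => _; rewrite ?normr0.
pose E : set R := `](- N), N[%classic.
have inE' x : (\1_E x : R) = ((- N < x) && (x < N))%:R.
  by rewrite indicE /E; congr ((nat_of_bool _)%:R); rewrite mem_setE/= in_itv.
pose h n (z : (measurableTypeR R * measurableTypeR R)%type) : R := (f z.1 - f z.2) ^+ 2 * kernel1 n z.1 z.2.
have mh n : measurable_fun setT (h n).
  by apply: measurable_sqr_diff => //; exact: measurable_kernel1.
have h0 n z : 0 <= h n z by rewrite mulr_ge0 ?sqr_ge0 ?kernel1_ge0.
have hC n x y : h n (x, y) = h n (y, x).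
  by rewrite /h /= kernel1C -[in LHS]opprB sqrrN.
pose phi n x := (\int[leb R]_y (h n (x, y))%:E)%E.
have phi0 n x : (0 <= phi n x)%E by apply: integral_ge0 => y _; rewrite lee_fin.
have mphi n : measurable_fun setT (phi n).
  exact: measurable_integral2 (mh n) (h0 n).
have m1 : measurable_fun [set: R] (\1_E : R -> R).
  by apply: measurable_indic; exact: measurable_itv.
have phiE n : (\int[leb R]_x \int[leb R]_y
    (\1_E x * h n (x, y))%:E = \int[leb R]_(x in E) phi n x)%E.
  rewrite [RHS]integral_mkcond; apply: eq_integral => x _.
  rewrite patchE; under eq_integral do rewrite EFinM.
  rewrite ge0_integralZl//; last 2 first.
  - by apply/measurable_EFinP; exact: measurable_fun_pair2.
  - by move=> y _; rewrite lee_fin.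
  by rewrite indicE; case: ifP => _; rewrite ?mul1e ?mul0e.
have oscE n : (oscillation lebesgue_measure (@kernel1 R n) f <=
   1%:E * (\int[leb R]_(x in E) phi n x +
           \int[leb R]_(x in E) phi n x))%E.
  rewrite -{2}phiE.
  have -> : (\int[leb R]_(x in E) phi n x = \int[leb R]_x
     \int[leb R]_y (\1_E y * h n (x, y))%:E)%E.
    rewrite -phiE; transitivity (\int[leb R]_a \int[leb R]_b
        (\1_E a * h n (b, a))%:E)%E.
      by apply: eq_integral => x _; apply: eq_integral => y _; rewrite hC.
    apply/esym; apply: (fubini_tonelli (m1 := leb R)
      (m2 := leb R) (fun z => (\1_E z.2 * h n z)%:E)) => [|z].
      apply/measurable_EFinP; apply: measurable_funM => //.
      exact: measurableT_comp m1 measurable_snd.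
    by rewrite lee_fin mulr_ge0.
  rewrite addeC.
  apply: (@le_double_integralD _ _ _ _ _ _ _ (h n) (fun z => \1_E z.1 * h n z)
    (fun z => \1_E z.2 * h n z)) => //.
  - by apply: measurable_funM => //; exact: measurableT_comp m1 measurable_fst.
  - by apply: measurable_funM => //; exact: measurableT_comp m1 measurable_snd.
  - by move=> z; rewrite mulr_ge0.
  - by move=> z; rewrite mulr_ge0.
  - move=> z; rewrite mul1r -mulrDl !inE'.
    have [z1|z1] := boolP ((- N < z.1) && _); first by rewrite mulrDl mul1r lerDl mulr_ge0.
    have [z2|z2] := boolP ((- N < z.2) && _); first by rewrite add0r mul1r.
    by rewrite /h /f /cutoff (negbTE z1) (negbTE z2) subrr expr0n/= !mul0r mulr0.
have vphi : vanishing (fun n => \int[leb R]_(x in E) phi n x)%E.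
  apply: cvg_vanishing.
  rewrite [X in _ --> X](_ : _ = \int[leb R]_(x in E) (cst 0%E x))%E; last first.
    by rewrite integral0.
  apply: (@dominated_cvg _ _ _ _ _ _ _ _ (cst (2 * pi * (4 * B ^+ 2 + 4 * B ^+ 2 * 2))%:E)) => //.
  - exact: measurable_itv.
  - by move=> n; exact: measurable_funTS.
  - move=> x; rewrite /E/= in_itv/= => /andP[Nx xN].
    apply: vanishing_cvg => // eta eta0.
    pose eta1 := eta / (4 * pi); have eta10 : 0 < eta1 by rewrite divr_gt0// mulr_gt0// pi_gt0.
    pose s := Num.min 1 eta1; have s0 : 0 < s by rewrite lt_min ltr01 eta10.
    have /cvgrPdist_le /(_ s s0) /nbhs_ballP[r /= r0 gr] := cg x.
    pose rho := Num.min r (Num.min (N - x) (x + N)).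
    have rho0 : 0 < rho by rewrite !lt_min r0 subr_gt0 xN /= -ltrBlDr sub0r.
    have frho y : `|x - y| < rho -> (f x - f y) ^+ 2 <= eta1.
      rewrite !lt_min => /and3P[yr yN yN'].
      have -> : f x = g x by rewrite /f /cutoff Nx xN.
      have -> : f y = g y.
        rewrite /f /cutoff ifT//; apply/andP; split.
          by move: yN'; rewrite ltr_norml => /andP[_]; lra.
        by move: yN; rewrite ltr_norml => /andP[]; lra.
      have gs : `|g x - g y| <= s by exact: gr.
      rewrite -(real_normK (num_real _)) expr2.
      apply: (@le_trans _ _ (1 * eta1)); last by rewrite mul1r.
      by apply: ler_pM => //; apply: (le_trans gs); rewrite ge_min lexx ?orbT.
    pose C := 4 * B ^+ 2 * (1 + rho ^- 2).
    have C0 : 0 <= C by rewrite !mulr_ge0 ?sqr_ge0// addr_ge0// invr_ge0 sqr_ge0.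
    have d0 : 0 < eta1 / (C + 1) by rewrite divr_gt0// ltr_wpDl.
    near=> n.
    have en0 : 0 < (n.+1%:R^-1 : R) by rewrite invr_gt0.
    apply: le_trans (integral_poisson_diff_le mf fB en0 (ltW eta10) rho0 frho) _.
    rewrite lee_fin.
    have en : n.+1%:R^-1 < eta1 / (C + 1).
      by near: n; exact: (near_infty_natSinv_lt (PosNum d0)).
    have : 4 * B ^+ 2 * (n.+1%:R^-1 * (1 + rho ^- 2)) <= eta1.
      rewrite (_ : _ * _ = n.+1%:R^-1 * C); last by rewrite /C; ring.
      apply: (@le_trans _ _ (n.+1%:R^-1 * (C + 1))).
        by rewrite ler_wpM2l ?(ltW en0)// lerDl.
      by rewrite -ler_pdivlMr ?ltr_wpDl// ltW.
    move=> h1; rewrite [leRHS](_ : _ = 2 * pi * (eta1 + eta1)); last first.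
      rewrite -[LHS](@divfK _ (4 * pi)) ?gt_eqF ?mulr_gt0 ?pi_gt0//.
      by rewrite -/eta1; ring.
    by rewrite ler_wpM2l ?mulr_ge0 ?pi_ge0// lerD2l.
  - apply/integrableP; split; first exact: measurable_cst.
    rewrite integral_cst; last exact: measurable_itv.
    by rewrite lte_mul_pinfty//; exact: lebesgue_measure_ball_lty.
  - move=> n x Ex; rewrite gee0_abs//.
    have en0 : 0 < (n.+1%:R^-1 : R) by rewrite invr_gt0.
    have B20 : 0 <= 4 * B ^+ 2 by rewrite mulr_ge0 ?sqr_ge0.
    apply: le_trans (@integral_poisson_diff_le f B _ _ 1 x mf fB en0 B20 ltr01 _) _.
      move=> y _; apply: le_trans (sqrB_le _ _) _.
      have fy z : (f z) ^+ 2 <= B ^+ 2.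
        by rewrite -(real_normK (num_real (f z))) lerXn2r ?nnegrE.
      by have := fy x; have := fy y; lra.
    rewrite lee_fin ler_wpM2l ?mulr_ge0 ?pi_ge0// lerD2l ler_wpM2l//.
    rewrite expr1n invr1 -[leRHS]mul1r ler_wpM2r// invf_le1 ?ltr0n//.
    by rewrite ler1n.
exact: (vanishing_le ler01 oscE vphi vphi).
Unshelve. all: by end_near. Qed.

End bounded_cutoff.

Section line_oscillation.
Context (R : realType).

(** Truncating in space and in size reduces the claim to a bounded function on a
    bounded interval, where the square of a difference is controlled by the
    difference itself, so that density in L^1 of the continuous functions suffices. *)
Lemma L2_approx_cutoff (f : R -> R) (eta : R) :
  measurable_fun [set: R] f ->
  (energy (leb R) f < +oo)%E -> 0 < eta ->
  exists (g : R -> R) (N : R),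
    [/\ continuous g, (forall x, `|g x| <= N) &
        (\int[leb R]_x ((f x - cutoff N g x) ^+ 2)%:E <= eta%:E)%E].
Proof.
move=> mf f2 eta0.
pose tr (n : nat) x : R := if `|f x| <= n.+1%:R then f x else 0.
have mtr n : measurable_fun [set: R] (tr n).
  apply: measurable_fun_ifT => //.
  by apply: measurable_fun_ler => //; exact: measurableT_comp.
pose fN n x : R := cutoff n.+1%:R (tr n) x.
have mfN n : measurable_fun [set: R] (fN n) by exact: measurable_cutoff.
have trn n x : `|tr n x| <= n.+1%:R.
  by rewrite /tr; case: ifPn => // _; rewrite normr0.
have v1 : vanishing (fun n => \int[leb R]_x ((f x - fN n x) ^+ 2)%:E)%E.
  apply: cvg_vanishing.
  rewrite [X in _ --> X](_ : _ = \int[leb R]_x (cst 0%E x))%E; last first.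
    by rewrite integral0.
  apply: (@dominated_cvg _ _ R (leb R) setT measurableT
    (fun n x => ((f x - fN n x) ^+ 2)%:E) (cst 0%E) (fun x => (f x ^+ 2)%:E)) => //.
  - move=> n; apply/measurable_EFinP; apply: measurable_funX.
    by apply: measurable_funB => //; exact: mfN.
  - move=> x _; apply: vanishing_cvg => [n|e e0]; first by rewrite lee_fin sqr_ge0.
    have [k fk] : exists k : nat, Num.max `|x| `|f x| < k%:R.
      by exists (Num.bound (Num.max `|x| `|f x|)); apply: archi_boundP; rewrite le_max normr_ge0.
    exists k => // n /= kn.
    have : Num.max `|x| `|f x| < n.+1%:R.
      by rewrite (lt_le_trans fk)// ler_nat (leq_trans kn).
    rewrite gt_max => /andP[]; rewrite ltr_norml => xn fn.
    by rewrite /fN /cutoff xn /tr (ltW fn) subrr expr0n/= lee_fin ltW.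
  - apply/integrableP; split.
      by apply/measurable_EFinP; exact: measurable_funX.
    apply: le_lt_trans f2; apply: ge0_le_integral => //.
    + apply/measurable_EFinP; apply: measurableT_comp => //.
      exact: measurable_funX.
    + by apply/measurable_EFinP; exact: measurable_funX.
    + by move=> x _; rewrite /= lee_fin ger0_norm ?sqr_ge0.
  - move=> n x _; rewrite /= lee_fin ger0_norm ?sqr_ge0// /fN /cutoff /tr.
    by case: ifP => _; [case: ifP => _|]; rewrite ?subr0// subrr expr0n/= sqr_ge0.
have e4 : 0 < eta / 4 by rewrite divr_gt0.
have [n _ /(_ n (leqnn n))/= fn] := v1 _ e4.
pose N : R := n.+1%:R; have N0 : 0 < N by rewrite ltr0n.
pose E : set R := `](- N), N[%classic.
have mE : measurable E by exact: measurable_itv.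
have muE : (lebesgue_measure E < +oo)%E by exact: lebesgue_measure_ball_lty.
have iE : (leb R).-integrable E (EFin \o tr n).
  apply: measurable_bounded_integrable => //; first exact: measurable_funTS (mtr n).
  exists N; split; first exact: num_real.
  by move=> M NM x _ /=; rewrite (le_trans (trn n x))// ltW.
have [g_ [cg ig gcv]] := approximation_continuous_integrable mE muE iE.
have e8 : 0 < eta / (8 * N) by rewrite divr_gt0// mulr_gt0.
have [k _ /(_ k (leqnn k))/= gk] := cvg_vanishing gcv e8.
pose g x := Num.max (- N) (Num.min N (g_ k x)).
have gN x : `|g x| <= N.
  rewrite ler_norml /g le_max lexx/= ge_max ge_min lexx/= andbT.
  by rewrite -subr_ge0 opprK addr_ge0 // ltW.
have ctg : continuous g.
  move=> x; have cst_x (c : R) : {for x, continuous (cst c : R -> R)} by exact: cst_continuous.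
  exact: (continuous_max (cst_x (- N)) (continuous_min (cst_x N) (cg k x))).
have mg : measurable_fun [set: R] g by exact: continuous_measurable_fun.
have clip x : `|tr n x - g x| <= `|tr n x - g_ k x|.
  have := trn n x; rewrite -/N ler_norml => /andP[h1 h2].
  rewrite /g; have [h3|h3] := leP N (g_ k x).
    rewrite max_r; last by rewrite -subr_ge0 opprK addr_ge0 // ltW.
    by rewrite !ler0_norm; lra.
  have [h4|h4] := leP (- N) (g_ k x) => //.
  by rewrite !ger0_norm; lra.
exists g, N; split => //.
apply: (@le_trans _ _ (2%:E * (\int[leb R]_x ((f x - fN n x) ^+ 2)%:E +
   \int[leb R]_x ((fN n x - cutoff N g x) ^+ 2)%:E))%E).
  apply: le_integralD => //.
  - apply: measurable_funX; apply: measurable_funB; [exact: mf|exact: measurable_cutoff].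
  - by apply: measurable_funX; apply: measurable_funB => //; exact: mfN.
  - apply: measurable_funX; apply: measurable_funB; [exact: mfN|exact: measurable_cutoff].
  - by move=> x; rewrite sqr_ge0.
  - by move=> x; rewrite sqr_ge0.
  - by move=> x; rewrite sqr_ge0.
  - by move=> x; rewrite (le_trans _ (sqrD_le _ _))// addrA subrK.
have h2 : (\int[leb R]_x ((fN n x - cutoff N g x) ^+ 2)%:E
    <= (eta / 4)%:E)%E.
  apply: (@le_trans _ _ (\int[leb R]_(x in E)
     ((2 * N)%:E * `|(tr n x - g_ k x)%:E|))%E).
    rewrite [leRHS]integral_mkcond; apply: ge0_le_integral => //.
    - by move=> x _; rewrite lee_fin sqr_ge0.
    - apply/measurable_EFinP; apply: measurable_funX.
      by apply: measurable_funB; [exact: mfN|exact: measurable_cutoff].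
    - apply/(measurable_restrictT _ _).1 => //.
      apply: measurable_funeM; apply: measurableT_comp => //.
      apply/measurable_EFinP; apply: measurable_funB.
        exact: measurable_funTS (mtr n).
      by apply: measurable_funTS; exact: continuous_measurable_fun.
    - move=> x _; rewrite patchE /fN /cutoff -/N.
      have -> : x \in E = (- N < x) && (x < N).
        by rewrite /E mem_setE/= in_itv.
      case: ifP => _; last by rewrite subrr expr0n.
      rewrite -EFinM lee_fin -(real_normK (num_real _)) expr2.
      apply: ler_pM => //; apply: le_trans (ler_normB _ _) _.
      by have := gN x; have := trn n x; rewrite -/N; lra.
  rewrite ge0_integralZl//; last 2 first.
  - apply: measurableT_comp => //.
    apply/measurable_EFinP; apply: measurable_funB.
      exact: measurable_funTS (mtr n).
    by apply: measurable_funTS; exact: continuous_measurable_fun.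
  - by rewrite lee_fin mulr_ge0// ltW.
  apply: (@le_trans _ _ ((2 * N)%:E * (eta / (8 * N))%:E)%E).
    by apply: lee_wpmul2l => //; rewrite lee_fin mulr_ge0// ltW.
  rewrite -EFinM lee_fin; move: (N) N0 => p p0.
  by rewrite le_eqVlt; apply/orP; left; apply/eqP; field; rewrite (gt_eqF p0).
apply: (@le_trans _ _ (2%:E * ((eta / 4)%:E + (eta / 4)%:E))%E).
  by apply: lee_wpmul2l; rewrite ?lee_fin//; exact: leeD.
by rewrite -EFinD -EFinM lee_fin; lra.
Qed.

Lemma oscillation1_vanishing (f : R -> R) :
  measurable_fun [set: R] f ->
  (energy (leb R) f < +oo)%E ->
  vanishing (fun n => oscillation (leb R) (@kernel1 R n) f).
Proof.
move=> mf f2 eta eta0.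
have p0 : 0 < 16 * (2 * pi : R) by rewrite !mulr_gt0// pi_gt0.
have e1 : 0 < eta / (16 * (2 * pi)) by rewrite divr_gt0.
have [g [N [cg gN gf]]] := L2_approx_cutoff mf f2 e1.
have mg : measurable_fun [set: R] (cutoff N g).
  by apply: measurable_cutoff; exact: continuous_measurable_fun.
have e4 : 0 < eta / 4 by rewrite divr_gt0.
have := oscillation_cutoff_vanishing N cg gN e4; apply: filterS => n hn.
have h1 := oscillation_split (leb R) mf mg (@measurable_kernel1 R n) (@kernel1_ge0 R n).
apply: le_trans h1 _.
have h2 : (oscillation lebesgue_measure (@kernel1 R n) (fun x => (f x - cutoff N g x)%R)
    <= (eta / 4)%:E)%E.
  apply: le_trans (oscillation_le (m := leb R) (M := 2 * pi) _ (@measurable_kernel1 R n)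
    (@kernel1_ge0 R n) (@kernel1C R n) (@integral_kernel1 R n) _) _.
  - exact: measurable_funB.
  - by rewrite mulr_ge0// pi_ge0.
  apply: (@le_trans _ _ ((4 * (2 * pi))%:E * (eta / (16 * (2 * pi)))%:E)%E).
    by apply: lee_wpmul2l => //; rewrite lee_fin !mulr_ge0// pi_ge0.
  rewrite -EFinM lee_fin; move: p0; move: (2 * pi) => p p0.
  rewrite le_eqVlt; apply/orP; left; apply/eqP; field.
  by rewrite pmulr_rgt0// in p0; rewrite (gt_eqF p0).
apply: (@le_trans _ _ (2%:E * ((eta / 4)%:E + (eta / 4)%:E))%E).
  apply: lee_wpmul2l; first by rewrite lee_fin.
  by apply: leeD; [exact: hn|exact: h2].
by rewrite -EFinD -EFinM lee_fin; lra.
Qed.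

End line_oscillation.

(** * Oscillation of a square integrable function in the plane *)

Section plane_kernel.
Context (R : realType).

Lemma integral_mu2_12 (F : plane R -> R) :
  measurable_fun setT F -> (forall z, 0 <= F z) ->
  (\int[@mu2 R]_z (F z)%:E =
   \int[leb R]_x \int[leb R]_y (F (x, y))%:E)%E.
Proof.
move=> mF F0; apply: (fubini_tonelli1 (m1 := leb R)
  (m2 := leb R) (EFin \o F)).
  exact/measurable_EFinP.
by move=> z; rewrite /= lee_fin.
Qed.

Lemma integral_mu2_21 (F : plane R -> R) :
  measurable_fun setT F -> (forall z, 0 <= F z) ->
  (\int[@mu2 R]_z (F z)%:E =
   \int[leb R]_y \int[leb R]_x (F (x, y))%:E)%E.
Proof.
move=> mF F0; apply: (fubini_tonelli2 (m1 := leb R)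
  (m2 := leb R) (EFin \o F)).
  exact/measurable_EFinP.
by move=> z; rewrite /= lee_fin.
Qed.

Definition kernel2 (n : nat) (x y : plane R) : R :=
  kernel1 n x.1 y.1 * kernel1 n x.2 y.2.

Lemma kernel2_ge0 (n : nat) (x y : plane R) : 0 <= kernel2 n x y.
Proof. by rewrite mulr_ge0 ?kernel1_ge0. Qed.

Lemma kernel2C (n : nat) (x y : plane R) : kernel2 n x y = kernel2 n y x.
Proof. by rewrite /kernel2 kernel1C (kernel1C n x.2). Qed.

Lemma measurable_kernel1_comp (d : measure_display) (T : measurableType d) (n : nat) (u v : T -> R) :
  measurable_fun setT u -> measurable_fun setT v ->
  measurable_fun setT (fun z => kernel1 n (u z) (v z)).
Proof.
move=> mu mv; apply: (measurableT_comp (@measurable_poisson R (n.+1%:R^-1) _)).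
  by rewrite invr_gt0.
exact: measurable_funB.
Qed.

Lemma measurable_kernel2 (n : nat) :
  measurable_fun setT (fun z : plane R * plane R => kernel2 n z.1 z.2).
Proof.
apply: measurable_funM; apply: measurable_kernel1_comp.
- exact: (measurableT_comp measurable_fst measurable_fst).
- exact: (measurableT_comp measurable_fst measurable_snd).
- exact: (measurableT_comp measurable_snd measurable_fst).
- exact: (measurableT_comp measurable_snd measurable_snd).
Qed.

Lemma integral_kernel2 (n : nat) (x : plane R) :
  (\int[@mu2 R]_y (kernel2 n x y)%:E = ((2 * pi) ^+ 2)%:E)%E.
Proof.
rewrite integral_mu2_12; last 2 first.
- exact: measurable_fun_pair2 (@measurable_kernel2 n).
- by move=> y; exact: kernel2_ge0.
have mk u : measurable_fun [set: R] (kernel1 n u).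
  exact: measurable_kernel1_comp.
transitivity (\int[leb R]_y ((kernel1 n x.1 y)%:E * (2 * pi)%:E))%E.
  apply: eq_integral => y1 _; rewrite /kernel2 /=.
  under eq_integral do rewrite EFinM.
  rewrite ge0_integralZl ?lee_fin ?kernel1_ge0//; last 2 first.
  - by apply/measurable_EFinP; exact: mk.
  - by move=> y _; rewrite lee_fin kernel1_ge0.
  by rewrite integral_kernel1.
rewrite ge0_integralZr ?lee_fin ?mulr_ge0 ?pi_ge0//; last 2 first.
- by apply/measurable_EFinP; exact: mk.
- by move=> y _; rewrite lee_fin kernel1_ge0.
by rewrite integral_kernel1 -EFinM expr2.
Qed.

(** Moving from [x] to [y] one coordinate at a time bounds the oscillation in the
    plane by oscillations along lines. *)
Lemma oscillation2_le (n : nat) (h : plane R -> R) :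
  measurable_fun setT h ->
  (oscillation (@mu2 R) (@kernel2 n) h <= (2 * (2 * pi))%:E *
    (\int[leb R]_b
        oscillation (leb R) (@kernel1 R n) (fun a => h (a, b)) +
     \int[leb R]_a
        oscillation (leb R) (@kernel1 R n) (fun b => h (a, b))))%E.
Proof.
move=> mh.
pose H1 (z : plane R * plane R) := (h z.1 - h (z.2.1, z.1.2)) ^+ 2 * kernel2 n z.1 z.2.
pose H2 (z : plane R * plane R) := (h (z.2.1, z.1.2) - h z.2) ^+ 2 * kernel2 n z.1 z.2.
have p11 := measurableT_comp (@measurable_fst _ _ R R) (@measurable_fst _ _ (plane R) (plane R)).
have p12 := measurableT_comp (@measurable_snd _ _ R R) (@measurable_fst _ _ (plane R) (plane R)).
have p21 := measurableT_comp (@measurable_fst _ _ R R) (@measurable_snd _ _ (plane R) (plane R)).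
have p22 := measurableT_comp (@measurable_snd _ _ R R) (@measurable_snd _ _ (plane R) (plane R)).
have mh1 : measurable_fun setT (fun z : plane R * plane R => h z.1).
  exact: measurableT_comp mh measurable_fst.
have mh2 : measurable_fun setT (fun z : plane R * plane R => h z.2).
  exact: measurableT_comp mh measurable_snd.
have mhm : measurable_fun setT (fun z : plane R * plane R => h (z.2.1, z.1.2)).
  by apply: (measurableT_comp mh); exact: measurable_fun_pair.
have mH1 : measurable_fun setT H1.
  apply: measurable_funM; last exact: measurable_kernel2.
  by apply: measurable_funX; exact: measurable_funB.
have mH2 : measurable_fun setT H2.
  apply: measurable_funM; last exact: measurable_kernel2.
  by apply: measurable_funX; exact: measurable_funB.
have H10 z : 0 <= H1 z by rewrite mulr_ge0 ?sqr_ge0 ?kernel2_ge0.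
have H20 z : 0 <= H2 z by rewrite mulr_ge0 ?sqr_ge0 ?kernel2_ge0.
apply: (@le_trans _ _ (2%:E * (\int[@mu2 R]_x \int[@mu2 R]_y (H1 (x, y))%:E +
    \int[@mu2 R]_x \int[@mu2 R]_y (H2 (x, y))%:E))%E).
  apply: (@le_double_integralD _ _ _ _ _ _ _
    (fun z => (h z.1 - h z.2) ^+ 2 * kernel2 n z.1 z.2) H1 H2) => //.
  - by apply: measurable_sqr_diff => //; exact: measurable_kernel2.
  - by move=> z; rewrite mulr_ge0 ?sqr_ge0 ?kernel2_ge0.
  - move=> z; rewrite /H1 /H2 -mulrDl mulrA ler_wpM2r ?kernel2_ge0//.
    by rewrite (le_trans _ (sqrD_le _ _))// addrA subrK.
have mk u : measurable_fun [set: R] (kernel1 n u).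
  exact: measurable_kernel1_comp.
have twopi0 : 0 <= 2 * (pi : R) by rewrite mulr_ge0 ?pi_ge0.
(* the second coordinate of [y] only enters the kernel *)
have E1 : (\int[@mu2 R]_x \int[@mu2 R]_y (H1 (x, y))%:E = (2 * pi)%:E *
    \int[leb R]_b
        oscillation (leb R) (@kernel1 R n) (fun a => h (a, b)))%E.
  pose Q (z : plane R * measurableTypeR R) :=
    (h z.1 - h (z.2, z.1.2)) ^+ 2 * kernel1 n z.1.1 z.2.
  have Q0 z : 0 <= Q z by rewrite mulr_ge0 ?sqr_ge0 ?kernel1_ge0.
  have mQ : measurable_fun setT Q.
    apply: measurable_funM.
      apply: measurable_funX; apply: measurable_funB.
        exact: measurableT_comp mh measurable_fst.
      apply: (measurableT_comp mh); apply: measurable_fun_pair.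
        exact: measurable_snd.
      exact: (measurableT_comp measurable_snd measurable_fst).
    apply: measurable_kernel1_comp; last exact: measurable_snd.
    exact: (measurableT_comp measurable_fst measurable_fst).
  pose G x := (\int[leb R]_c (Q (x, c))%:E)%E.
  have mG : measurable_fun setT G := measurable_integral2 (leb R) mQ Q0.
  have G0 x : (0 <= G x)%E by apply: integral_ge0 => c _; rewrite lee_fin.
  transitivity (\int[@mu2 R]_x ((2 * pi)%:E * G x))%E.
    apply: eq_integral => x _.
    rewrite (integral_mu2_12 (F := fun y => H1 (x, y))); last 2 first.
    - exact: measurable_fun_pair2 mH1.
    - by move=> y.
    rewrite /G -ge0_integralZl ?lee_fin//; last 2 first.
    - by apply/measurable_EFinP; exact: measurable_fun_pair2 mQ.
    - by move=> y _; rewrite lee_fin.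
    apply: eq_integral => c _; rewrite /H1 /Q /kernel2 /=.
    under eq_integral do rewrite mulrA EFinM.
    rewrite ge0_integralZl; last 4 first.
    - by [].
    - by apply/measurable_EFinP; exact: mk.
    - by move=> y _; rewrite lee_fin kernel1_ge0.
    - by rewrite lee_fin mulr_ge0 ?sqr_ge0 ?kernel1_ge0.
    by rewrite integral_kernel1 muleC.
  transitivity ((2 * pi)%:E * \int[@mu2 R]_x G x)%E.
    by apply: ge0_integralZl => //; rewrite lee_fin.
  congr (_ * _)%E; transitivity (\int[leb R]_b \int[leb R]_a G (a, b))%E.
    exact: (fubini_tonelli2 (m1 := leb R) (m2 := leb R) G mG G0).
  by apply: eq_integral.
have E2 : (\int[@mu2 R]_x \int[@mu2 R]_y (H2 (x, y))%:E = (2 * pi)%:E *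
    \int[leb R]_a
        oscillation (leb R) (@kernel1 R n) (fun b => h (a, b)))%E.
  pose Q (z : plane R * measurableTypeR R) :=
    (h z.1 - h (z.1.1, z.2)) ^+ 2 * kernel1 n z.1.2 z.2.
  have Q0 z : 0 <= Q z by rewrite mulr_ge0 ?sqr_ge0 ?kernel1_ge0.
  have mQ : measurable_fun setT Q.
    apply: measurable_funM.
      apply: measurable_funX; apply: measurable_funB.
        exact: measurableT_comp mh measurable_fst.
      apply: (measurableT_comp mh); apply: measurable_fun_pair.
        exact: (measurableT_comp measurable_fst measurable_fst).
      exact: measurable_snd.
    apply: measurable_kernel1_comp; last exact: measurable_snd.
    exact: (measurableT_comp measurable_snd measurable_fst).
  transitivity (\int[@mu2 R]_y \int[@mu2 R]_x (H2 (x, y))%:E)%E.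
    apply: (fubini_tonelli (m1 := @mu2 R) (m2 := @mu2 R) (EFin \o H2)).
      exact/measurable_EFinP.
    by move=> z; rewrite /= lee_fin.
  pose G x := (\int[leb R]_c (Q (x, c))%:E)%E.
  have mG : measurable_fun setT G := measurable_integral2 (leb R) mQ Q0.
  have G0 x : (0 <= G x)%E by apply: integral_ge0 => c _; rewrite lee_fin.
  transitivity (\int[@mu2 R]_y ((2 * pi)%:E * G y))%E.
    apply: eq_integral => y _.
    rewrite (integral_mu2_21 (F := fun x => H2 (x, y))); last 2 first.
    - exact: measurable_fun_pair1 mH2.
    - by move=> x.
    rewrite /G -ge0_integralZl ?lee_fin//; last 2 first.
    - by apply/measurable_EFinP; exact: measurable_fun_pair2 mQ.
    - by move=> x _; rewrite lee_fin.
    apply: eq_integral => c _; rewrite /H2 /Q /kernel2 /=.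
    transitivity (\int[leb R]_a (((h (y.1, c) - h y) ^+ 2 *
      kernel1 n c y.2)%:E * (kernel1 n y.1 a)%:E))%E.
      apply: eq_integral => a _; rewrite -EFinM (kernel1C n a); congr EFin; ring.
    rewrite ge0_integralZl; last 4 first.
    - by [].
    - by apply/measurable_EFinP; exact: mk.
    - by move=> x _; rewrite lee_fin kernel1_ge0.
    - by rewrite lee_fin mulr_ge0 ?sqr_ge0 ?kernel1_ge0.
    by rewrite integral_kernel1 muleC kernel1C -[in LHS]opprB sqrrN.
  transitivity ((2 * pi)%:E * \int[@mu2 R]_x G x)%E.
    by apply: ge0_integralZl => //; rewrite lee_fin.
  congr (_ * _)%E; transitivity (\int[leb R]_a \int[leb R]_b G (a, b))%E.
    exact: (fubini_tonelli1 (m1 := leb R) (m2 := leb R) G mG G0).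
  by apply: eq_integral.
have o0 k : (0 <= oscillation (leb R) (@kernel1 R n) k)%E.
  by apply: oscillation_ge0; exact: kernel1_ge0.
rewrite E1 E2 -ge0_muleDr; last 2 first.
- by apply: integral_ge0 => x _.
- by apply: integral_ge0 => x _.
by rewrite muleA EFinM.
Qed.

End plane_kernel.

Section transforms.
Context (R : realType).

(** Almost every line carries a square integrable restriction, to which
    [oscillation1_vanishing] applies; [oscillation_le] dominates the oscillations
    along lines by the energies of the restrictions, which are integrable. *)
Lemma oscillation2_vanishing (h : plane R -> R) :
  measurable_fun setT h -> (energy (@mu2 R) h < +oo)%E ->
  vanishing (fun n => oscillation (@mu2 R) (@kernel2 R n) h).
Proof.
move=> mh h2.
have mh2 : measurable_fun setT (fun z => h z ^+ 2) by exact: measurable_funX.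
have h20 z : 0 <= h z ^+ 2 by exact: sqr_ge0.
have o0 n k : (0 <= oscillation (leb R) (@kernel1 R n) k)%E.
  by apply: oscillation_ge0; exact: kernel1_ge0.
have twopi0 : 0 <= 2 * (pi : R) by rewrite mulr_ge0 ?pi_ge0.
have line (k : plane R -> R) : measurable_fun setT k ->
    (\int[leb R]_b \int[leb R]_a (k (a, b) ^+ 2)%:E < +oo)%E ->
    vanishing (fun n => \int[leb R]_b
        oscillation (leb R) (@kernel1 R n) (fun a => k (a, b)))%E.
  move=> mk k2.
  have mk2 : measurable_fun setT (fun z => k z ^+ 2) by exact: measurable_funX.
  have k20 z : 0 <= k z ^+ 2 by exact: sqr_ge0.
  have mks b : measurable_fun setT (fun a => k (a, b)) by exact: measurable_fun_pair1.
  pose G b := (\int[leb R]_a (k (a, b) ^+ 2)%:E)%E.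
  have G0 b : (0 <= G b)%E by apply: integral_ge0 => a _; rewrite lee_fin.
  have mG : measurable_fun setT G := measurable_integral1 (leb R) mk2 k20.
  have iG : (leb R).-integrable setT G.
    apply/integrableP; split => //.
    by under eq_integral do rewrite gee0_abs//.
  have mo n : measurable_fun setT (fun b : measurableTypeR R =>
      oscillation (leb R) (@kernel1 R n) (fun a => k (a, b))).
    pose Q (z : plane R * measurableTypeR R) :=
      (k z.1 - k (z.2, z.1.2)) ^+ 2 * kernel1 n z.1.1 z.2.
    have Q0 z : 0 <= Q z by rewrite mulr_ge0 ?sqr_ge0 ?kernel1_ge0.
    have mQ : measurable_fun setT Q.
      apply: measurable_funM.
        apply: measurable_funX; apply: measurable_funB.
          exact: measurableT_comp mk measurable_fst.
        apply: (measurableT_comp mk); apply: measurable_fun_pair.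
          exact: measurable_snd.
        exact: (measurableT_comp measurable_snd measurable_fst).
      apply: measurable_kernel1_comp; last exact: measurable_snd.
      exact: (measurableT_comp measurable_fst measurable_fst).
    have mQ1 := measurable_integral2 (leb R) mQ Q0.
    apply: (measurable_fun_fubini_tonelli_G (m1 := leb R)
      (fun x : plane R => \int[leb R]_c (Q (x, c))%:E)%E) => //.
    by move=> x; apply: integral_ge0 => c _; rewrite lee_fin.
  apply: cvg_vanishing.
  rewrite [X in _ --> X](_ : _ = \int[leb R]_x (cst 0%E x))%E; last first.
    by rewrite integral0.
  have [] // := @dominated_convergence _ _ R (leb R) setT measurableT
    (fun n b => oscillation (leb R) (@kernel1 R n) (fun a => k (a, b)))
    (cst 0%E) (fun b => (4 * (2 * pi))%:E * G b)%E.
  - have := integrable_ae measurableT iG; apply: filterS => b /(_ I) Gb _.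
    apply: vanishing_cvg => [n|]; first exact: o0.
    apply: oscillation1_vanishing; first exact: mks.
    by move: Gb; rewrite (ge0_fin_numE (G0 b)).
  - exact: integrableZl.
  - apply: nearW => b n _; rewrite gee0_abs//.
    apply: oscillation_le => //.
    + exact: measurable_kernel1.
    + exact: kernel1_ge0.
    + exact: kernel1C.
    + exact: integral_kernel1.
have msw : measurable_fun setT (fun z : plane R => h (z.2, z.1)).
  exact: (measurableT_comp mh (@measurable_swap _ _ R R)).
apply: (vanishing_le (c := 2 * (2 * pi)) _ (fun n => oscillation2_le n mh)).
- by rewrite mulr_ge0.
- by apply: line => //; rewrite -(integral_mu2_21 mh2 h20).
- apply: (line (fun z => h (z.2, z.1))) => //.
  by rewrite -(integral_mu2_12 mh2 h20).
Qed.

(** * Plancherel's identity *)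

Definition cos_transform (f : plane R -> R) (k : plane R) : R :=
  \int[@mu2 R]_x (f x * cos (dot x k)).

Definition sin_transform (f : plane R -> R) (k : plane R) : R :=
  \int[@mu2 R]_x (f x * sin (dot x k)).

Definition damping2 (e : R) (k : plane R) : R :=
  damping e k.1 * damping e k.2.

Lemma measurable_dot :
  measurable_fun setT (fun z : plane R * plane R => dot z.1 z.2).
Proof.
apply: measurable_funD; apply: measurable_funM.
- exact: (measurableT_comp measurable_fst measurable_fst).
- exact: (measurableT_comp measurable_fst measurable_snd).
- exact: (measurableT_comp measurable_snd measurable_fst).
- exact: (measurableT_comp measurable_snd measurable_snd).
Qed.

Lemma measurable_cos_dot :
  measurable_fun setT (fun z : plane R * plane R => cos (dot z.1 z.2)).
Proof. exact: measurableT_comp (@measurable_cos R) (@measurable_dot). Qed.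

Lemma measurable_sin_dot :
  measurable_fun setT (fun z : plane R * plane R => sin (dot z.1 z.2)).
Proof. exact: measurableT_comp (@measurable_sin R) (@measurable_dot). Qed.

Lemma normr_cos_le1 (a : R) : `|cos a| <= 1.
Proof. by rewrite ler_norml cos_geN1 cos_le1. Qed.

Lemma normr_sin_le1 (a : R) : `|sin a| <= 1.
Proof. by rewrite ler_norml sin_geN1 sin_le1. Qed.

Lemma measurable_cos_transform (f : plane R -> R) :
  measurable_fun setT f -> measurable_fun setT (cos_transform f).
Proof.
move=> mf; apply: (measurable_Rintegral1 (@mu2 R)
  (F := fun z : plane R * plane R => f z.1 * cos (dot z.1 z.2))).
apply: measurable_funM; last exact: measurable_cos_dot.
exact: measurableT_comp mf measurable_fst.
Qed.

Lemma measurable_sin_transform (f : plane R -> R) :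
  measurable_fun setT f -> measurable_fun setT (sin_transform f).
Proof.
move=> mf; apply: (measurable_Rintegral1 (@mu2 R)
  (F := fun z : plane R * plane R => f z.1 * sin (dot z.1 z.2))).
apply: measurable_funM; last exact: measurable_sin_dot.
exact: measurableT_comp mf measurable_fst.
Qed.

Lemma integrable_damping2 (e : R) : 0 < e ->
  integrableR (@mu2 R) (@damping2 e).
Proof.
by move=> e0; apply: (integrable_tensor (m1 := leb R)
  (m2 := leb R)); exact: integrable_damping.
Qed.

Lemma Rintegral_damping2_cos (e : R) (z : plane R) : 0 < e ->
  \int[@mu2 R]_k (damping2 e k * cos (dot z k)) = poisson e z.1 * poisson e z.2.
Proof.
move=> e0.
have iwc : integrableR (@mu2 R) (fun k => damping2 e k * cos (dot z k)).
  apply: (@integrable_mul_bounded _ _ _ _ _ _ 1) (integrable_damping2 e0) _ _.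
    exact: measurable_fun_pair2 (@measurable_cos_dot).
  by move=> k; exact: normr_cos_le1.
have -> : \int[@mu2 R]_k (damping2 e k * cos (dot z k)) =
    \int[leb R]_a \int[leb R]_b
      (damping2 e (a, b) * cos (dot z (a, b))).
  by rewrite (Rintegral_prod12 (m1 := leb R)
    (m2 := leb R) iwc).
have mcb (c d : R) : measurable_fun [set: R] (fun b : R => cos (c * b + d)).
  apply: measurableT_comp; first exact: measurable_cos.
  by apply: measurable_funD => //; exact: measurable_funM.
have iw (c d : R) : integrableR (leb R) (fun b => damping e b * cos (c * b + d)).
  apply: (@integrable_mul_bounded _ _ _ _ _ _ 1) (integrable_damping e0) (mcb c d) _.
  by move=> k; exact: normr_cos_le1.
transitivity (\int[leb R]_a
    (damping e a * cos (z.1 * a + 0) * poisson e z.2)).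
  apply: eq_Rintegral => a _; rewrite /damping2 /dot /=.
  transitivity (\int[leb R]_b
      (damping e a * (damping e b * cos (z.2 * b + z.1 * a)))).
    by apply: eq_Rintegral => b _; rewrite mulrA (addrC (z.2 * b)).
  by rewrite RintegralZl// Rintegral_damping_cos// addr0 mulrA.
by rewrite RintegralZr// Rintegral_damping_cos// cos0 mul1r.
Qed.

End transforms.

Section plancherel.
Context (R : realType).

Lemma kernel2_transform (n : nat) (x y : plane R) :
  \int[@mu2 R]_k (damping2 n.+1%:R^-1 k *
    (cos (dot x k) * cos (dot y k) + sin (dot x k) * sin (dot y k))) = kernel2 n x y.
Proof.
have e0 : 0 < (n.+1%:R^-1 : R) by rewrite invr_gt0.
rewrite -[RHS](Rintegral_damping2_cos ((x.1 - y.1), (x.2 - y.2)) e0).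
apply: eq_Rintegral => k _; rewrite -cosB; congr (_ * cos _).
by rewrite /dot /=; ring.
Qed.

Lemma damped_energy (f : plane R -> R) (n : nat) :
  integrableR (@mu2 R) f ->
  (energy (@mu2 R) f < +oo)%E ->
  (2%:E * \int[@mu2 R]_k (damping2 n.+1%:R^-1 k *
      (cos_transform f k ^+ 2 + sin_transform f k ^+ 2))%:E
   + oscillation (@mu2 R) (@kernel2 R n) f
   = (2 * (2 * pi) ^+ 2)%:E * energy (@mu2 R) f)%E.
Proof.
move=> fi f2; have mf := integrable_measurable fi.
have e0 : 0 < (n.+1%:R^-1 : R) by rewrite invr_gt0.
have iw := integrable_damping2 e0.
have cB k : `|cos_transform f k| <= \int[@mu2 R]_x `|f x|.
  apply: normr_Rintegral_mul_le => //.
    exact: measurable_fun_pair1 (@measurable_cos_dot R).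
  by move=> x; exact: normr_cos_le1.
have sB k : `|sin_transform f k| <= \int[@mu2 R]_x `|f x|.
  apply: normr_Rintegral_mul_le => //.
    exact: measurable_fun_pair1 (@measurable_sin_dot R).
  by move=> x; exact: normr_sin_le1.
have mcs : measurable_fun setT (fun k => cos_transform f k ^+ 2 + sin_transform f k ^+ 2).
  apply: measurable_funD; apply: measurable_funX.
    exact: measurable_cos_transform.
  exact: measurable_sin_transform.
have sqB (u v : R) : `|u| <= v -> u ^+ 2 <= v ^+ 2.
  move=> uv; rewrite -(real_normK (num_real u)) lerXn2r ?nnegrE//.
  exact: le_trans uv.
have iE : integrableR (@mu2 R) (fun k => damping2 n.+1%:R^-1 k *
      (cos_transform f k ^+ 2 + sin_transform f k ^+ 2)).
  apply: (integrable_mul_bounded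
    (C := (\int[@mu2 R]_x `|f x|) ^+ 2 + (\int[@mu2 R]_x `|f x|) ^+ 2) iw mcs) => k.
  rewrite ger0_norm; last by rewrite addr_ge0 ?sqr_ge0.
  by apply: lerD; exact: sqB.
have FE := weighted_transform_energy fi iw (@measurable_cos_dot R) (@measurable_sin_dot R)
  (fun z => normr_cos_le1 (dot z.1 z.2)) (fun z => normr_sin_le1 (dot z.1 z.2))
  (@kernel2_transform n).
have M0 : 0 <= (2 * (pi : R)) ^+ 2 by exact: sqr_ge0.
have DE := double_energy mf (@measurable_kernel2 R n) (@kernel2_ge0 R n)
  (@kernel2C R n) (@integral_kernel2 R n) M0 f2.
by rewrite -DE -FE -(EFin_Rintegral iE) -EFinM.
Qed.

Lemma cvg_damping2 (k : plane R) :
  damping2 n.+1%:R^-1 k @[n --> \oo] --> (1 : R).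
Proof.
have h c : damping n.+1%:R^-1 c @[n --> \oo] --> (1 : R).
  rewrite -[X in _ --> X](@expR0 R) -[X in _ --> expR X]oppr0 -[X in _ --> expR (- X)](mul0r `|c|).
  apply: continuous_cvg; first exact: continuous_expR.
  by apply: cvgN; apply: cvgMr_tmp; exact: cvg_harmonic.
by rewrite -[X in _ --> X](mulr1 1); apply: cvgM; exact: h.
Qed.

Lemma damping2_nondecreasing (k : plane R) (n m : nat) : (n <= m)%N ->
  damping2 n.+1%:R^-1 k <= damping2 m.+1%:R^-1 k.
Proof.
move=> nm; have h c : damping n.+1%:R^-1 c <= damping m.+1%:R^-1 c :> R.
  by rewrite ler_expR lerN2 ler_wpM2r// lef_pV2 ?posrE// ler_nat ltnS.
by apply: ler_pM => //; apply/ltW; exact: damping_gt0.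
Qed.

Lemma damping2_ge0 (e : R) (k : plane R) : 0 <= damping2 e k.
Proof. by rewrite mulr_ge0// ltW// damping_gt0. Qed.

(** Plancherel's theorem on L^1 /\ L^2: damping the frequencies turns the energy of
    the transform into the energy of [f] less half its oscillation against the
    Poisson kernel, and the oscillation disappears with the damping. *)
Theorem plancherel (f : plane R -> R) :
  integrableR (@mu2 R) f ->
  (energy (@mu2 R) f < +oo)%E ->
  (\int[@mu2 R]_k (cos_transform f k ^+ 2 + sin_transform f k ^+ 2)%:E =
   ((2 * pi) ^+ 2)%:E * energy (@mu2 R) f)%E.
Proof.
move=> fi f2; have mf := integrable_measurable fi.
pose e k := cos_transform f k ^+ 2 + sin_transform f k ^+ 2.
have e0 k : 0 <= e k by rewrite addr_ge0 ?sqr_ge0.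
have me : measurable_fun setT e.
  apply: measurable_funD; apply: measurable_funX.
    exact: measurable_cos_transform.
  exact: measurable_sin_transform.
pose g n k := damping2 n.+1%:R^-1 k * e k.
have mg n : measurable_fun setT (g n).
  apply: measurable_funM => //.
  by have := integrable_measurable (@integrable_damping2 R n.+1%:R^-1 _); apply; rewrite invr_gt0.
have g0 n k : 0 <= g n k by rewrite mulr_ge0// damping2_ge0.
have gnd k : {homo (fun n => (g n k)%:E) : n m / (n <= m)%N >-> (n <= m)%E}.
  by move=> n m nm; rewrite lee_fin ler_wpM2r// damping2_nondecreasing.
have cg k : (g n k)%:E @[n --> \oo] --> (e k)%:E.
  apply: cvg_EFin; first by apply: nearW.
  rewrite -[X in _ --> X]mul1r; apply: cvgMr_tmp; exact: cvg_damping2.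
set M := (2 * pi) ^+ 2.
have M0 : 0 <= M by exact: sqr_ge0.
pose I n := (\int[@mu2 R]_k (g n k)%:E)%E.
have IE n : (2%:E * I n + oscillation (@mu2 R) (@kernel2 R n) f =
    (2 * M)%:E * energy (@mu2 R) f)%E by exact: damped_energy.
have I0 n : (0 <= I n)%E by apply: integral_ge0 => k _; rewrite lee_fin.
have o0 n : (0 <= oscillation (@mu2 R) (@kernel2 R n) f)%E.
  by apply: oscillation_ge0; exact: kernel2_ge0.
have cI : I n @[n --> \oo] --> (\int[@mu2 R]_k (e k)%:E)%E.
  rewrite (_ : (fun k => (e k)%:E) = (fun k => limn (fun n => (g n k)%:E))); last first.
    by apply/funext => k; apply/esym/cvg_lim => //; exact: cg.
  apply: (@cvg_monotone_convergence _ _ R (@mu2 R) setT measurableT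
    (fun n k => (g n k)%:E)) => //.
  - by move=> n; apply/measurable_EFinP; exact: mg.
  - by move=> n k _; rewrite lee_fin.
have In n : (I n <= \int[@mu2 R]_k (e k)%:E)%E.
  apply: ge0_le_integral => //.
  - by move=> k _; rewrite lee_fin.
  - by apply/measurable_EFinP; exact: mg.
  - exact/measurable_EFinP.
  - move=> k _; rewrite lee_fin ler_piMl//.
    have h c : damping n.+1%:R^-1 c <= 1 :> R.
      by rewrite -[leRHS]expR0 ler_expR oppr_le0 mulr_ge0// invr_ge0.
    rewrite -[leRHS]mul1r; apply: ler_pM => //; apply/ltW; exact: damping_gt0.
have E0 : (0 <= energy (@mu2 R) f)%E.
  by apply: integral_ge0 => x _; rewrite lee_fin sqr_ge0.
have Efin : (energy (@mu2 R) f)%E \is a fin_num by rewrite ge0_fin_numE.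
apply/eqP; rewrite eq_le; apply/andP; split.
  apply: (cvge_to_le cI); apply: nearW => n.
  rewrite -(@lee_pmul2l _ 2%:E)//.
  by rewrite muleA -EFinM -(IE n); apply: leeDl; exact: o0.
rewrite -(@lee_pmul2l _ 2%:E)// muleA -EFinM.
apply/lee_addgt0Pr => eta eta0.
have [n _ /(_ n (leqnn n))/= on] := oscillation2_vanishing mf f2 eta0.
rewrite -(IE n); apply: leeD => //.
by apply: lee_wpmul2l => //; rewrite lee_fin.
Qed.

End plancherel.

(** * The L^2 Fourier transform and the velocity *)

Section fourier_L2.
Context (R : realType).

Lemma normc_sqr (z : R[i]) :
  Normc.normc z ^+ 2 = complex.Re z ^+ 2 + complex.Im z ^+ 2.
Proof. by case: z => a b /=; rewrite sqr_sqrtr// addr_ge0 ?sqr_ge0. Qed.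

Definition restrict_ball (N : nat) (f : plane R -> R) (x : plane R) : R :=
  if enorm x <= N%:R then f x else 0.

Lemma measurable_enorm : measurable_fun setT (@enorm R : plane R -> R).
Proof.
apply: measurableT_comp; last first.
  by apply: measurable_funD; apply: measurable_funX.
by apply: continuous_measurable_fun; exact: sqrt_continuous.
Qed.

Lemma measurable_restrict_ball (N : nat) (f : plane R -> R) :
  measurable_fun setT f -> measurable_fun setT (restrict_ball N f).
Proof.
move=> mf; apply: measurable_fun_ifT => //.
by apply: measurable_fun_ler => //; exact: measurable_enorm.
Qed.

Lemma normr_le_enorm (x : R * R) : (`|x.1| <= enorm x) * (`|x.2| <= enorm x).
Proof.
by split; rewrite -sqrtr_sqr ler_sqrt ?addr_ge0 ?sqr_ge0// ?lerDl ?lerDr sqr_ge0.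
Qed.

(** On the ball, 1 is at most a multiple of the integrable function [damping2 1]. *)
Lemma integrable_restrict_ball (N : nat) (f : plane R -> R) :
  measurable_fun setT f -> (energy (@mu2 R) f < +oo)%E ->
  integrableR (@mu2 R) (restrict_ball N f).
Proof.
move=> mf f2.
have if2 : integrableR (@mu2 R) (fun x => f x ^+ 2).
  apply/integrableP; split; first by apply/measurable_EFinP; exact: measurable_funX.
  by under eq_integral do rewrite /= ger0_norm ?sqr_ge0//.
have iw := integrableRZ (expR (2 * N%:R)) (@integrable_damping2 R 1 ltr01).
have i2 := integrableRD if2 iw.
apply: (integrable_dominated (g := fun x => f x ^+ 2 + expR (2 * N%:R) * damping2 1 x)).
- exact: measurable_restrict_ball.
- move=> x; rewrite /restrict_ball; case: ifP => xN; last first.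
    by rewrite normr0 addr_ge0 ?sqr_ge0// mulr_ge0 ?expR_ge0// damping2_ge0.
  apply: (@le_trans _ _ (f x ^+ 2 + 1)).
    rewrite -(real_normK (num_real (f x))); have := sqr_ge0 (`|f x| - 1).
    by rewrite !expr2; have := normr_ge0 (f x); nra.
  rewrite lerD2l /damping2 /damping -!expRD -[leLHS]expR0 ler_expR !mul1r.
  have [h1 h2] := (normr_le_enorm x).
  by have := h1; have := h2; lra.
- exact: i2.
Qed.

Lemma le_integral_restrict_ball (N : nat) (f : plane R -> R) :
  measurable_fun setT f ->
  (\int[@mu2 R]_x (restrict_ball N f x ^+ 2)%:E <= energy (@mu2 R) f)%E.
Proof.
move=> mf; apply: ge0_le_integral => //.
- by move=> x _; rewrite lee_fin sqr_ge0.
- by apply/measurable_EFinP; apply: measurable_funX; exact: measurable_restrict_ball.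
- by apply/measurable_EFinP; exact: measurable_funX.
- move=> x _; rewrite lee_fin /restrict_ball; case: ifP => _ //.
  by rewrite expr0n sqr_ge0.
Qed.

Lemma restrict_ball_le (f : plane R -> R) (M : \bar R) :
  measurable_fun setT f ->
  (forall N, \int[@mu2 R]_x (restrict_ball N f x ^+ 2)%:E <= M)%E ->
  (energy (@mu2 R) f <= M)%E.
Proof.
move=> mf fM.
pose g N x := (restrict_ball N f x ^+ 2)%:E.
have cg x : g N x @[N --> \oo] --> (f x ^+ 2)%:E.
  apply: cvg_EFin; first by apply: nearW.
  apply: cvg_near_cst; exists (Num.bound (enorm x)) => // n /= xn.
  rewrite /restrict_ball ifT// ltW//.
  apply: lt_le_trans (archi_boundP _) _; first exact: sqrtr_ge0.
  by rewrite ler_nat.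
have : (\int[@mu2 R]_x g N x)%E @[N --> \oo] --> (energy (@mu2 R) f)%E.
  rewrite (_ : (fun x => (f x ^+ 2)%:E) = (fun x => limn (g ^~ x))); last first.
    by apply/funext => x; apply/esym/cvg_lim => //; exact: cg.
  apply: (@cvg_monotone_convergence _ _ R (@mu2 R) setT measurableT g) => //.
  - move=> n; apply/measurable_EFinP; apply: measurable_funX.
    exact: measurable_restrict_ball.
  - by move=> n x _; rewrite lee_fin sqr_ge0.
  - move=> x _ n m nm; rewrite lee_fin /restrict_ball.
    case: ifP => xn; last by rewrite expr0n; case: ifP; rewrite ?sqr_ge0// expr0n.
    by rewrite ifT// (le_trans xn)// ler_nat.
move/cvge_to_le; apply; apply: nearW => N; exact: fM.
Qed.

Lemma fourier_toC (f : plane R -> R) (k : plane R) :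
  integrableR (@mu2 R) f ->
  fourier (toC f) k = (cos_transform f k +i* (- sin_transform f k))%C.
Proof.
move=> fi.
have isin : integrableR (@mu2 R) (fun x => f x * sin (dot x k)).
  apply: (integrable_mul_bounded (C := 1) fi); last by move=> x; exact: normr_sin_le1.
  exact: measurable_fun_pair1 (@measurable_sin_dot R).
rewrite /fourier /Cintegral; congr (_ +i* _)%C.
  by apply: (@eq_Rintegral _ _ _ (@mu2 R)) => x _; rewrite /= mul0r subr0 cosN.
rewrite -mulN1r -RintegralZl//.
by apply: (@eq_Rintegral _ _ _ (@mu2 R)) => x _; rewrite /= mul0r addr0 sinN; ring.
Qed.

Lemma truncate_toC (N : nat) (f : plane R -> R) :
  truncate N (toC f) = toC (restrict_ball N f).
Proof.
by apply/funext => x; rewrite /truncate /toC /restrict_ball; case: ifP.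
Qed.

(** [D N] is the squared distance between [F] and the transform of the truncation at
    radius [N].  Comparing squares up to a factor two avoids the triangle inequality
    in L^2; the constants are immaterial in the energy bounds below. *)
Lemma fourier_truncation (f : plane R -> R) (F : plane R -> R[i]) :
  is_fourierL2 f F ->
  exists D : nat -> plane R -> R,
    [/\ forall N k, 0 <= D N k, forall N, measurable_fun setT (D N),
     vanishing (fun N => \int[@mu2 R]_k (D N k)%:E)%E &
     forall N k, let g := restrict_ball N f in
       let P := cos_transform g k ^+ 2 + sin_transform g k ^+ 2 in
       Normc.normc (F k) ^+ 2 <= 2 * (D N k + P) /\
       P <= 2 * (D N k + Normc.normc (F k) ^+ 2)].
Proof.
move=> [fL [FR FI] cv]; have mf := Lfun_measurable fL; have f2 := Lfun2_sqr_lty fL.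
have mR := Lfun_measurable FR; have mI := Lfun_measurable FI.
pose D N (k : plane R) := (cos_transform (restrict_ball N f) k - complex.Re (F k)) ^+ 2 +
             (- sin_transform (restrict_ball N f) k - complex.Im (F k)) ^+ 2.
exists D; split.
- by move=> N k; rewrite addr_ge0 ?sqr_ge0.
- move=> N; have mr := measurable_restrict_ball N mf.
  apply: measurable_funD; apply: measurable_funX; apply: measurable_funB => //.
    exact: measurable_cos_transform.
  by apply: measurableT_comp => //; exact: measurable_sin_transform.
- have E : (fun N => \int[@mu2 R]_k (D N k)%:E)%E = (fun N : nat => \int[leb2 R]_k
      (Normc.normc (fourier (truncate N (toC f)) k - F k) ^+ 2)%:E)%E.
    apply/funext => N; apply: (@eq_integral _ _ _ (@mu2 R)) => k _.
    rewrite truncate_toC fourier_toC; last exact: integrable_restrict_ball.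
    by rewrite normc_sqr /D; case: (F k) => a b.
  by apply: cvg_vanishing; rewrite E.
- move=> N k /=; rewrite normc_sqr /D.
  move: (cos_transform _ _) (sin_transform _ _) (complex.Re _) (complex.Im _) => c s a b.
  rewrite !expr2; split.
    by have := sqr_ge0 (2 * c - a); have := sqr_ge0 (2 * s + b); rewrite !expr2; nra.
  by have := sqr_ge0 (c - 2 * a); have := sqr_ge0 (s + 2 * b); rewrite !expr2; nra.
Qed.

Lemma measurable_normc_sqr (F : plane R -> R[i]) :
  CL2 F -> measurable_fun setT (fun k : plane R => Normc.normc (F k) ^+ 2).
Proof.
move=> [FR FI]; under eq_fun do rewrite normc_sqr.
by apply: measurable_funD; apply: measurable_funX; [exact: Lfun_measurable FR|exact: Lfun_measurable FI].
Qed.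

Lemma measurable_transform_sqr (f : plane R -> R) :
  measurable_fun setT f -> measurable_fun setT
   (fun k => cos_transform f k ^+ 2 + sin_transform f k ^+ 2).
Proof.
move=> mf; apply: measurable_funD; apply: measurable_funX.
  exact: measurable_cos_transform.
exact: measurable_sin_transform.
Qed.

Lemma fourierL2_le (f : plane R -> R) (F : plane R -> R[i]) :
  is_fourierL2 f F ->
  (\int[@mu2 R]_k (Normc.normc (F k) ^+ 2)%:E <=
   (2 * (2 * pi) ^+ 2)%:E * energy (@mu2 R) f)%E.
Proof.
move=> fF; have [D [D0 mD vD DE]] := fourier_truncation fF.
have [fL CF _] := fF; have mf := Lfun_measurable fL; have f2 := Lfun2_sqr_lty fL.
apply/lee_addgt0Pr => eta eta0.
have e2 : 0 < eta / 2 by rewrite divr_gt0.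
have [N _ /(_ N (leqnn N))/= DN] := vD _ e2.
have mr := measurable_restrict_ball N mf.
apply: (@le_trans _ _ (2%:E * (\int[@mu2 R]_k (D N k)%:E + \int[@mu2 R]_k
    (cos_transform (restrict_ball N f) k ^+ 2 + sin_transform (restrict_ball N f) k ^+ 2)%:E))%E).
  apply: le_integralD => //.
  - exact: measurable_normc_sqr.
  - exact: measurable_transform_sqr.
  - by move=> k; rewrite sqr_ge0.
  - by move=> k; rewrite addr_ge0 ?sqr_ge0.
  - by move=> k; have [] := DE N k.
rewrite plancherel; last 2 first.
- exact: integrable_restrict_ball.
- exact: le_lt_trans (le_integral_restrict_ball N mf) f2.
apply: (@le_trans _ _ (2%:E * ((eta / 2)%:E +
    ((2 * pi) ^+ 2)%:E * energy (@mu2 R) f))%E).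
  apply: lee_wpmul2l; first by rewrite lee_fin.
  apply: leeD => //; apply: lee_wpmul2l; first by rewrite lee_fin sqr_ge0.
  exact: le_integral_restrict_ball.
have E0 : (0 <= energy (@mu2 R) f)%E.
  by apply: integral_ge0 => x _; rewrite lee_fin sqr_ge0.
rewrite ge0_muleDr ?lee_fin ?(ltW e2)//; last first.
  by rewrite mule_ge0// lee_fin sqr_ge0.
rewrite addeC muleA -!EFinM; apply: leeD => //.
by rewrite lee_fin; lra.
Qed.

Lemma fourierL2_ge (f : plane R -> R) (F : plane R -> R[i]) :
  is_fourierL2 f F ->
  (((2 * pi) ^+ 2)%:E * energy (@mu2 R) f <=
   2%:E * \int[@mu2 R]_k (Normc.normc (F k) ^+ 2)%:E)%E.
Proof.
move=> fF; have [D [D0 mD vD DE]] := fourier_truncation fF.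
have [fL CF _] := fF; have mf := Lfun_measurable fL; have f2 := Lfun2_sqr_lty fL.
have pi2 : 0 < (2 * (pi : R)) ^+ 2 by rewrite exprn_gt0// mulr_gt0// pi_gt0.
rewrite -lee_pdivlMl//; apply: restrict_ball_le => // N0.
rewrite lee_pdivlMl//.
apply/lee_addgt0Pr => eta eta0.
have e2 : 0 < eta / 2 by rewrite divr_gt0.
have [N1 _ DN1] := vD _ e2.
pose N := maxn N0 N1.
have DN : (\int[@mu2 R]_k (D N k)%:E <= (eta / 2)%:E)%E by apply: DN1; exact: leq_maxr.
have mr := measurable_restrict_ball N mf.
apply: (@le_trans _ _ (((2 * pi) ^+ 2)%:E * \int[@mu2 R]_x (restrict_ball N f x ^+ 2)%:E)%E).
  apply: lee_wpmul2l; first by rewrite lee_fin ltW.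
  apply: ge0_le_integral => //.
  - by move=> x _; rewrite lee_fin sqr_ge0.
  - by apply/measurable_EFinP; apply: measurable_funX; exact: measurable_restrict_ball.
  - by apply/measurable_EFinP; exact: measurable_funX.
  - move=> x _; rewrite lee_fin /restrict_ball; case: ifP => xn.
      by rewrite ifT// (le_trans xn)// ler_nat leq_maxl.
    by rewrite expr0n sqr_ge0.
rewrite -plancherel; last 2 first.
- exact: integrable_restrict_ball.
- exact: le_lt_trans (le_integral_restrict_ball N mf) f2.
apply: (@le_trans _ _ (2%:E * (\int[@mu2 R]_k (D N k)%:E +
    \int[@mu2 R]_k (Normc.normc (F k) ^+ 2)%:E))%E).
  apply: le_integralD => //.
  - exact: measurable_transform_sqr.
  - exact: measurable_normc_sqr.
  - by move=> k; rewrite addr_ge0 ?sqr_ge0.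
  - by move=> k; rewrite sqr_ge0.
  - by move=> k; have [] := DE N k.
have E0 : (0 <= \int[@mu2 R]_k (Normc.normc (F k) ^+ 2)%:E)%E.
  by apply: integral_ge0 => k _; rewrite lee_fin sqr_ge0.
rewrite ge0_muleDr//; last by apply: integral_ge0 => k _; rewrite lee_fin.
rewrite addeC; apply: leeD => //.
apply: (@le_trans _ _ (2%:E * (eta / 2)%:E)%E).
  by apply: lee_wpmul2l => //; rewrite lee_fin.
by rewrite -EFinM lee_fin; lra.
Qed.

(** The velocity is a rotation of the Riesz transforms of [th], whose symbols have
    modulus at most one, so two uses of Plancherel bound it by [th]. *)
Lemma velocity_energy_le (th u1 u2 : plane R -> R) :
  is_velocity th u1 u2 ->
  [/\ u1 \in Lfun (leb2 R) 2%:E, u2 \in Lfun (leb2 R) 2%:E,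
      (energy (@mu2 R) u1 <= 4%:E * energy (@mu2 R) th)%E &
      (energy (@mu2 R) u2 <= 4%:E * energy (@mu2 R) th)%E].
Proof.
move=> [thh [psih [u1h [u2h [fth f1 f2 _ vel]]]]].
have ae : {ae @mu2 R, forall k, [/\ (enorm k)%:C%C * psih k = - thh k,
    u1h k = - ((0 +i* k.2)%C * psih k) & u2h k = (0 +i* k.1)%C * psih k]} by exact: vel.
have pi2 : 0 < (2 * (pi : R)) ^+ 2 by rewrite exprn_gt0// mulr_gt0// pi_gt0.
have key u uh : is_fourierL2 u uh ->
    {ae @mu2 R, forall k, Normc.normc (uh k) ^+ 2 <= Normc.normc (thh k) ^+ 2} ->
    (energy (@mu2 R) u <= 4%:E * energy (@mu2 R) th)%E.
  move=> fu uth; have [_ Cu _] := fu; have [_ Ct _] := fth.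
  have h1 : (\int[@mu2 R]_k (Normc.normc (uh k) ^+ 2)%:E <=
      \int[@mu2 R]_k (Normc.normc (thh k) ^+ 2)%:E)%E.
    apply: ae_ge0_le_integral => //.
    - by move=> k _; rewrite lee_fin sqr_ge0.
    - by apply/measurable_EFinP; exact: measurable_normc_sqr.
    - by move=> k _; rewrite lee_fin sqr_ge0.
    - by apply/measurable_EFinP; exact: measurable_normc_sqr.
    - by apply: (ae_impl uth) => k ku _; rewrite lee_fin.
  have h2 := fourierL2_ge fu; have h3 := fourierL2_le fth.
  rewrite -(@lee_pmul2l _ ((2 * pi) ^+ 2)%:E)// ?lte_fin//.
  apply: (@le_trans _ _ (2%:E * \int[@mu2 R]_k (Normc.normc (thh k) ^+ 2)%:E)%E).
    by apply: le_trans h2 _; apply: lee_wpmul2l; rewrite ?lee_fin.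
  apply: (@le_trans _ _ (2%:E * ((2 * (2 * pi) ^+ 2)%:E *
      energy (@mu2 R) th))%E).
    by apply: lee_wpmul2l; rewrite ?lee_fin.
  rewrite !muleA -!EFinM le_eqVlt; apply/orP; left; apply/eqP.
  by congr (_%:E * _)%E; ring.
have sym (k : R * R) : `|k.1| <= enorm k /\ `|k.2| <= enorm k by have [] := normr_le_enorm k.
have normcM (z w : R[i]) : Normc.normc (z * w) ^+ 2 = Normc.normc z ^+ 2 * Normc.normc w ^+ 2.
  by rewrite !normc_sqr; case: z => a b; case: w => c d /=; ring.
have normcN (z : R[i]) : Normc.normc (- z) ^+ 2 = Normc.normc z ^+ 2.
  by rewrite !normc_sqr; case: z => a b /=; ring.
have bound k a p : `|a| <= enorm k -> (enorm k)%:C%C * p = - thh k ->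
    Normc.normc ((0 +i* a)%C * p) ^+ 2 <= Normc.normc (thh k) ^+ 2.
  move=> ak E; rewrite -(normcN (thh k)) -E !normcM ler_wpM2r ?sqr_ge0//.
  rewrite !normc_sqr /= !expr0n /= add0r addr0.
  by rewrite -(real_normK (num_real a)) lerXn2r ?nnegrE// (le_trans _ ak).
have [L1 _ _] := f1; have [L2 _ _] := f2.
split => //.
- apply: (key _ _ f1); apply: (ae_impl ae) => k [E -> _].
  by rewrite normcN; apply: bound E; have [] := sym k.
- apply: (key _ _ f2); apply: (ae_impl ae) => k [E _ ->].
  by apply: bound E; have [] := sym k.
Qed.

End fourier_L2.

(** * Smooth functions of one variable *)

Section smooth_functions.
Context (R : realType).

(** The derivative is asked for as a function satisfying [is_derive], which makes the
    closure properties direct inductions on the order. *)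
Fixpoint Cn (n : nat) (f : R -> R) : Prop :=
  if n is m.+1 then exists2 g : R -> R, (forall x : R, is_derive x 1 f (g x)) & Cn m g
  else continuous f.

Definition smooth1 (f : R -> R) : Prop := forall n, Cn n f.

Lemma CnW (n : nat) (f : R -> R) : Cn n.+1 f -> Cn n f.
Proof.
elim: n f => [|n IH] f [g fg cg]; first exact: continuous_of_derive fg.
by exists g => //; exact: IH.
Qed.

Lemma Cn_cst (n : nat) (c : R) : Cn n (cst c).
Proof.
elim: n c => [|n IH] c; first exact: cst_continuous.
by exists (cst 0); [move=> x; exact: is_derive_cst|exact: IH].
Qed.

Lemma CnD (n : nat) (f g : R -> R) :
  Cn n f -> Cn n g -> Cn n (fun x => f x + g x).
Proof.
elim: n f g => [|n IH] f g.
  by move=> cf cg x; apply: cvgD; [exact: cf|exact: cg].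
move=> [f' df cf] [g' dg cg]; exists (fun x => f' x + g' x); last exact: IH.
by move=> x; have := df x; have := dg x => *; exact: is_deriveD.
Qed.

Lemma CnM (n : nat) (f g : R -> R) :
  Cn n f -> Cn n g -> Cn n (fun x => f x * g x).
Proof.
elim: n f g => [|n IH] f g.
  by move=> cf cg x; apply: cvgM; [exact: cf|exact: cg].
move=> hf hg; have [f' df cf] := hf; have [g' dg cg] := hg.
exists (fun x => f x * g' x + g x * f' x).
  by move=> x; have := df x; have := dg x => *; exact: is_deriveM.
by apply: CnD; apply: IH => //; exact: CnW.
Qed.

Lemma CnV (n : nat) (f : R -> R) :
  (forall x, f x != 0) -> Cn n f -> Cn n (fun x => (f x)^-1).
Proof.
move=> f0; elim: n => [|n IH].
  by move=> cf x; apply: cvgV => //; exact: cf.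
move=> hf; have [f' df cf] := hf.
exists (fun x => -1 * (f x)^-1 * (f x)^-1 * f' x).
  move=> x; have dfx := df x; apply: (is_derive_eq (is_deriveV (f0 x) dfx)).
  by rewrite /GRing.scale /= -exprVn expr2; ring.
have cV : Cn n (fun x => (f x)^-1) by apply: IH; exact: CnW.
apply: CnM => //; apply: CnM => //; apply: CnM => //; exact: Cn_cst.
Qed.

Lemma Cn_affine (n : nat) (f : R -> R) (a b : R) :
  Cn n f -> Cn n (fun x => f (a * x + b)).
Proof.
have da (x : R) : is_derive x 1 (fun x => a * x + b) a.
  by apply: is_derive_eq; rewrite /GRing.scale /=; ring.
elim: n f => [|n IH] f.
  move=> cf x; apply: (@continuous_comp _ _ _ (fun x => a * x + b) f); last exact: cf.
  exact: (continuous_of_derive da).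
move=> [f' df cf]; exists (fun x => f' (a * x + b) * a).
  move=> x; have h1 := da x; have h2 := df (a * x + b).
  exact: (@is_derive1_comp _ f (fun x => a * x + b)).
by apply: CnM; [exact: IH|exact: Cn_cst].
Qed.

Lemma smooth1_cst (c : R) : smooth1 (cst c).
Proof. by move=> n; exact: Cn_cst. Qed.

Lemma smooth1D (f g : R -> R) :
  smooth1 f -> smooth1 g -> smooth1 (fun x => f x + g x).
Proof. by move=> sf sg n; exact: CnD. Qed.

Lemma smooth1M (f g : R -> R) :
  smooth1 f -> smooth1 g -> smooth1 (fun x => f x * g x).
Proof. by move=> sf sg n; exact: CnM. Qed.

Lemma smooth1V (f : R -> R) :
  (forall x, f x != 0) -> smooth1 f -> smooth1 (fun x => (f x)^-1).
Proof. by move=> f0 sf n; exact: CnV. Qed.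

Lemma smooth1_affine (f : R -> R) (a b : R) :
  smooth1 f -> smooth1 (fun x => f (a * x + b)).
Proof. by move=> sf n; exact: Cn_affine. Qed.

Lemma smooth1_continuous (f : R -> R) : smooth1 f -> continuous f.
Proof. by move=> /(_ 0%N). Qed.

Lemma smooth1_is_derive (f : R -> R) (x : R) :
  smooth1 f -> is_derive x 1 f (derive1 f x).
Proof.
move=> /(_ 1%N)[g fg _]; rewrite derive1E; have := fg x => h.
by rewrite derive_val.
Qed.

Lemma smooth1_derive1 (f : R -> R) : smooth1 f -> smooth1 (derive1 f).
Proof.
move=> sf n; have [g fg cg] := sf n.+1.
rewrite (_ : derive1 f = g)//; apply/funext => x.
by rewrite derive1E; have h := fg x; rewrite derive_val.
Qed.

Lemma smooth1_measurable (f : R -> R) :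
  smooth1 f -> measurable_fun [set: R] f.
Proof. by move=> sf; apply: continuous_measurable_fun; exact: smooth1_continuous. Qed.

(** These functions, for all [k], are closed under differentiation up to linear
    combinations, which makes [flat 0], that is exp (-1/x), smooth at 0. *)
Definition flat (k : nat) (x : R) : R :=
  if 0 < x then x ^- k * expR (- x^-1) else 0.

Lemma flat_le (k : nat) (x : R) :
  `|flat k x| <= k.+2`!%:R * x ^+ 2.
Proof.
rewrite /flat; case: ifP => x0; last by rewrite normr0 mulr_ge0 ?sqr_ge0.
have xV : 0 < x^-1 by rewrite invr_gt0.
rewrite ger0_norm; last by rewrite mulr_ge0 ?expR_ge0// invr_ge0 exprn_ge0// ltW.
rewrite expRN -exprVn ler_pdivrMr ?expR_gt0//.
have := expR_ge1Dxn k.+1 (ltW xV).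
have fac : 0 < (k.+2`!%:R : R) by rewrite ltr0n fact_gt0.
move=> h; apply: (@le_trans _ _ (k.+2`!%:R * x ^+ 2 * (x^-1 ^+ k.+2 / k.+2`!%:R))).
  rewrite le_eqVlt; apply/orP; left; apply/eqP.
  rewrite -[k.+2]addn2 exprD; rewrite [X in _ = _ * X * _]expr2.
  have -> : x^-1 ^+ 2 = x^-1 * x^-1 by rewrite expr2.
  move: fac; rewrite addn2; move: (k.+2`!%:R) => F F0.
  field; by rewrite (gt_eqF F0) (gt_eqF x0).
apply: ler_wpM2l; first by rewrite mulr_ge0 ?sqr_ge0.
by apply: le_trans h; rewrite lerDr.
Qed.

Lemma flat_is_derive (k : nat) (x : R) :
  is_derive x 1 (@flat k) (- k%:R * flat k.+1 x + flat k.+2 x).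
Proof.
have [x0|x0|->] := ltgtP x 0.
- apply: (near_eq_is_derive (f := cst 0)).
    near=> y; have y0 : y < 0 by near: y; exact: lt_nbhsl.
    by rewrite /flat ltNge (ltW y0).
  by rewrite /flat ltNge (ltW x0)/= mulr0 addr0; exact: is_derive_cst.
- apply: (near_eq_is_derive (f := fun y : R => y ^- k * expR (- y^-1) : R)).
    near=> y; have y0 : 0 < y by near: y; exact: lt_nbhsr.
    by rewrite /flat y0.
  have dV : is_derive x 1 (fun y : R => y^-1) (- x ^- 2).
    apply: (is_derive_eq (is_deriveV (f := id) (lt0r_neq0 x0) (is_derive_id _ _))).
    by rewrite /GRing.scale /= mulr1.
  have dE : is_derive x 1 (fun y : R => expR (- y^-1)) (expR (- x^-1) * x ^- 2).
    by apply: is_derive_eq; rewrite /GRing.scale /= opprK mulrC.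
  have dk : is_derive x 1 (fun y : R => y ^- k) (- k%:R * x ^- k.+1).
    rewrite (_ : (fun y : R => y ^- k) = (fun y : R => y^-1) ^+ k); last first.
      by apply/funext => y; rewrite fctE exprVn.
    apply: is_derive_eq; rewrite /GRing.scale /=.
    case: k => [|k] /=; first by rewrite !mul0r oppr0 mul0r.
    by rewrite -!exprVn !exprS expr0; ring.
  apply: (is_derive_eq (is_deriveM dk dE)).
  by rewrite /GRing.scale /= /flat x0 -!exprVn !exprS expr0; ring.
- rewrite /flat ltxx mulr0 addr0.
  have cv : (fun h => h^-1 *: ((@flat k \o shift 0) (h *: (1 : R)) - flat k 0)) @ 0^' --> (0 : R).
    apply/cvgr0Pnorm_le => e e0; pose F : R := k.+2`!%:R.
    have F0 : 0 < F by rewrite ltr0n fact_gt0.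
    near=> t; rewrite /= [t *: _]mulr1 addr0.
    rewrite {2}/flat ltxx subr0 [_ *: _](_ : _ = t^-1 * flat k t)// normrM.
    have t0 : t != 0 by near: t; exact: nbhs_dnbhs_neq.
    rewrite normfV ler_pdivrMl ?normr_gt0//.
    apply: le_trans (flat_le k t) _.
    rewrite -(real_normK (num_real t)) expr2 mulrA mulrC ler_wpM2l//.
    rewrite -/F mulrC -ler_pdivlMr//.
    near: t; apply: dnbhs0_le; exact: divr_gt0.
  by apply: DeriveDef; [apply/cvg_ex; exists 0|exact/cvg_lim].
Unshelve. all: by end_near. Qed.

Lemma flat_smooth (k : nat) : smooth1 (@flat k).
Proof.
move=> n; elim: n k => [|n IH] k; first exact: (continuous_of_derive (@flat_is_derive k)).
exists (fun x => - k%:R * flat k.+1 x + flat k.+2 x); first exact: flat_is_derive.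
by apply: CnD => //; apply: CnM => //; exact: Cn_cst.
Qed.

Lemma flat_ge0 (k : nat) (x : R) : 0 <= flat k x.
Proof.
rewrite /flat; case: ifP => // x0.
by rewrite mulr_ge0 ?expR_ge0// invr_ge0 exprn_ge0// ltW.
Qed.

Lemma flat0_gt0 (x : R) : 0 < x -> 0 < flat 0 x.
Proof. by move=> x0; rewrite /flat x0 expr0 invr1 mul1r expR_gt0. Qed.

Lemma flat_eq0 (k : nat) (x : R) : x <= 0 -> flat k x = 0.
Proof. by move=> x0; rewrite /flat ltNge x0. Qed.

Definition step (x : R) : R := flat 0 x / (flat 0 x + flat 0 (1 - x)).

Lemma step_den_gt0 (x : R) : 0 < flat 0 x + flat 0 (1 - x).
Proof.
have [x0|x0] := ltP 0 x.
  by rewrite ltr_pwDl ?flat0_gt0 ?flat_ge0.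
by rewrite ltr_wpDl ?flat_ge0// flat0_gt0// subr_gt0 (le_lt_trans x0).
Qed.

Lemma flat_reflect_smooth (k : nat) : smooth1 (fun x : R => flat k (1 - x)).
Proof.
rewrite (_ : (fun x => _) = (fun x => flat k (-1 * x + 1))).
  by apply: smooth1_affine; exact: flat_smooth.
by apply/funext => x; rewrite mulN1r addrC.
Qed.

Lemma step_smooth : smooth1 (@step).
Proof.
apply: smooth1M; first exact: flat_smooth.
apply: smooth1V; first by move=> x; rewrite gt_eqF// step_den_gt0.
by apply: smooth1D; [exact: flat_smooth|exact: flat_reflect_smooth].
Qed.

Lemma step_ge0 (x : R) : 0 <= step x.
Proof. by rewrite divr_ge0 ?flat_ge0// ltW// step_den_gt0. Qed.

Lemma step_le1 (x : R) : step x <= 1.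
Proof. by rewrite ler_pdivrMr ?step_den_gt0// mul1r lerDl flat_ge0. Qed.

Lemma step_eq0 (x : R) : x <= 0 -> step x = 0.
Proof. by move=> x0; rewrite /step flat_eq0// mul0r. Qed.

Lemma step_eq1 (x : R) : 1 <= x -> step x = 1.
Proof.
move=> x1; rewrite /step [flat 0 (1 - x)]flat_eq0 ?subr_le0// addr0 divff//.
by rewrite gt_eqF// flat0_gt0// (lt_le_trans ltr01).
Qed.

Lemma step_derive_ge0 (x : R) : 0 <= derive1 (@step) x.
Proof.
have d1 := flat_is_derive 0 x.
have d2 : is_derive x 1 (fun y => flat 0 (1 - y)) (- flat 2 (1 - x)).
  have h : is_derive x 1 (fun y : R => 1 - y) (- 1).
    by apply: is_derive_eq; rewrite /GRing.scale /=; ring.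
  have h2 := flat_is_derive 0 (1 - x).
  apply: (is_derive_eq (@is_derive1_comp _ (@flat 0) (fun y => 1 - y) _ _ _ h2 h)).
  by rewrite oppr0 mul0r add0r mulrN1.
have D0 := step_den_gt0 x.
have d3 : is_derive x 1 (@step)
  ((flat 2 x * flat 0 (1 - x) + flat 0 x * flat 2 (1 - x)) / (flat 0 x + flat 0 (1 - x)) ^+ 2).
  have dD : is_derive x 1 (fun y => flat 0 y + flat 0 (1 - y)) (flat 2 x - flat 2 (1 - x)).
    apply: (is_derive_eq (is_deriveD d1 d2)).
    by rewrite oppr0 mul0r add0r.
  have dV : is_derive x 1 (fun y => (flat 0 y + flat 0 (1 - y))^-1)
      (- (flat 0 x + flat 0 (1 - x)) ^- 2 *: (flat 2 x - flat 2 (1 - x))).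
    by apply: is_deriveV; rewrite gt_eqF.
  apply: (is_derive_eq (is_deriveM d1 dV)).
  rewrite /GRing.scale /= oppr0 mul0r add0r.
  move: D0; set p := flat 0 x; set q := flat 0 (1 - x); set p' := flat 2 x; set q' := flat 2 _.
  by clearbody p q p' q' => D0; field; rewrite (gt_eqF D0).
by rewrite derive1E derive_val divr_ge0 ?sqr_ge0// addr_ge0// mulr_ge0 ?flat_ge0.
Qed.

End smooth_functions.

(** * Plateaus with small derivatives *)

Section bumps.
Context (R : realType).

Definition vanish_outside (a b : R) (f : R -> R) : Prop :=
  forall x, ~~ (a <= x <= b) -> f x = 0.

Lemma vanish_outside_derive1 (a b : R) (f : R -> R) :
  vanish_outside a b f -> vanish_outside a b (derive1 f).
Proof.
move=> f0 x xab; rewrite derive1E (near_eq_derive (g := cst 0)) ?derive_cst//.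
move: xab; rewrite negb_and -!ltNge => /orP[xa|bx].
  near=> y; apply: f0; rewrite negb_and -!ltNge; apply/orP; left.
  by near: y; exact: lt_nbhsl.
near=> y; apply: f0; rewrite negb_and -!ltNge; apply/orP; right.
by near: y; exact: lt_nbhsr.
Unshelve. all: by end_near. Qed.

Lemma vanish_outside_bounded (a b : R) (f : R -> R) :
  continuous f -> vanish_outside a b f -> exists2 B, 0 <= B & forall x, `|f x| <= B.
Proof.
move=> cf f0; have [ab|ba] := leP a b; last first.
  exists 0 => // x; rewrite f0 ?normr0// negb_and -!ltNge.
  by have [//|ax] := ltP x a; rewrite (lt_le_trans ba).
have [|c _ fc] := @EVT_max R (fun x => `|f x|) a b ab.
  by apply: continuous_subspaceT => x; apply: cvg_norm; exact: cf.
exists `|f c| => // x; have [xab|xab] := boolP (a <= x <= b).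
  by apply: fc; rewrite in_itv.
by rewrite f0// normr0.
Qed.

Lemma vanish_outside_integrable (a b : R) (f : R -> R) :
  continuous f -> vanish_outside a b f ->
  integrableR (leb R) f.
Proof.
move=> cf f0; have [B B0 fB] := vanish_outside_bounded cf f0.
apply: (@integrable_dominated _ _ R (leb R) f (fun x => B * \1_(`[a, b]%classic : set R) x)).
- exact: continuous_measurable_fun.
- move=> x; have [xab|xab] := boolP (a <= x <= b).
    by rewrite indicE mem_set ?mulr1//= in_itv.
  by rewrite f0// normr0 mulr_ge0.
- exact: (integrableRZ B (integrable_indic_itv a b true false)).
Qed.

Lemma vanish_outside_sqr_lty (a b : R) (f : R -> R) :
  continuous f -> vanish_outside a b f ->
  (energy (leb R) f < +oo)%E.
Proof.
move=> cf f0.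
have /integrableP[_] : integrableR (leb R) (fun x => f x ^+ 2).
  apply: (vanish_outside_integrable (a := a) (b := b)).
    have -> : (fun x => f x ^+ 2) = (fun x => f x * f x) by apply/funext => x; rewrite expr2.
    by move=> x; apply: cvgM; exact: cf.
  by move=> x /f0 ->; rewrite expr0n.
by under eq_integral do rewrite /= ger0_norm ?sqr_ge0//.
Qed.

Lemma integral_sqr_two_intervals (L B : R) (g : R -> R) :
  measurable_fun [set: R] g -> (forall x, `|g x| <= B) ->
  (forall x, ~~ (-1 <= x <= 0) -> ~~ (L <= x <= L + 1) -> g x = 0) ->
  (energy (leb R) g <= (2 * B ^+ 2)%:E)%E.
Proof.
move=> mg gB g0; have B0 : 0 <= B by apply: le_trans (gB 0).
pose E1 : set R := `[-1, 0]%classic; pose E2 : set R := `[L, L + 1]%classic.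
have mE1 : measurable E1 by exact: measurable_itv.
have mE2 : measurable E2 by exact: measurable_itv.
apply: (@le_trans _ _ ((B ^+ 2)%:E * (\int[leb R]_x (\1_E1 x)%:E +
    \int[leb R]_x (\1_E2 x)%:E))%E).
  apply: le_integralD => //.
  - exact: measurable_funX.
  - by move=> x; rewrite sqr_ge0.
  - by rewrite sqr_ge0.
  - have gx x : g x ^+ 2 <= B ^+ 2.
      by rewrite -(real_normK (num_real (g x))) lerXn2r ?nnegrE.
    move=> x; rewrite !indicE !mem_setE/= !in_itv/=.
    have [h1|h1] := boolP (-1 <= x <= 0).
      by rewrite mulrDr mulr1 (le_trans (gx x))// lerDl mulr_ge0 ?sqr_ge0.
    have [h2|h2] := boolP (L <= x <= L + 1); first by rewrite add0r mulr1.
    by rewrite g0// expr0n addr0 mulr0.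
have I1 : (\int[leb R]_x (\1_E1 x)%:E = 1)%E.
  rewrite integral_indic// setIT.
  by apply: etrans (lebesgue_measure_itv _) _; rewrite /= lte_fin ltrN10 -EFinB sub0r opprK.
have I2 : (\int[leb R]_x (\1_E2 x)%:E = 1)%E.
  rewrite integral_indic// setIT.
  apply: etrans (lebesgue_measure_itv _) _.
  by rewrite /= lte_fin ltrDl ltr01 -EFinB addrAC subrr add0r.
rewrite I1 I2.
by rewrite -EFinD -EFinM lee_fin mulrC.
Qed.

Definition plateau (L x : R) : R := step (1 * x + 1) * step (- 1 * x + (L + 1)).

Lemma plateau_smooth (L : R) : smooth1 (plateau L).
Proof. by apply: smooth1M; apply: smooth1_affine; exact: step_smooth. Qed.

Lemma plateau_vanish (L : R) : vanish_outside (-1) (L + 1) (plateau L).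
Proof.
move=> x; rewrite negb_and -!ltNge => /orP[x1|x1]; rewrite /plateau.
  by rewrite [step (1 * x + 1)]step_eq0 ?mul0r//; lra.
by rewrite [step (- 1 * x + _)]step_eq0 ?mulr0//; lra.
Qed.

Lemma affine_derive (f : R -> R) (a b x : R) : smooth1 f ->
  is_derive x 1 (fun y => f (a * y + b)) (a * derive1 f (a * x + b)).
Proof.
move=> sf; have da : is_derive x 1 (fun x => a * x + b) a.
  by apply: is_derive_eq; rewrite /GRing.scale /=; ring.
rewrite mulrC; apply: (@is_derive1_comp _ f (fun y => a * y + b)).
exact: smooth1_is_derive.
Qed.

Lemma derive1_step_vanish : vanish_outside 0 1 (derive1 (@step R)).
Proof.
move=> x xab; rewrite derive1E.
move: xab; rewrite negb_and -!ltNge => /orP[x0|x1].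
  rewrite (near_eq_derive (g := cst 0)) ?derive_cst//.
  near=> y; apply: step_eq0; apply/ltW.
  by near: y; exact: lt_nbhsl.
rewrite (near_eq_derive (g := cst (1 : R))) ?derive_cst//.
near=> y; apply: step_eq1; apply/ltW.
by near: y; exact: lt_nbhsr.
Unshelve. all: by end_near. Qed.

Definition flat_bump (delta : R) (e : R -> R) : Prop :=
  exists a b,
    [/\ smooth1 e, vanish_outside a b e,
        (energy (leb R) e = 1%:E)%E,
        (forall x, `|e x| <= 1) /\ (forall x, `|derive1 e x| <= delta) &
        (\int[leb R]_x (derive1 e x ^+ 2)%:E <= (delta ^+ 2)%:E)%E /\
        (\int[leb R]_x (derive1 (derive1 e) x ^+ 2)%:E <=
           (delta ^+ 2)%:E)%E].

(** A wide plateau has all its variation in two unit intervals, so that after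
    normalisation in L^2 its derivatives are as small as desired. *)
Lemma flat_bump_exists (delta : R) : 0 < delta ->
  exists e : R -> R, flat_bump delta e.
Proof.
move=> delta0; pose s1 := derive1 (@step R); pose s2 := derive1 s1.
have ss := @step_smooth R.
have ss1 : smooth1 s1 := smooth1_derive1 ss; have ss2 : smooth1 s2 := smooth1_derive1 ss1.
have v1 : vanish_outside 0 1 s1 := @derive1_step_vanish.
have v2 : vanish_outside 0 1 s2 := vanish_outside_derive1 v1.
have [B1 B10 s1B] := vanish_outside_bounded (smooth1_continuous ss1) v1.
have [B2 B20 s2B] := vanish_outside_bounded (smooth1_continuous ss2) v2.
have aff0 (a b x : R) : is_derive x 1 (fun y : R => step (a * y + b)) (a * s1 (a * x + b)).
  exact: affine_derive.
have aff1 (a b x : R) : is_derive x 1 (fun y : R => s1 (a * y + b)) (a * s2 (a * x + b)).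
  exact: affine_derive.
clearbody s2; clearbody s1.
have sB x : `|@step R x| <= 1 by rewrite ger0_norm ?step_ge0 ?step_le1.
pose C : R := 2 * B1 + 2 * B2 + 2 * (B1 * B1).
have C0 : 0 <= C by rewrite !addr_ge0 ?mulr_ge0.
(* the plateau has energy at least its length [L], its derivatives at most 2 C^2 *)
pose L : R := 1 + 2 * C ^+ 2 / delta ^+ 2.
have d2 : 0 < delta ^+ 2 by rewrite exprn_gt0.
have L1 : 1 <= L by rewrite lerDl divr_ge0 ?(ltW d2)// mulr_ge0 ?sqr_ge0.
have L0 : 0 < L by rewrite (lt_le_trans ltr01).
have CL : 2 * C ^+ 2 <= delta ^+ 2 * L.
  by rewrite -ler_pdivrMl// mulrC lerDr.
pose f := plateau L.
have sf : smooth1 f := plateau_smooth L.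
have vf : vanish_outside (-1) (L + 1) f := @plateau_vanish L.
pose f1 (x : R) : R := s1 (1 * x + 1) * step (-1 * x + (L + 1)) -
             step (1 * x + 1) * s1 (-1 * x + (L + 1)).
pose f2 (x : R) : R := s2 (1 * x + 1) * step (-1 * x + (L + 1)) -
             2 * (s1 (1 * x + 1) * s1 (-1 * x + (L + 1))) +
             step (1 * x + 1) * s2 (-1 * x + (L + 1)).
have df (x : R) : is_derive x 1 f (f1 x).
  have h1 := aff0 1 1 x; have h2 := aff0 (-1) (L + 1) x.
  apply: (is_derive_eq (is_deriveM h1 h2)); rewrite /GRing.scale /= /f1.
  by move: (s1 _) (s1 _) (step _) (step _) => *; ring.
have df1 (x : R) : is_derive x 1 f1 (f2 x).
  have h1 := aff0 1 1 x; have h2 := aff0 (-1) (L + 1) x.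
  have h3 := aff1 1 1 x; have h4 := aff1 (-1) (L + 1) x.
  apply: (is_derive_eq (is_deriveB (is_deriveM h3 h2) (is_deriveM h1 h4))).
  rewrite /GRing.scale /= /f2.
  by move: (s2 _) (s2 _) (s1 _) (s1 _) (step _) (step _) => *; ring.
have f1E : derive1 f = f1.
  by apply/funext => x; rewrite derive1E; have h := df x; rewrite derive_val.
have f2E : derive1 f1 = f2.
  by apply/funext => x; rewrite derive1E; have h := df1 x; rewrite derive_val.
have sf1 : smooth1 f1 by rewrite -f1E; exact: smooth1_derive1.
have sf2 : smooth1 f2 by rewrite -f2E; exact: smooth1_derive1.
have out x : ~~ (-1 <= x <= 0) -> ~~ (L <= x <= L + 1) ->
    [/\ s1 (1 * x + 1) = 0, s1 (-1 * x + (L + 1)) = 0,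
        s2 (1 * x + 1) = 0 & s2 (-1 * x + (L + 1)) = 0].
  move=> x1 x2; have o1 : ~~ (0 <= 1 * x + 1 <= 1).
    by apply: contra x1 => /andP[? ?]; apply/andP; split; lra.
  have o2 : ~~ (0 <= -1 * x + (L + 1) <= 1).
    by apply: contra x2 => /andP[? ?]; apply/andP; split; lra.
  by split; [exact: v1|exact: v1|exact: v2|exact: v2].
have leM (p q P Q : R) : `|p| <= P -> `|q| <= Q -> `|p * q| <= P * Q.
  by move=> hp hq; rewrite normrM ler_pM.
have f1B x : `|f1 x| <= C.
  apply: (@le_trans _ _ (B1 * 1 + 1 * B1)); last first.
    by rewrite /C mulr1 mul1r; have := mulr_ge0 B10 B10; lra.
  by apply: le_trans (ler_normB _ _) _; apply: lerD; exact: leM.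
have f2B x : `|f2 x| <= C.
  apply: (@le_trans _ _ (B2 * 1 + 2 * (B1 * B1) + 1 * B2)); last first.
    by rewrite /C mulr1 mul1r; lra.
  apply: le_trans (ler_normD _ _) _; apply: lerD; last exact: leM.
  apply: le_trans (ler_normB _ _) _; apply: lerD; first exact: leM.
  by rewrite normrM ger0_norm// ler_wpM2l//; exact: leM.
have I1 : (energy (leb R) f1 <= (2 * C ^+ 2)%:E)%E.
  apply: (integral_sqr_two_intervals (L := L)) => //.
    exact: smooth1_measurable.
  by move=> x h1 h2; have [E1 E2 _ _] := out x h1 h2; rewrite /f1 E1 E2 mul0r mulr0 subr0.
have I2 : (energy (leb R) f2 <= (2 * C ^+ 2)%:E)%E.
  apply: (integral_sqr_two_intervals (L := L)) => //.
    exact: smooth1_measurable.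
  move=> x h1 h2; have [E1 E2 E3 E4] := out x h1 h2.
  by rewrite /f2 E1 E2 E3 E4 !mul0r !mulr0 subr0 addr0.
pose J := \int[leb R]_x (f x ^+ 2).
have Joo := vanish_outside_sqr_lty (smooth1_continuous sf) vf.
have J0' : (0 <= energy (leb R) f)%E.
  by apply: integral_ge0 => x _; rewrite lee_fin sqr_ge0.
have JE : (energy (leb R) f = J%:E)%E.
  by rewrite fineK// ge0_fin_numE.
have mf2 : measurable_fun [set: R] (fun x => f x ^+ 2).
  by apply: measurable_funX; exact: smooth1_measurable.
have LJ : L <= J.
  rewrite -lee_fin -JE; apply: (@le_trans _ _ (\int[leb R]_x (\1_`[0, L]%classic x)%:E)%E).
    rewrite integral_indic; [|by []|exact: measurable_itv]; rewrite setIT.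
    rewrite [leRHS](_ : _ = L%:E)//; apply: etrans (lebesgue_measure_itv _) _.
    by rewrite /= lte_fin L0 -EFinB subr0.
  apply: ge0_le_integral => //.
  - by apply/measurable_EFinP; apply: measurable_indic; exact: measurable_itv.
  - exact/measurable_EFinP.
  - move=> x _; rewrite lee_fin indicE mem_setE/= in_itv/=.
    have [/andP[x0 xL]|_] := boolP (0 <= x <= L); last by rewrite sqr_ge0.
    by rewrite /f /plateau !step_eq1 ?mulr1 ?expr1n//; lra.
have J0 : 0 < J by exact: lt_le_trans L0 LJ.
pose c := (Num.sqrt J)^-1.
have c2 : c ^+ 2 = J^-1 by rewrite exprVn sqr_sqrtr// ltW.
have c0 : 0 <= c by rewrite invr_ge0 sqrtr_ge0.
have c1 : c <= 1.
  by rewrite -(@expr_le1 _ 2)// c2 invf_le1// (le_trans L1).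
have cC : c ^+ 2 * (2 * C ^+ 2) <= delta ^+ 2.
  by rewrite c2 ler_pdivrMl// (le_trans CL)// mulrC ler_wpM2r// ltW.
have dcM (g g' : R -> R) : (forall x : R, is_derive x 1 g (g' x)) ->
    derive1 (fun x => c * g x) = (fun x => c * g' x).
  move=> dg; apply/funext => x; rewrite derive1E; have h := dg x.
  have h2 : is_derive x 1 (fun x => c * g x) (c * g' x).
    by apply: is_derive_eq; rewrite /GRing.scale /=; ring.
  by rewrite derive_val.
have intc (g : R -> R) : measurable_fun [set: R] g ->
    (\int[leb R]_x ((c * g x) ^+ 2)%:E =
     (c ^+ 2)%:E * energy (leb R) g)%E.
  move=> mg; under eq_integral do rewrite exprMn EFinM.
  have mg2 : measurable_fun setT (fun x => (g x ^+ 2)%:E).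
    by apply/measurable_EFinP; exact: measurable_funX.
  by apply: ge0_integralZl => // *; rewrite lee_fin sqr_ge0.
exists (fun x => c * f x), (-1), (L + 1); split.
- by apply: smooth1M => //; exact: smooth1_cst.
- by move=> x /vf ->; rewrite mulr0.
- rewrite intc; last exact: smooth1_measurable.
  by rewrite JE -EFinM c2 mulVf// gt_eqF.
- split=> x.
    rewrite normrM (ger0_norm c0) -[leRHS]mulr1; apply: ler_pM => //.
    by rewrite /f /plateau -[leRHS]mulr1; exact: leM.
  rewrite (dcM _ _ df) normrM (ger0_norm c0).
  apply: (@le_trans _ _ (c * C)); first by rewrite ler_wpM2l.
  rewrite -(@ler_pXn2r _ 2) ?nnegrE ?mulr_ge0 ?(ltW delta0)//.
  apply: le_trans cC; rewrite exprMn ler_wpM2l ?sqr_ge0//.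
  by have := sqr_ge0 C; lra.
- rewrite (dcM _ _ df) (dcM _ _ df1); split.
    rewrite intc; last exact: smooth1_measurable.
    apply: (@le_trans _ _ ((c ^+ 2)%:E * (2 * C ^+ 2)%:E)%E); last by rewrite -EFinM lee_fin.
    by apply: lee_wpmul2l; rewrite ?lee_fin ?sqr_ge0.
  rewrite intc; last exact: smooth1_measurable.
  apply: (@le_trans _ _ ((c ^+ 2)%:E * (2 * C ^+ 2)%:E)%E); last by rewrite -EFinM lee_fin.
  by apply: lee_wpmul2l; rewrite ?lee_fin ?sqr_ge0.
Qed.

End bumps.

(** * Transforms of tensor products *)

Section tensors.
Context (R : realType).

Definition cos1 (f : R -> R) (k : R) : R :=
  \int[leb R]_x (f x * cos (k * x)).

Definition sin1 (f : R -> R) (k : R) : R :=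
  \int[leb R]_x (f x * sin (k * x)).

Definition power1 (f : R -> R) (k : R) : R := cos1 f k ^+ 2 + sin1 f k ^+ 2.

Definition tensor (f g : R -> R) (z : plane R) : R := f z.1 * g z.2.

Lemma Rintegral_derivative (g g' : R -> R) (a b : R) :
  (forall x : R, is_derive x 1 g (g' x)) -> continuous g' -> vanish_outside a b g ->
  \int[leb R]_x g' x = 0.
Proof.
move=> dg cg' vg.
have g'E : g' = derive1 g.
  by apply/funext => x; rewrite derive1E; have h := dg x; rewrite derive_val.
have vg' : vanish_outside a b g' by rewrite g'E; exact: vanish_outside_derive1.
pose A := a - 1; pose B := Num.max a b + 1.
have aB : a < B by rewrite ltr_pwDr// le_max lexx.
have bB : b < B by rewrite ltr_pwDr// le_max lexx orbT.
have Aa : A < a by rewrite ltrBlDr ltrDl.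
have AB : A < B by exact: lt_trans aB.
have cg : continuous g := continuous_of_derive dg.
have gA : g A = 0 by apply: vg; rewrite leNgt Aa.
have gB : g B = 0 by apply: vg; rewrite (leNgt B) bB andbF.
rewrite /Rintegral.
have -> : (\int[leb R]_x (g' x)%:E =
    \int[leb R]_(x in `[A, B]) (g' x)%:E)%E.
  rewrite [RHS]integral_mkcond; apply: eq_integral => x _; rewrite patchE.
  rewrite mem_setE/= in_itv/=; case: ifPn => // xAB; congr EFin; apply: vg'.
  apply: contra xAB => /andP[ax xb].
  by rewrite (le_trans (ltW Aa) ax) (le_trans xb (ltW bB)).
rewrite (@continuous_FTC2 _ g' g A B AB).
- by rewrite gA gB -EFinB subrr.
- exact: continuous_subspaceT.
- split.
  + by move=> x _; case: (dg x).
  + by apply: cvg_at_right_filter; exact: cg.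
  + by apply: cvg_at_left_filter; exact: cg.
- by move=> x _; rewrite g'E.
Qed.

Lemma integrable_mul_cos (f : R -> R) (k : R) :
  integrableR (leb R) f ->
  integrableR (leb R) (fun x => f x * cos (k * x)).
Proof.
move=> fi; apply: (@integrable_mul_bounded _ _ _ _ _ _ 1) fi _ _.
  by apply: measurableT_comp; [exact: measurable_cos|exact: measurable_funM].
by move=> x; exact: normr_cos_le1.
Qed.

Lemma integrable_mul_sin (f : R -> R) (k : R) :
  integrableR (leb R) f ->
  integrableR (leb R) (fun x => f x * sin (k * x)).
Proof.
move=> fi; apply: (@integrable_mul_bounded _ _ _ _ _ _ 1) fi _ _.
  by apply: measurableT_comp; [exact: measurable_sin|exact: measurable_funM].
by move=> x; exact: normr_sin_le1.
Qed.

Lemma integration_by_parts (f u u' : R -> R) (a b : R) :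
  smooth1 f -> vanish_outside a b f -> (forall x : R, is_derive x 1 u (u' x)) ->
  continuous u' ->
  \int[leb R]_x (derive1 f x * u x) = - \int[leb R]_x (f x * u' x).
Proof.
move=> sf vf du cu'; have sf' := smooth1_derive1 sf; have vf' := vanish_outside_derive1 vf.
have cf := smooth1_continuous sf; have cf' := smooth1_continuous sf'.
have cu := continuous_of_derive du.
have c1 : continuous (fun x => derive1 f x * u x).
  by move=> x; apply: cvgM; [exact: cf'|exact: cu].
have c2 : continuous (fun x => f x * u' x).
  by move=> x; apply: cvgM; [exact: cf|exact: cu'].
have i1 : integrableR (leb R) (fun x => derive1 f x * u x).
  by apply: (vanish_outside_integrable c1 (a := a) (b := b)) => x /vf' ->; rewrite mul0r.
have i2 : integrableR (leb R) (fun x => f x * u' x).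
  by apply: (vanish_outside_integrable c2 (a := a) (b := b)) => x /vf ->; rewrite mul0r.
apply/eqP; rewrite -addr_eq0 -RintegralD//; apply/eqP.
apply: (Rintegral_derivative (g := fun x => f x * u x) (a := a) (b := b)).
- move=> x; have h := smooth1_is_derive x sf; have dux := du x.
  apply: (is_derive_eq (is_deriveM h dux)); rewrite /GRing.scale /=.
  by rewrite addrC mulrC.
- by move=> x; apply: cvgD; [exact: c1|exact: c2].
- by move=> x /vf ->; rewrite mul0r.
Qed.

Lemma cos1_derive (f : R -> R) (a b k : R) :
  smooth1 f -> vanish_outside a b f -> cos1 (derive1 f) k = k * sin1 f k.
Proof.
move=> sf vf; have isin := integrable_mul_sin k (vanish_outside_integrable
  (smooth1_continuous sf) vf).
have dc (x : R) : is_derive x 1 (fun x => cos (k * x)) (- k * sin (k * x)).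
  by apply: is_derive_eq; rewrite /GRing.scale /=; ring.
have ds (x : R) : is_derive x 1 (fun x => - k * sin (k * x)) (- k ^+ 2 * cos (k * x)).
  by apply: is_derive_eq; rewrite /GRing.scale /=; ring.
rewrite /cos1 (integration_by_parts sf vf dc (continuous_of_derive ds)).
rewrite /sin1 -RintegralZl// -mulN1r -RintegralZl//.
  by apply: eq_Rintegral => x _; ring.
by have := integrableRZ (- k) isin; apply: eq_integrable => // x _ /=; rewrite mulrCA.
Qed.

Lemma sin1_derive (f : R -> R) (a b k : R) :
  smooth1 f -> vanish_outside a b f -> sin1 (derive1 f) k = - (k * cos1 f k).
Proof.
move=> sf vf; have icos := integrable_mul_cos k (vanish_outside_integrable
  (smooth1_continuous sf) vf).
have ds (x : R) : is_derive x 1 (fun x => sin (k * x)) (k * cos (k * x)).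
  by apply: is_derive_eq; rewrite /GRing.scale /=; ring.
have dc (x : R) : is_derive x 1 (fun x => k * cos (k * x)) (- k ^+ 2 * sin (k * x)).
  by apply: is_derive_eq; rewrite /GRing.scale /=; ring.
rewrite /sin1 (integration_by_parts sf vf ds (continuous_of_derive dc)).
rewrite /cos1 -RintegralZl//; congr (- _).
by apply: eq_Rintegral => x _; rewrite mulrCA.
Qed.

Lemma power1_derive (f : R -> R) (a b k : R) :
  smooth1 f -> vanish_outside a b f -> power1 (derive1 f) k = k ^+ 2 * power1 f k.
Proof.
move=> sf vf; rewrite /power1 (cos1_derive k sf vf) (sin1_derive k sf vf).
by ring.
Qed.

Lemma power1_ge0 (f : R -> R) (k : R) : 0 <= power1 f k.
Proof. by rewrite addr_ge0 ?sqr_ge0. Qed.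

Lemma normr_cos1_le (f : R -> R) (k : R) :
  integrableR (leb R) f ->
  `|cos1 f k| <= \int[leb R]_x `|f x|.
Proof.
move=> fi; apply: normr_Rintegral_mul_le => //; last by move=> x; exact: normr_cos_le1.
by apply: measurableT_comp; [exact: measurable_cos|exact: measurable_funM].
Qed.

Lemma normr_sin1_le (f : R -> R) (k : R) :
  integrableR (leb R) f ->
  `|sin1 f k| <= \int[leb R]_x `|f x|.
Proof.
move=> fi; apply: normr_Rintegral_mul_le => //; last by move=> x; exact: normr_sin_le1.
by apply: measurableT_comp; [exact: measurable_sin|exact: measurable_funM].
Qed.

Lemma decay_weight_le (k u v n0 n2 n4 : R) :
  u <= n0 -> v <= n0 -> k ^+ 2 * u <= n2 -> k ^+ 2 * v <= n2 ->
  k ^+ 4 * u <= n4 -> k ^+ 4 * v <= n4 ->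
  (1 + k ^+ 2) ^+ 2 * (u + v) <= 2 * (n0 + 2 * n2 + n4).
Proof.
rewrite (_ : (1 + k ^+ 2) ^+ 2 * (u + v) = (u + v) + 2 * (k ^+ 2 * u + k ^+ 2 * v) +
  (k ^+ 4 * u + k ^+ 4 * v)); last by ring.
by move: (k ^+ 2 * u) (k ^+ 2 * v) (k ^+ 4 * u) (k ^+ 4 * v) => *; lra.
Qed.

(** Four integrations by parts: two would make the transform integrable, and two more
    compensate the growth of the symbol of (-Delta)^alpha. *)
Lemma transform1_decay (f : R -> R) (a b : R) :
  smooth1 f -> vanish_outside a b f ->
  exists2 B, 0 <= B & forall k, (1 + k ^+ 2) ^+ 2 * (`|cos1 f k| + `|sin1 f k|) <= B.
Proof.
move=> s0 v0.
have s1 := smooth1_derive1 s0; have v1 := vanish_outside_derive1 v0.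
have s2 := smooth1_derive1 s1; have v2 := vanish_outside_derive1 v1.
have s3 := smooth1_derive1 s2; have v3 := vanish_outside_derive1 v2.
have s4 := smooth1_derive1 s3; have v4 := vanish_outside_derive1 v3.
have i0 := vanish_outside_integrable (smooth1_continuous s0) v0.
have i2 := vanish_outside_integrable (smooth1_continuous s2) v2.
have i4 := vanish_outside_integrable (smooth1_continuous s4) v4.
have c2 k : cos1 (derive1 (derive1 f)) k = - k ^+ 2 * cos1 f k.
  by rewrite (cos1_derive k s1 v1) (sin1_derive k s0 v0); ring.
have d2 k : sin1 (derive1 (derive1 f)) k = - k ^+ 2 * sin1 f k.
  by rewrite (sin1_derive k s1 v1) (cos1_derive k s0 v0); ring.
have c4 k : cos1 (derive1 (derive1 (derive1 (derive1 f)))) k = k ^+ 4 * cos1 f k.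
  by rewrite (cos1_derive k s3 v3) (sin1_derive k s2 v2) c2; ring.
have d4 k : sin1 (derive1 (derive1 (derive1 (derive1 f)))) k = k ^+ 4 * sin1 f k.
  by rewrite (sin1_derive k s3 v3) (cos1_derive k s2 v2) d2; ring.
pose N (g : R -> R) := \int[leb R]_x `|g x|.
have N0 g : 0 <= N g by apply: Rintegral_ge0.
exists (2 * (N f + 2 * N (derive1 (derive1 f)) +
   N (derive1 (derive1 (derive1 (derive1 f)))))).
  by rewrite mulr_ge0// !addr_ge0// mulr_ge0.
move=> k; have k2 : 0 <= k ^+ 2 by exact: sqr_ge0.
have k4 : 0 <= k ^+ 4 by rewrite exprn_even_ge0.
have a1 := normr_cos1_le k i0; have b1 := normr_sin1_le k i0.
have := normr_cos1_le k i2; rewrite c2 normrM normrN (ger0_norm k2) => a2.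
have := normr_sin1_le k i2; rewrite d2 normrM normrN (ger0_norm k2) => b2.
have := normr_cos1_le k i4; rewrite c4 normrM (ger0_norm k4) => a3.
have := normr_sin1_le k i4; rewrite d4 normrM (ger0_norm k4) => b3.
exact: decay_weight_le a1 b1 a2 b2 a3 b3.
Qed.

Lemma integrable_tensor2 (f g : R -> R) :
  integrableR (leb R) f ->
  integrableR (leb R) g ->
  integrableR (@mu2 R) (tensor f g).
Proof.
move=> fi gi.
exact: (integrable_tensor (m1 := leb R) (m2 := leb R)).
Qed.

Lemma Rintegral_tensor (f g : R -> R) : integrableR (leb R) f -> integrableR (leb R) g ->
  \int[@mu2 R]_z tensor f g z = \int[leb R]_x f x * \int[leb R]_y g y.
Proof.
move=> fi gi; have ifg := integrable_tensor2 fi gi.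
have -> : \int[@mu2 R]_z tensor f g z = \int[leb R]_x \int[leb R]_y tensor f g (x, y).
  by rewrite (Rintegral_prod12 (m1 := leb R) (m2 := leb R) ifg).
rewrite -RintegralZr//; by apply: eq_Rintegral => x _; exact: (RintegralZl (f x) measurableT gi).
Qed.

Lemma cos_transform_tensor (f g : R -> R) (k : plane R) :
  integrableR (leb R) f -> integrableR (leb R) g ->
  cos_transform (tensor f g) k = cos1 f k.1 * cos1 g k.2 - sin1 f k.1 * sin1 g k.2.
Proof.
move=> fi gi; have cf := integrable_mul_cos k.1 fi; have sf := integrable_mul_sin k.1 fi.
have cg := integrable_mul_cos k.2 gi; have sg := integrable_mul_sin k.2 gi.
rewrite /cos1 /sin1 -!Rintegral_tensor//.
rewrite -(RintegralB measurableT (integrable_tensor2 cf cg) (integrable_tensor2 sf sg)).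
apply: eq_Rintegral => z _.
by rewrite /tensor /dot cosD (mulrC z.1) (mulrC z.2); ring.
Qed.

Lemma sin_transform_tensor (f g : R -> R) (k : plane R) :
  integrableR (leb R) f -> integrableR (leb R) g ->
  sin_transform (tensor f g) k = sin1 f k.1 * cos1 g k.2 + cos1 f k.1 * sin1 g k.2.
Proof.
move=> fi gi; have cf := integrable_mul_cos k.1 fi; have sf := integrable_mul_sin k.1 fi.
have cg := integrable_mul_cos k.2 gi; have sg := integrable_mul_sin k.2 gi.
rewrite /cos1 /sin1 -!Rintegral_tensor//.
rewrite -(RintegralD measurableT (integrable_tensor2 sf cg) (integrable_tensor2 cf sg)).
apply: eq_Rintegral => z _.
by rewrite /tensor /dot sinD (mulrC z.1) (mulrC z.2); ring.
Qed.

Lemma energy_transform_tensor (f g : R -> R) (k : plane R) :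
  integrableR (leb R) f ->
  integrableR (leb R) g ->
  cos_transform (tensor f g) k ^+ 2 + sin_transform (tensor f g) k ^+ 2 =
  power1 f k.1 * power1 g k.2.
Proof.
move=> fi gi; rewrite cos_transform_tensor// sin_transform_tensor// /power1.
by move: (cos1 _ _) (cos1 _ _) (sin1 _ _) (sin1 _ _) => *; ring.
Qed.

Lemma integral_tensor_sqr (f g : R -> R) :
  measurable_fun [set: R] f -> measurable_fun [set: R] g ->
  (\int[@mu2 R]_z (tensor f g z ^+ 2)%:E =
   energy (leb R) f * energy (leb R) g)%E.
Proof.
move=> mf mg.
have mf2 : measurable_fun setT (fun x => (f x ^+ 2)%:E).
  by apply/measurable_EFinP; exact: measurable_funX.
have mg2 : measurable_fun setT (fun x => (g x ^+ 2)%:E).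
  by apply/measurable_EFinP; exact: measurable_funX.
rewrite (integral_mu2_12 (F := fun z => tensor f g z ^+ 2)); last 2 first.
- apply: measurable_funX; apply: measurable_funM.
    exact: measurableT_comp mf measurable_fst.
  exact: measurableT_comp mg measurable_snd.
- by move=> z; exact: sqr_ge0.
transitivity (\int[leb R]_x ((f x ^+ 2)%:E *
    energy (leb R) g))%E.
  apply: eq_integral => x _; rewrite /tensor /=.
  under eq_integral do rewrite exprMn EFinM.
  by apply: ge0_integralZl => // *; rewrite lee_fin sqr_ge0.
apply: ge0_integralZr => //.
- by move=> x _; rewrite lee_fin sqr_ge0.
- by apply: integral_ge0 => x _; rewrite lee_fin sqr_ge0.
Qed.

End tensors.

(** * The fractional Laplacian of a profile *)

Section dissipation.
Context (R : realType).

Lemma dotC (x y : R * R) : dot x y = dot y x.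
Proof. by rewrite /dot mulrC (mulrC x.2). Qed.

Lemma frac_laplacianE (a : R) (f : plane R -> R) (x : plane R) :
  integrableR (@mu2 R) f ->
  frac_laplacian a f x = (2 * pi) ^- 2 * \int[@mu2 R]_k
    (riesz_symbol (2 * a) k *
     (cos_transform f k * cos (dot x k) + sin_transform f k * sin (dot x k))).
Proof.
move=> fi.
have ReZ (c : R) (z : R[i]) : complex.Re (c%:C%C * z) = c * complex.Re z.
  by case: z => u v /=; rewrite mul0r subr0.
rewrite /frac_laplacian /inv_fourier ReZ; congr (_ * _).
apply: (@eq_Rintegral _ _ _ (@mu2 R)) => k _; rewrite fourier_toC//=.
by rewrite !mul0r subr0 addr0; ring.
Qed.

Lemma cos_transformZ (c : R) (f : plane R -> R) (k : plane R) :
  integrableR (@mu2 R) f ->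
  cos_transform (fun x => c * f x) k = c * cos_transform f k.
Proof.
move=> fi; rewrite /cos_transform -RintegralZl//.
  by apply: eq_Rintegral => x _; rewrite mulrA.
apply: (@integrable_mul_bounded _ _ _ _ _ _ 1) fi _ _.
  exact: measurable_fun_pair1 (@measurable_cos_dot R).
by move=> x; exact: normr_cos_le1.
Qed.

Lemma sin_transformZ (c : R) (f : plane R -> R) (k : plane R) :
  integrableR (@mu2 R) f ->
  sin_transform (fun x => c * f x) k = c * sin_transform f k.
Proof.
move=> fi; rewrite /sin_transform -RintegralZl//.
  by apply: eq_Rintegral => x _; rewrite mulrA.
apply: (@integrable_mul_bounded _ _ _ _ _ _ 1) fi _ _.
  exact: measurable_fun_pair1 (@measurable_sin_dot R).
by move=> x; exact: normr_sin_le1.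
Qed.

Lemma integrable_oscillatory (G H : plane R -> R) (x : plane R) :
  integrableR (@mu2 R) G -> integrableR (@mu2 R) H ->
  integrableR (@mu2 R) (fun k => G k * cos (dot k x) + H k * sin (dot k x)).
Proof.
move=> Gi Hi.
have i1 : integrableR (@mu2 R) (fun k => G k * cos (dot k x)).
  apply: (@integrable_mul_bounded _ _ _ _ _ _ 1) Gi _ _.
    exact: measurable_fun_pair1 (@measurable_cos_dot R).
  by move=> k; exact: normr_cos_le1.
have i2 : integrableR (@mu2 R) (fun k => H k * sin (dot k x)).
  apply: (@integrable_mul_bounded _ _ _ _ _ _ 1) Hi _ _.
    exact: measurable_fun_pair1 (@measurable_sin_dot R).
  by move=> k; exact: normr_sin_le1.
exact: integrableRD i1 i2.
Qed.

(** Written through the real transforms again, the inversion formula has an energy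
    that [plancherel] computes. *)
Lemma frac_laplacian_transform (a : R) (f : plane R -> R) (x : plane R) :
  integrableR (@mu2 R) f ->
  integrableR (@mu2 R) (fun k => riesz_symbol (2 * a) k * cos_transform f k) ->
  integrableR (@mu2 R) (fun k => riesz_symbol (2 * a) k * sin_transform f k) ->
  frac_laplacian a f x = (2 * pi) ^- 2 *
    (cos_transform (fun k => riesz_symbol (2 * a) k * cos_transform f k) x +
     sin_transform (fun k => riesz_symbol (2 * a) k * sin_transform f k) x).
Proof.
move=> fi ci si; rewrite frac_laplacianE//; congr (_ * _).
rewrite /cos_transform -/(cos_transform f) /sin_transform -/(sin_transform f).
rewrite -RintegralD//.
- apply: eq_Rintegral => k _; rewrite (dotC x).
  by rewrite -/(cos_transform f k) -/(sin_transform f k); ring.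
- apply: (@integrable_mul_bounded _ _ _ _ _ _ 1) ci _ _.
    exact: measurable_fun_pair1 (@measurable_cos_dot R).
  by move=> k; exact: normr_cos_le1.
- apply: (@integrable_mul_bounded _ _ _ _ _ _ 1) si _ _.
    exact: measurable_fun_pair1 (@measurable_sin_dot R).
  by move=> k; exact: normr_sin_le1.
Qed.

Lemma frac_laplacianZ (a c : R) (f : plane R -> R) (x : plane R) :
  integrableR (@mu2 R) f ->
  integrableR (@mu2 R) (fun k => riesz_symbol (2 * a) k * cos_transform f k) ->
  integrableR (@mu2 R) (fun k => riesz_symbol (2 * a) k * sin_transform f k) ->
  frac_laplacian a (fun y => c * f y) x = c * frac_laplacian a f x.
Proof.
move=> fi ci si.
have cfi : integrableR (@mu2 R) (fun y => c * f y).
  exact: integrableRZ fi.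
rewrite !frac_laplacianE// mulrCA; congr (_ * _).
have i := integrable_oscillatory x ci si.
rewrite -RintegralZl//.
  apply: eq_Rintegral => k _; rewrite cos_transformZ// sin_transformZ//.
  by move: (cos_transform f k) (sin_transform f k) (riesz_symbol _ _) => *; ring.
move: i; apply: eq_integrable => // k _ /=; rewrite (dotC k); congr EFin.
by move: (cos_transform f k) (sin_transform f k) (riesz_symbol _ _) => *; ring.
Qed.

Lemma riesz_symbol_ge0 (s : R) (k : plane R) : 0 <= riesz_symbol s k.
Proof. exact: powR_ge0. Qed.

Lemma measurable_riesz_symbol (s : R) :
  measurable_fun setT (@riesz_symbol R s : plane R -> R).
Proof. exact: measurableT_comp (@measurable_powR R s) (@measurable_enorm R). Qed.

(** The range of [a] places the order 2 a of the operator between 1 and 2. *)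
Lemma riesz_symbol_le (a : R) (k : plane R) : 1 / 2 < a <= 1 ->
  riesz_symbol (2 * a) k <= enorm k + enorm k ^+ 2.
Proof.
move=> /andP[a1 a2]; rewrite /riesz_symbol; set n := enorm k.
have n0 : 0 <= n by exact: sqrtr_ge0.
have h1 : 1 <= 2 * a by lra.
have h2 : 2 * a <= 2%:R by lra.
move: n0; rewrite le_eqVlt => /predU1P[<-|n0].
  by rewrite powR0 ?expr0n ?addr0// gt_eqF//; lra.
have [n1|n1] := leP n 1.
  apply: (@le_trans _ _ (n `^ 1)); first by apply: ger_powR; rewrite ?n0.
  by rewrite powRr1 ?(ltW n0)// lerDl sqr_ge0.
apply: (@le_trans _ _ (n `^ 2%:R)); first by apply: ler_powR => //; exact: ltW.
by rewrite powR_mulrn ?(ltW n0)// lerDr ltW.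
Qed.

Lemma enorm_sqr (k : R * R) : enorm k ^+ 2 = k.1 ^+ 2 + k.2 ^+ 2.
Proof. by rewrite sqr_sqrtr// addr_ge0 ?sqr_ge0. Qed.

Lemma riesz_symbol_weight_le (a : R) (k : plane R) : 1 / 2 < a <= 1 ->
  riesz_symbol (2 * a) k <= 2 * (1 + k.1 ^+ 2) * (1 + k.2 ^+ 2).
Proof.
move=> ha; apply: (le_trans (riesz_symbol_le k ha)).
have n2 := enorm_sqr k; have n0 : 0 <= enorm k by exact: sqrtr_ge0.
apply: (@le_trans _ _ (2 * (1 + enorm k ^+ 2))).
  by have := sqr_ge0 (enorm k - 1); rewrite !expr2; nra.
rewrite n2; have := sqr_ge0 k.1; have := sqr_ge0 k.2.
by move: (k.1 ^+ 2) (k.2 ^+ 2) => p q hp hq; nra.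
Qed.

Lemma riesz_symbol_sqr_le (a : R) (k : plane R) : 1 / 2 < a <= 1 ->
  riesz_symbol (2 * a) k ^+ 2 <=
    4 * ((k.1 ^+ 2 + k.2 ^+ 2) + ((k.1 ^+ 2) ^+ 2 + (k.2 ^+ 2) ^+ 2)).
Proof.
move=> ha; have h := riesz_symbol_le k ha.
have m0 := riesz_symbol_ge0 (2 * a) k.
have n2 := enorm_sqr k; have n0 : 0 <= enorm k by exact: sqrtr_ge0.
apply: (@le_trans _ _ ((enorm k + enorm k ^+ 2) ^+ 2)).
  by rewrite lerXn2r ?nnegrE// (le_trans m0).
apply: (le_trans (sqrD_le _ _)); rewrite n2.
have := sqr_ge0 k.1; have := sqr_ge0 k.2; move: (k.1 ^+ 2) (k.2 ^+ 2) => p q hp hq.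
by have := sqr_ge0 (p - q); rewrite !expr2; nra.
Qed.

Lemma integrable_riesz_tensor (a b c : R) (e : R -> R)
    (T : plane R -> R) :
  1 / 2 < a <= 1 -> smooth1 e -> vanish_outside b c e -> measurable_fun setT T ->
  (forall k, `|T k| <= (`|cos1 e k.1| + `|sin1 e k.1|) * (`|cos1 e k.2| + `|sin1 e k.2|)) ->
  integrableR (@mu2 R) (fun k => riesz_symbol (2 * a) k * T k).
Proof.
move=> ha se ve mT Te; have [B B0 eB] := transform1_decay se ve.
have ip : integrableR (leb R) (fun k => poisson 1 (0 - k)).
  apply/integrableP; split.
    apply/measurable_EFinP; apply: measurableT_comp; first exact: measurable_poisson.
    exact: measurable_funB.
  under eq_integral do rewrite /= ger0_norm ?(ltW (poisson_gt0 _ ltr01))//.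
  by rewrite integral_poisson// ltry.
have i := integrableRZ (B ^+ 2 / 2) (integrable_tensor2 ip ip).
apply: (integrable_dominated (mu := @mu2 R)
  (g := fun k => B ^+ 2 / 2 * tensor (fun k => poisson 1 (0 - k)) (fun k => poisson 1 (0 - k)) k)).
- by apply: measurable_funM => //; exact: measurable_riesz_symbol.
- move=> k; rewrite normrM (ger0_norm (riesz_symbol_ge0 _ _)).
  apply: (@le_trans _ _ (2 * (1 + k.1 ^+ 2) * (1 + k.2 ^+ 2) *
    ((`|cos1 e k.1| + `|sin1 e k.1|) * (`|cos1 e k.2| + `|sin1 e k.2|)))).
    by apply: ler_pM => //; [exact: riesz_symbol_ge0|exact: riesz_symbol_weight_le].
  rewrite /tensor /poisson !sub0r !sqrrN !expr1n !mulr1.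
  have h1 := eB k.1; have h2 := eB k.2.
  have p1 : 0 < 1 + k.1 ^+ 2 by rewrite ltr_wpDr ?sqr_ge0.
  have p2 : 0 < 1 + k.2 ^+ 2 by rewrite ltr_wpDr ?sqr_ge0.
  have u0 : 0 <= `|cos1 e k.1| + `|sin1 e k.1| by rewrite addr_ge0.
  have v0 : 0 <= `|cos1 e k.2| + `|sin1 e k.2| by rewrite addr_ge0.
  move: h1 h2 p1 p2 u0 v0.
  move: (`|cos1 e k.1| + _) (`|cos1 e k.2| + _) (1 + k.1 ^+ 2) (1 + k.2 ^+ 2) => u v p q h1 h2 p0 q0 u0 v0.
  have -> : B ^+ 2 / 2 * (2 / p * (2 / q)) = 2 * (B * B) / (p * q).
    by field; rewrite (gt_eqF p0) (gt_eqF q0).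
  rewrite ler_pdivlMr ?mulr_gt0//.
  rewrite (_ : _ * (p * q) = 2 * ((p ^+ 2 * u) * (q ^+ 2 * v))); last by ring.
  by rewrite ler_wpM2l// ler_pM// mulr_ge0// sqr_ge0.
- exact: i.
Qed.

(** The operator applied to e (x) e is small in L^2 as soon as the first two
    derivatives of [e] are: the square of its symbol is at most a sum of second and
    fourth powers of one coordinate, which are the transforms of derivatives. *)
Lemma frac_laplacian_energy (a b c delta : R) (e : R -> R) :
  1 / 2 < a <= 1 -> smooth1 e -> vanish_outside b c e ->
  (energy (leb R) e = 1%:E)%E ->
  (\int[leb R]_x (derive1 e x ^+ 2)%:E <= (delta ^+ 2)%:E)%E ->
  (\int[leb R]_x (derive1 (derive1 e) x ^+ 2)%:E <= (delta ^+ 2)%:E)%E ->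
  [/\ measurable_fun setT (frac_laplacian a (tensor e e) : plane R -> R),
      (forall (d : R) x, frac_laplacian a (fun y => d * tensor e e y) x =
         d * frac_laplacian a (tensor e e) x) &
      (\int[@mu2 R]_x (frac_laplacian a (tensor e e) x ^+ 2)%:E <=
         (32 * delta ^+ 2)%:E)%E].
Proof.
move=> ha s0 v0 e1 e2 e3.
have s1 := smooth1_derive1 s0; have v1 := vanish_outside_derive1 v0.
have s2 := smooth1_derive1 s1; have v2 := vanish_outside_derive1 v1.
have i0 := vanish_outside_integrable (smooth1_continuous s0) v0.
have i1 := vanish_outside_integrable (smooth1_continuous s1) v1.
have i2 := vanish_outside_integrable (smooth1_continuous s2) v2.
have mes (g : R -> R) (sg : smooth1 g) := smooth1_measurable sg.
pose phi := tensor e e; have iphi : integrableR (@mu2 R) phi.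
  exact: integrable_tensor2.
have mphi := integrable_measurable iphi.
have mC := measurable_cos_transform mphi; have mS := measurable_sin_transform mphi.
pose m := @riesz_symbol R (2 * a).
have mm : measurable_fun setT (m : plane R -> R) by exact: measurable_riesz_symbol.
pose G k := m k * cos_transform phi k; pose H k := m k * sin_transform phi k.
have iG : integrableR (@mu2 R) G.
  apply: (integrable_riesz_tensor ha s0 v0) => // k; rewrite cos_transform_tensor//.
  apply: le_trans (ler_normB _ _) _; rewrite !normrM mulrDl !mulrDr.
  by rewrite lerD// ?lerDl ?lerDr mulr_ge0.
have iH : integrableR (@mu2 R) H.
  apply: (integrable_riesz_tensor ha s0 v0) => // k; rewrite sin_transform_tensor//.
  apply: le_trans (ler_normD _ _) _; rewrite !normrM mulrDl !mulrDr.
  by rewrite addrC lerD// ?lerDl ?lerDr mulr_ge0.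
have LE x : frac_laplacian a phi x = (2 * pi) ^- 2 * (cos_transform G x + sin_transform H x).
  exact: frac_laplacian_transform.
have mG := integrable_measurable iG; have mH := integrable_measurable iH.
have mcG := measurable_cos_transform mG; have msH := measurable_sin_transform mH.
split.
- rewrite (_ : frac_laplacian a _ = (fun x => (2 * pi) ^- 2 *
    (cos_transform G x + sin_transform H x))); last by apply/funext => x; exact: LE.
  by apply: measurable_funM => //; exact: measurable_funD.
- by move=> d x; exact: frac_laplacianZ.
(* each weight is the energy of the transform of a derivative *)
have weight (f g : R -> R) (j : plane R -> R) :
    smooth1 f -> smooth1 g -> integrableR (leb R) f ->
    integrableR (leb R) g ->
    (forall k, power1 f k.1 * power1 g k.2 = j k * (power1 e k.1 * power1 e k.2)) ->
    (energy (leb R) f * energy (leb R) g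
       <= (delta ^+ 2)%:E)%E ->
    (\int[@mu2 R]_k (j k * (power1 e k.1 * power1 e k.2))%:E <=
       ((2 * pi) ^+ 2 * delta ^+ 2)%:E)%E /\
    measurable_fun setT (fun k => j k * (power1 e k.1 * power1 e k.2)).
  move=> sf sg fi gi fg fgd.
  have E k : cos_transform (tensor f g) k ^+ 2 + sin_transform (tensor f g) k ^+ 2 =
      j k * (power1 e k.1 * power1 e k.2) by rewrite energy_transform_tensor.
  have ifg := integrable_tensor2 fi gi.
  have int2 := integral_tensor_sqr (mes _ sf) (mes _ sg).
  split; last first.
    under eq_fun do rewrite -E.
    exact: measurable_transform_sqr (integrable_measurable ifg).
  under eq_integral do rewrite -E.
  rewrite plancherel//; last by rewrite int2 (le_lt_trans fgd)// ltry.
  rewrite int2 (EFinM ((2 * pi) ^+ 2) (delta ^+ 2)).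
  have c0 : (0 <= ((2 * (pi : R)) ^+ 2)%:E)%E by rewrite lee_fin sqr_ge0.
  exact: (lee_wpmul2l c0 fgd).
have P1 k : power1 (derive1 e) k = k ^+ 2 * power1 e k by exact: power1_derive s0 v0.
have P2 k : power1 (derive1 (derive1 e)) k = (k ^+ 2) ^+ 2 * power1 e k.
  by rewrite (power1_derive k s1 v1) P1 mulrA -expr2.
pose p (k : plane R) := power1 e k.1 * power1 e k.2.
have p0 k : 0 <= p k by rewrite mulr_ge0 ?power1_ge0.
have mp : measurable_fun setT p.
  rewrite (_ : p = (fun k => cos_transform phi k ^+ 2 + sin_transform phi k ^+ 2)).
    exact: measurable_transform_sqr.
  by apply/funext => k; rewrite energy_transform_tensor.
have q1 : (\int[leb R]_x ((derive1 e) x ^+ 2)%:E * energy (leb R) e <= (delta ^+ 2)%:E)%E.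
  by rewrite e1 mule1.
have [|w1 m1] := weight (derive1 e) e (fun k : plane R => k.1 ^+ 2) s1 s0 i1 i0 _ q1.
  by move=> k; rewrite P1 mulrA.
have q2 : (energy (leb R) e * \int[leb R]_x ((derive1 e) x ^+ 2)%:E <= (delta ^+ 2)%:E)%E.
  by rewrite e1 mul1e.
have [|w2 m2] := weight e (derive1 e) (fun k : plane R => k.2 ^+ 2) s0 s1 i0 i1 _ q2.
  by move=> k; rewrite P1 mulrCA.
have q3 : (\int[leb R]_x ((derive1 (derive1 e)) x ^+ 2)%:E * energy (leb R) e <= (delta ^+ 2)%:E)%E.
  by rewrite e1 mule1.
have [|w3 m3] := weight (derive1 (derive1 e)) e (fun k : plane R => (k.1 ^+ 2) ^+ 2) s2 s0 i2 i0 _ q3.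
  by move=> k; rewrite P2 mulrA.
have q4 : (energy (leb R) e * \int[leb R]_x ((derive1 (derive1 e)) x ^+ 2)%:E <= (delta ^+ 2)%:E)%E.
  by rewrite e1 mul1e.
have [|w4 m4] := weight e (derive1 (derive1 e)) (fun k : plane R => (k.2 ^+ 2) ^+ 2) s0 s2 i0 i2 _ q4.
  by move=> k; rewrite P2 mulrCA.
set D := (2 * pi) ^+ 2 * delta ^+ 2 in w1 w2 w3 w4.
have pair (A1 A2 : plane R -> R) : measurable_fun setT A1 -> measurable_fun setT A2 ->
    (forall k, 0 <= A1 k) -> (forall k, 0 <= A2 k) ->
    (\int[@mu2 R]_k (A1 k)%:E <= D%:E)%E -> (\int[@mu2 R]_k (A2 k)%:E <= D%:E)%E ->
    (\int[@mu2 R]_k (A1 k + A2 k)%:E <= (2 * D)%:E)%E.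
  move=> mA1 mA2 A10 A20 h1 h2.
  apply: (@le_trans _ _ (1%:E * (\int[@mu2 R]_k (A1 k)%:E + \int[@mu2 R]_k (A2 k)%:E))%E).
    apply: le_integralD => //; first exact: measurable_funD.
      by move=> k; rewrite addr_ge0.
    by move=> k; rewrite mul1r.
  rewrite mul1e (_ : 2 * D = D + D); last by ring.
  by rewrite EFinD; exact: leeD.
have q0 (r : R) k : 0 <= r ^+ 2 * p k by rewrite mulr_ge0 ?sqr_ge0.
have mass : (\int[@mu2 R]_k (m k ^+ 2 * p k)%:E <= (16 * D)%:E)%E.
  apply: (@le_trans _ _ (4%:E * (\int[@mu2 R]_k (k.1 ^+ 2 * p k + k.2 ^+ 2 * p k)%:E +
     \int[@mu2 R]_k ((k.1 ^+ 2) ^+ 2 * p k + (k.2 ^+ 2) ^+ 2 * p k)%:E))%E).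
    apply: le_integralD => //.
    - by apply: measurable_funM => //; exact: measurable_funX.
    - exact: measurable_funD.
    - exact: measurable_funD.
    - by move=> k; rewrite addr_ge0.
    - by move=> k; rewrite addr_ge0.
    - by move=> k; rewrite -!mulrDl mulrA ler_wpM2r//; exact: riesz_symbol_sqr_le.
  apply: (@le_trans _ _ (4%:E * ((2 * D)%:E + (2 * D)%:E))%E).
    by apply: lee_wpmul2l; rewrite ?lee_fin//; apply: leeD; exact: pair.
  by rewrite -EFinD -EFinM lee_fin le_eqVlt; apply/orP; left; apply/eqP; ring.
have GH : (energy (@mu2 R) G + energy (@mu2 R) H =
    \int[@mu2 R]_k (m k ^+ 2 * p k)%:E)%E.
  rewrite -ge0_integralD//; last 4 first.
  - by move=> k _; rewrite lee_fin sqr_ge0.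
  - by apply/measurable_EFinP; exact: measurable_funX.
  - by move=> k _; rewrite lee_fin sqr_ge0.
  - by apply/measurable_EFinP; exact: measurable_funX.
  apply: eq_integral => k _; rewrite -EFinD /G /H !exprMn -mulrDr; congr (_ * _)%:E.
  by rewrite energy_transform_tensor.
have G0 : (0 <= energy (@mu2 R) G)%E.
  by apply: integral_ge0 => k _; rewrite lee_fin sqr_ge0.
have H0 : (0 <= energy (@mu2 R) H)%E.
  by apply: integral_ge0 => k _; rewrite lee_fin sqr_ge0.
have massoo : (\int[@mu2 R]_k (m k ^+ 2 * p k)%:E < +oo)%E.
  by rewrite (le_lt_trans mass)// ltry.
have Goo : (energy (@mu2 R) G < +oo)%E.
  by apply: le_lt_trans massoo; rewrite -GH; exact: leeDl.
have Hoo : (energy (@mu2 R) H < +oo)%E.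
  by apply: le_lt_trans massoo; rewrite -GH; exact: leeDr.
have pi2 : 0 < (2 * (pi : R)) ^+ 2 by rewrite exprn_gt0// mulr_gt0// pi_gt0.
set q := (2 * pi) ^+ 2 in pi2 D pair mass w1 w2 w3 w4 LE *.
have cG : (\int[@mu2 R]_x (cos_transform G x ^+ 2)%:E <= q%:E * energy (@mu2 R) G)%E.
  rewrite -(plancherel iG Goo); apply: ge0_le_integral => //.
  - by move=> x _; rewrite lee_fin sqr_ge0.
  - by apply/measurable_EFinP; exact: measurable_funX.
  - by apply/measurable_EFinP; exact: measurable_transform_sqr.
  - by move=> x _; rewrite lee_fin lerDl sqr_ge0.
have sH : (\int[@mu2 R]_x (sin_transform H x ^+ 2)%:E <= q%:E * energy (@mu2 R) H)%E.
  rewrite -(plancherel iH Hoo); apply: ge0_le_integral => //.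
  - by move=> x _; rewrite lee_fin sqr_ge0.
  - by apply/measurable_EFinP; exact: measurable_funX.
  - by apply/measurable_EFinP; exact: measurable_transform_sqr.
  - by move=> x _; rewrite lee_fin lerDr sqr_ge0.
apply: (@le_trans _ _ ((2 * (q^-1) ^+ 2)%:E * (\int[@mu2 R]_x (cos_transform G x ^+ 2)%:E +
   \int[@mu2 R]_x (sin_transform H x ^+ 2)%:E))%E).
  apply: le_integralD => //.
  - apply: measurable_funX; rewrite (_ : frac_laplacian a _ = (fun x => q^-1 *
      (cos_transform G x + sin_transform H x))); last by apply/funext => x; exact: LE.
    by apply: measurable_funM => //; exact: measurable_funD.
  - exact: measurable_funX.
  - exact: measurable_funX.
  - by move=> x; rewrite sqr_ge0.
  - by move=> x; rewrite sqr_ge0.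
  - by move=> x; rewrite sqr_ge0.
  - by rewrite mulr_ge0 ?sqr_ge0.
  - move=> x; rewrite LE exprMn (mulrC 2) -(mulrA (q^-1 ^+ 2)).
    by apply: ler_wpM2l; [exact: sqr_ge0|exact: sqrD_le].
apply: (@le_trans _ _ ((2 * (q^-1) ^+ 2)%:E * (q%:E * (16 * D)%:E))%E).
  apply: lee_wpmul2l; first by rewrite lee_fin mulr_ge0 ?sqr_ge0.
  apply: (@le_trans _ _ (q%:E * (energy (@mu2 R) G + energy (@mu2 R) H))%E).
    by rewrite ge0_muleDr//; exact: leeD.
  by rewrite GH; apply: lee_wpmul2l; rewrite ?lee_fin ?(ltW pi2).
rewrite -!EFinM lee_fin /D le_eqVlt; apply/orP; left; apply/eqP.
by move: (q) pi2 => t t0; field; rewrite (gt_eqF t0).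
Qed.

End dissipation.

(** * Tensor test functions *)

Section test_functions.
Context (R : realType).

Lemma is_derive_line (V : normedModType R) (f : V -> R) (z v : V) (d : R) :
  is_derive (0 : R) 1 (fun h : R => f (h *: v + z)) d -> is_derive z v f d.
Proof.
move=> [df Df]; split; first exact: (iffRL (derivable1P f z v) df).
rewrite -Df /derive; apply: (congr1 (fun F : R -> R => lim (F @ (0 : R)^'))).
apply/funext => h /=.
by rewrite addr0 scale0r add0r [_%:A]mulr1.
Qed.

Lemma smooth1_is_derive_line (f : R -> R) (a b : R) :
  smooth1 f -> is_derive (0 : R) 1 (fun h : R => f (h * a + b)) (a * derive1 f b).
Proof.
move=> sf; have da : is_derive (0 : R) 1 (fun h : R => h * a + b) a.
  by apply: is_derive_eq; rewrite /GRing.scale /=; ring.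
have df : is_derive (0 * a + b : R) 1 f (derive1 f (0 * a + b)).
  exact: smooth1_is_derive.
have := @is_derive1_comp R f (fun h : R => h * a + b) 0 _ _ df da; rewrite mul0r add0r /GRing.scale /=.
by rewrite mulrC.
Qed.

(** Sums are needed because a directional derivative of one product of functions of
    the three coordinates is a sum of three such products. *)
Inductive tensor_sum : (R * (R * R) -> R) -> Prop :=
| tensor_sum_mul (c f g : R -> R) : smooth1 c -> smooth1 f -> smooth1 g ->
    tensor_sum (fun z => c z.1 * tensor f g z.2)
| tensor_sum_add (p q : R * (R * R) -> R) : tensor_sum p -> tensor_sum q ->
    tensor_sum (fun z => p z + q z).

Lemma tensor3_is_derive (c f g : R -> R) (z v : R * (R * R)) :
  smooth1 c -> smooth1 f -> smooth1 g ->
  is_derive z v (fun z => c z.1 * tensor f g z.2)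
    (v.1 * derive1 c z.1 * tensor f g z.2 +
     (c z.1 * tensor (fun x => v.2.1 * derive1 f x) g z.2 +
      c z.1 * tensor f (fun x => v.2.2 * derive1 g x) z.2)).
Proof.
move=> sc sf sg.
apply: (@is_derive_line _ (fun z : R * (R * R) => c z.1 * tensor f g z.2) z v).
rewrite /tensor /=.
have dc := smooth1_is_derive_line v.1 z.1 sc.
have df := smooth1_is_derive_line v.2.1 z.2.1 sf.
have dg := smooth1_is_derive_line v.2.2 z.2.2 sg.
apply: (is_derive_eq (is_deriveM dc (is_deriveM df dg))).
have fg0 : ((fun h : R => f (h * v.2.1 + z.2.1)) * (fun h : R => g (h * v.2.2 + z.2.2))) 0
    = f z.2.1 * g z.2.2.
  by rewrite -[LHS]/(f (0 * v.2.1 + z.2.1) * g (0 * v.2.2 + z.2.2)) !mul0r !add0r.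
rewrite /GRing.scale /= fg0 !mul0r !add0r.
by move: (c _) (f _) (g _) (derive1 c _) (derive1 f _) (derive1 g _) => *; ring.
Qed.

Lemma tensor_sum_is_derive (p : R * (R * R) -> R) (v : R * (R * R)) :
  tensor_sum p -> exists2 q, tensor_sum q & forall z, is_derive z v p (q z).
Proof.
elim=> [c f g sc sf sg|p1 p2 _ [q1 t1 d1] _ [q2 t2 d2]]; last first.
  exists (fun z => q1 z + q2 z); first exact: tensor_sum_add.
  by move=> z; have := d1 z; have := d2 z => *; exact: is_deriveD.
eexists; last by move=> z; exact: tensor3_is_derive.
apply: tensor_sum_add.
  apply: (@tensor_sum_mul (fun x => v.1 * derive1 c x)) => //.
  by apply: smooth1M; [exact: smooth1_cst|exact: smooth1_derive1].
by apply: tensor_sum_add; apply: tensor_sum_mul => //; apply: smooth1M;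
  (exact: smooth1_cst || exact: smooth1_derive1).
Qed.

Lemma tensor_sum_continuous (p : R * (R * R) -> R) :
  tensor_sum p -> continuous p.
Proof.
elim=> [c f g sc sf sg|p1 p2 _ c1 _ c2] z; last first.
  by apply: cvgD; [exact: c1|exact: c2].
have [cc [cf cg]] : continuous c /\ continuous f /\ continuous g.
  by do 2?split; exact: smooth1_continuous.
have c2 : {for z, continuous (fun z : R * (R * R) => z.2)} by exact: cvg_snd.
apply: cvgM; first by apply: continuous_comp; [exact: cvg_fst|exact: cc].
apply: cvgM.
  apply: (@continuous_comp _ _ _ (fun z : R * (R * R) => z.2.1) f); last exact: cf.
  by apply: (@continuous_comp _ _ _ snd fst); [exact: c2|exact: cvg_fst].
apply: (@continuous_comp _ _ _ (fun z : R * (R * R) => z.2.2) g); last exact: cg.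
by apply: (@continuous_comp _ _ _ snd snd); [exact: c2|exact: cvg_snd].
Qed.

Lemma tensor_sum_smooth (p : R * (R * R) -> R) :
  tensor_sum p -> smooth p.
Proof.
move=> tp s; set dp := foldr _ _ _.
suff tdp : tensor_sum dp.
  split; first exact: tensor_sum_continuous.
  by move=> z v; have [q _ dq] := tensor_sum_is_derive v tdp; have [] := dq z.
rewrite {}/dp; elim: s => [//|v s IH] /=.
have [q tq dq] := tensor_sum_is_derive v IH.
rewrite (_ : (fun z => _) = q)//; apply/funext => z.
by have := dq z => ?; exact: derive_val.
Qed.

Lemma tensor3_test_function (c f g : R -> R) (a0 b0 a1 b1 a2 b2 : R) :
  smooth1 c -> smooth1 f -> smooth1 g ->
  vanish_outside a0 b0 c -> vanish_outside a1 b1 f -> vanish_outside a2 b2 g ->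
  test_function (fun z => c z.1 * tensor f g z.2).
Proof.
move=> sc sf sg vc vf vg; split.
  by apply: tensor_sum_smooth; exact: tensor_sum_mul.
have cB : compact (`[a0, b0] `*` (`[a1, b1] `*` `[a2, b2]) : set (R * (R * R))).
  by apply: compact_setX; [|apply: compact_setX]; exact: segment_compact.
apply: (subclosed_compact _ cB); first exact: closed_closure.
rewrite [X in _ `<=` X](iffLR (closure_id _)); last first.
  by apply: compact_closed => //; exact: norm_hausdorff.
apply: closureS => z /=; rewrite !mulf_eq0 !negb_or => /andP[c0 /andP[f0 g0]].
rewrite /= !in_itv /=; split; [|split].
- by apply: contraNT c0 => h; apply/eqP; exact: vc.
- by apply: contraNT f0 => h; apply/eqP; exact: vf.
- by apply: contraNT g0 => h; apply/eqP; exact: vg.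
Qed.

Lemma tensor3_derivatives (c f g : R -> R) (z : R * (R * R)) :
  smooth1 c -> smooth1 f -> smooth1 g -> let phi := fun z => c z.1 * tensor f g z.2 in
  [/\ dt phi z = derive1 c z.1 * tensor f g z.2,
      dx1 phi z = c z.1 * tensor (derive1 f) g z.2 &
      dx2 phi z = c z.1 * tensor f (derive1 g) z.2].
Proof.
move=> sc sf sg phi; have D v := @tensor3_is_derive c f g z v sc sf sg.
rewrite /dt /dx1 /dx2; split.
- rewrite (@derive_val _ _ _ _ _ _ _ (D (1, (0, 0)))) /tensor /=; ring.
- rewrite (@derive_val _ _ _ _ _ _ _ (D (0, (1, 0)))) /tensor /=; ring.
- rewrite (@derive_val _ _ _ _ _ _ _ (D (0, (0, 1)))) /tensor /=; ring.
Qed.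

End test_functions.

(** * The pairing of a solution with the datum *)

Section L2_norm.
Context (R : realType).

Lemma L2norm_sqr (f : plane R -> R) :
  (L2norm f ^+ 2 = energy (@mu2 R) f)%E.
Proof.
have -> : (L2norm f ^+ 2 = L2norm f `^ 2)%E.
  have : (0 <= L2norm f)%E by exact: Lnorm_ge0.
  case: (L2norm f) => [s s0|_|//]; first by rewrite poweR_EFin powR_mulrn// EFin_expe.
  by rewrite /= pnatr_eq0 -[LHS]/(+oo * +oo)%E mulyy.
rewrite /L2norm /Lpnorm powR_Lnorm//.
apply: (@eq_integral _ _ _ (@mu2 R)) => x _ /=.
by rewrite powR_mulrn ?normr_ge0// real_normK// num_real.
Qed.

Lemma L2norm_ge0 (f : plane R -> R) : (0 <= L2norm f)%E.
Proof. exact: Lnorm_ge0. Qed.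

Lemma L2norm_le (f : plane R -> R) (r : R) : 0 <= r ->
  (L2norm f <= r%:E)%E = (energy (@mu2 R) f <= (r ^+ 2)%:E)%E.
Proof.
move=> r0; rewrite -L2norm_sqr; have := L2norm_ge0 f.
case: (L2norm f) => [s s0|_|//]; last by rewrite expe2 mulyy.
by rewrite -EFin_expe !lee_fin ler_pXn2r// nnegrE.
Qed.

Lemma L2norm_eq (f : plane R -> R) (r : R) : 0 <= r ->
  (energy (@mu2 R) f = (r ^+ 2)%:E)%E -> L2norm f = r%:E.
Proof.
move=> r0; rewrite -L2norm_sqr; have := L2norm_ge0 f.
case: (L2norm f) => [s s0|_|//]; last by rewrite expe2 mulyy.
by rewrite -EFin_expe => -[] /eqP; rewrite eqrXn2// => /eqP ->.
Qed.

Lemma Lfun2_of_norm (f : plane R -> R) (r : R) :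
  measurable_fun setT f -> (L2norm f <= r%:E)%E -> f \in Lfun (leb2 R) 2%:E.
Proof.
move=> mf fr; rewrite inE; apply/andP; split; rewrite inE//=.
by rewrite /finite_norm; apply: le_lt_trans fr _; rewrite ltry.
Qed.

End L2_norm.

Section pairing.
Context (R : realType).

Lemma time_cutoff_exists (T d : R) : 0 < T -> 0 < d ->
  exists chi : R -> R,
    [/\ smooth1 chi, vanish_outside (-2) (T + d) chi, (forall t, 0 <= chi t <= 1),
        chi 0 = 1 /\ chi (T + d) = 0 &
        (forall t, 0 <= t -> derive1 chi t <= 0) /\
        (forall t, 0 <= t < T -> derive1 chi t = 0)].
Proof.
move=> T0 d0; pose s (t : R) := step (d^-1 * t + - (d^-1 * T)).
have di0 : 0 < d^-1 by rewrite invr_gt0.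
have sE (t : R) : d^-1 * t + - (d^-1 * T) = (t - T) / d by rewrite -mulrBr mulrC.
have s0 (t : R) : t <= T -> s t = 0.
  by move=> tT; apply: step_eq0; rewrite sE pmulr_lle0// subr_le0.
have s1 (t : R) : T + d <= t -> s t = 1.
  by move=> tT; apply: step_eq1; rewrite sE ler_pdivlMr// mul1r lerBrDl.
have r1 (t : R) : -1 <= t -> step (1 * t + 2) = 1.
  by move=> t1; apply: step_eq1; lra.
pose chi (t : R) := step (1 * t + 2) * (1 + - 1 * s t).
have sms : smooth1 s by apply: smooth1_affine; exact: step_smooth.
have dchi (t : R) : 0 <= t -> is_derive t 1 chi (- (d^-1 * derive1 (@step R) (d^-1 * t + - (d^-1 * T)))).
  move=> t0; apply: (near_eq_is_derive (f := fun t : R => 1 + - 1 * s t)).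
    near=> y; rewrite /chi r1 ?mul1r//; apply/ltW.
    by near: y; apply: lt_nbhsr; lra.
  have ds := affine_derive (d^-1) (- (d^-1 * T)) t (@step_smooth R).
  have h := is_deriveD (is_derive_cst (1 : R) t 1) (is_deriveM (is_derive_cst (-1 : R) t 1) ds).
  apply: (is_derive_eq h); rewrite /GRing.scale /= mulr0 addr0 add0r.
  by rewrite mulN1r.
have s01 (t : R) : 0 <= s t <= 1 by rewrite step_ge0 step_le1.
exists chi; split.
- apply: smooth1M; first by apply: smooth1_affine; exact: step_smooth.
  apply: smooth1D; first exact: smooth1_cst.
  by apply: smooth1M => //; exact: smooth1_cst.
- move=> t; rewrite negb_and -!ltNge /chi => /orP[t2|tT].
    by rewrite step_eq0 ?mul0r//; lra.
  by rewrite s1 ?(ltW tT)// mulN1r subrr mulr0.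
- move=> t; have /andP[a0 a1] := s01 t; rewrite /chi mulN1r.
  rewrite mulr_ge0 ?step_ge0 ?subr_ge0//=.
  by rewrite mulr_ile1 ?step_ge0 ?step_le1 ?subr_ge0// gerBl.
- split; first by rewrite /chi r1 ?s0 ?(ltW T0)// ?mulr0 ?addr0 ?mulr1// oppr_le0.
  by rewrite /chi s1// mulN1r subrr mulr0.
split=> t.
  move=> t0; rewrite derive1E (@derive_val _ _ _ _ _ _ _ (dchi t t0)).
  by rewrite oppr_le0 mulr_ge0 ?(ltW di0)// step_derive_ge0.
move=> /andP[t0 tT]; rewrite derive1E (@derive_val _ _ _ _ _ _ _ (dchi t t0)).
rewrite derive1_step_vanish ?mulr0 ?oppr0// negb_and -!ltNge sE.
by rewrite pmulr_llt0// subr_lt0 tT.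
Unshelve. all: by end_near. Qed.

Lemma smooth1_FTC (f : R -> R) (a b : R) : a < b -> smooth1 f ->
  \int[leb R]_(x in `[a, b]) derive1 f x = f b - f a.
Proof.
move=> ab sf; have cf := smooth1_continuous sf; have sf' := smooth1_derive1 sf.
rewrite /Rintegral (@continuous_FTC2 _ (derive1 f) f a b ab)//.
- by apply: continuous_subspaceT; exact: smooth1_continuous.
- split.
  + by move=> x _; case: (smooth1_is_derive x sf).
  + by apply: cvg_at_right_filter; exact: cf.
  + by apply: cvg_at_left_filter; exact: cf.
Qed.

Lemma Rintegral_half_line_cut (f : R -> R) (b : R) :
  (forall t, b < t -> f t = 0) ->
  \int[leb R]_(t in `[0%R, +oo[) f t =
  \int[leb R]_(t in `[0%R, b]) f t.
Proof.
move=> f0; rewrite Rintegral_mkcond [RHS]Rintegral_mkcond; congr (Rintegral _ _ _).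
apply/funext => t; rewrite !patchE !mem_setE !in_itv /= andbT.
case: (0 <= t) => //=; case: leP => // bt; exact: f0.
Qed.

Lemma integrable_smooth1_segment (f : R -> R) (a b : R) : smooth1 f ->
  (leb R).-integrable `[a, b] (EFin \o f).
Proof.
move=> sf; apply: continuous_compact_integrable; first exact: segment_compact.
by apply: continuous_subspaceT; exact: smooth1_continuous.
Qed.

Lemma normrM_le_mul (p q d : R) :
  `|p| <= d -> `|q| <= 1 -> 0 <= d -> `|p * q| <= d.
Proof. by move=> pd q1 d0; rewrite normrM -[leRHS]mulr1 ler_pM. Qed.

Lemma normrM_le_mulr (p q d : R) :
  `|p| <= 1 -> `|q| <= d -> 0 <= d -> `|p * q| <= d.
Proof. by move=> p1 qd d0; rewrite mulrC; exact: normrM_le_mul. Qed.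

(** Every term other than the time derivative carries a factor [delta]: the
    transport terms through the gradient of the profile, the dissipation through
    its energy bound. *)
Lemma pairing_derivative_le (r delta p q : R) (e : R -> R)
    (Q th u1 u2 : plane R -> R) : 0 < r -> 0 < delta -> 0 <= q ->
  smooth1 e -> (energy (leb R) e = 1%:E)%E ->
  (forall x, `|e x| <= 1) -> (forall x, `|derive1 e x| <= delta) ->
  measurable_fun setT Q ->
  (energy (@mu2 R) Q <= (32 * delta ^+ 2)%:E)%E ->
  th \in Lfun (leb2 R) 2%:E -> (energy (@mu2 R) th <= (r ^+ 2)%:E)%E ->
  is_velocity th u1 u2 ->
  `|\int[@mu2 R]_x (th x * (p * tensor e e x + u1 x * (q * tensor (derive1 e) e x) +
       u2 x * (q * tensor e (derive1 e) x) - q * Q x))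
     - p * \int[@mu2 R]_x (th x * tensor e e x)| <= q * (delta * (6 * r ^+ 2 + 16)).
Proof.
move=> r0 d0 q0 se e1 eb eb' mQ Qe thL thr vel.
have mth := Lfun_measurable thL; have [u1L u2L u1e u2e] := velocity_energy_le vel.
have mu1 := Lfun_measurable u1L; have mu2' := Lfun_measurable u2L.
have me := smooth1_measurable se; have me' := smooth1_measurable (smooth1_derive1 se).
have mT (f g : R -> R) : measurable_fun [set: R] f -> measurable_fun [set: R] g ->
    measurable_fun setT (tensor f g : plane R -> R).
  by move=> mf mg; apply: measurable_funM; apply: measurableT_comp.
have [iA _] : integrableR (@mu2 R) (fun x => th x * tensor e e x) /\
    `|\int[@mu2 R]_x (th x * tensor e e x)| <= 1 * (r ^+ 2 + 1) / 2.
  apply: Rintegral_mul_le => //; first exact: mT.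
  by rewrite integral_tensor_sqr// e1 mule1 expr1n mulr1.
have transport (u F : plane R -> R) : measurable_fun setT u -> measurable_fun setT F ->
    (forall x, `|F x| <= delta) ->
    (energy (@mu2 R) u <= 4%:E * energy (@mu2 R) th)%E ->
    integrableR (@mu2 R) (fun x => th x * (u x * F x)) /\
    `|\int[@mu2 R]_x (th x * (u x * F x))| <= delta * (r ^+ 2 + 4 * r ^+ 2) / 2.
  move=> mu mF Fd ue; apply: Rintegral_mul_le => //; first exact: measurable_funM.
  apply: (@le_trans _ _ ((delta ^+ 2)%:E * energy (@mu2 R) u)%E).
    rewrite -ge0_integralZl//.
    - apply: ge0_le_integral => //.
      + by move=> x _; rewrite lee_fin sqr_ge0.
      + by apply/measurable_EFinP; apply: measurable_funX; exact: measurable_funM.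
      + by apply/measurable_EFinP; apply: measurable_funM => //; exact: measurable_funX.
      + move=> x _; rewrite lee_fin exprMn mulrC ler_wpM2r ?sqr_ge0//.
        by rewrite -(real_normK (num_real (F x))) lerXn2r// nnegrE ltW.
    - by apply/measurable_EFinP; exact: measurable_funX.
    - by move=> x _; rewrite lee_fin sqr_ge0.
    - by rewrite lee_fin sqr_ge0.
  rewrite (EFinM (delta ^+ 2) (4 * r ^+ 2)).
  apply: lee_wpmul2l; first by rewrite lee_fin sqr_ge0.
  apply: (le_trans ue); rewrite (EFinM 4 (r ^+ 2)).
  by apply: lee_wpmul2l => //; rewrite lee_fin.
have [i1 b1] := transport u1 _ mu1 (mT _ _ me' me)
  (fun x => normrM_le_mul (eb' x.1) (eb x.2) (ltW d0)) u1e.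
have [i2 b2] := transport u2 _ mu2' (mT _ _ me me')
  (fun x => normrM_le_mulr (eb x.1) (eb' x.2) (ltW d0)) u2e.
have [i3 b3] : integrableR (@mu2 R) (fun x => th x * Q x) /\
    `|\int[@mu2 R]_x (th x * Q x)| <= delta * (r ^+ 2 + 32) / 2.
  by apply: Rintegral_mul_le => //; rewrite mulrC.
set A := \int[@mu2 R]_x (th x * tensor e e x).
have -> : \int[@mu2 R]_x (th x * (p * tensor e e x + u1 x * (q * tensor (derive1 e) e x) +
       u2 x * (q * tensor e (derive1 e) x) - q * Q x)) =
   p * A + (q * \int[@mu2 R]_x (th x * (u1 x * tensor (derive1 e) e x)) +
     (q * \int[@mu2 R]_x (th x * (u2 x * tensor e (derive1 e) x)) +
      - q * \int[@mu2 R]_x (th x * Q x))).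
  transitivity (\int[@mu2 R]_x (p * (th x * tensor e e x) +
     (q * (th x * (u1 x * tensor (derive1 e) e x)) +
      (q * (th x * (u2 x * tensor e (derive1 e) x)) + - q * (th x * Q x))))).
    apply: eq_Rintegral => x _.
    by move: (th x) (u1 x) (u2 x) (Q x) (tensor _ _ x) (tensor _ _ x) (tensor _ _ x) => *; ring.
  have j0 := integrableRZ p iA; have j1 := integrableRZ q i1.
  have j2 := integrableRZ q i2; have j3 := integrableRZ (- q) i3.
  rewrite (RintegralD measurableT j0 (integrableRD j1 (integrableRD j2 j3))).
  rewrite (RintegralD measurableT j1 (integrableRD j2 j3)) (RintegralD measurableT j2 j3).
  by rewrite !RintegralZl.
rewrite addrAC subrr add0r.
move: b1 b2 b3; move: (\int[_]_x _) (\int[_]_x _) (\int[_]_x _) => B1 B2 B3.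
rewrite !ler_norml => /andP[b11 b12] /andP[b21 b22] /andP[b31 b32].
have dr0 : 0 <= delta * r ^+ 2 by rewrite mulr_ge0 ?sqr_ge0// ltW.
rewrite -ler_norml mulNr -mulrBr -mulrDr normrM (ger0_norm q0); apply: ler_wpM2l => //.
by rewrite ler_norml; apply/andP; split; lra.
Qed.

End pairing.

Section solutions.
Context (R : realType).

Lemma continuous_half_line_close (f : R -> R) (T delta : R) : 0 < T -> 0 < delta ->
  {within `[0%R, +oo[, continuous f} ->
  exists2 d, 0 < d <= 1 & forall t, T <= t <= T + d -> `|f t - f T| <= delta.
Proof.
move=> T0 d0 cf.
have cf' : {within `]0%R, +oo[, continuous f}.
  by apply: continuous_subspaceW cf => t /=; rewrite !in_itv/= !andbT; exact: ltW.
have cT : f x @[x --> T] --> f T.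
  move: cf'; rewrite continuous_open_subspace; last exact: interval_open.
  by apply; rewrite inE/= in_itv/= T0.
move/cvgrPdist_le : cT => /(_ delta d0)/nbhs_ballP[s /= s0 sT].
exists (Num.min (s / 2) 1); first by rewrite lt_min divr_gt0// ltr01 ge_min lexx orbT.
move=> t /andP[Tt tT]; rewrite distrC; apply: sT; rewrite /ball/= distrC ger0_norm ?subr_ge0//.
apply: (@le_lt_trans _ _ (s / 2)); last by rewrite ltr_pdivrMr// ltr_pMr// ltr1n.
by rewrite lerBlDl; apply: le_trans tT _; rewrite lerD2l ge_min lexx.
Qed.

Lemma measurable_nonneg_times (F : R * plane R -> R) :
  measurable_fun [set z : (measurableTypeR R * plane R)%type | 0 <= z.1] F ->
  exists2 G : measurableTypeR R * plane R -> R, measurable_fun setT G &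
    forall t x, 0 <= t -> F (t, x) = G (t, x).
Proof.
move=> mF; pose A := [set z : (measurableTypeR R * plane R)%type | 0 <= z.1].
have mA : measurable A.
  rewrite (_ : A = fst @^-1` `[0%R, +oo[%classic); last first.
    by apply/seteqP; split => z; rewrite /A /= in_itv/= andbT.
  by rewrite -[X in measurable X]setTI; exact: measurable_fst.
exists (F \_ A); first by apply/(measurable_restrictT _ mA).
by move=> t x t0; rewrite patchE mem_set.
Qed.

Lemma measurable_section (F : R * plane R -> R) (t : R) :
  measurable_fun [set z : (measurableTypeR R * plane R)%type | 0 <= z.1] F ->
  0 <= t -> measurable_fun setT (fun x : plane R => F (t, x)).
Proof.
move=> /measurable_nonneg_times[G mG FG] t0.
rewrite (_ : (fun x => F (t, x)) = (fun x => G (t, x))); last first.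
  by apply/funext => x; exact: FG.
exact: (measurableT_comp mG (pair1_measurable t)).
Qed.

Lemma measurable_section_integral (F : R * plane R -> R) (D : set R) :
  measurable_fun [set z : (measurableTypeR R * plane R)%type | 0 <= z.1] F ->
  (forall t, D t -> 0 <= t) ->
  measurable_fun (D : set (measurableTypeR R)) (fun t => \int[@mu2 R]_x F (t, x)).
Proof.
move=> /measurable_nonneg_times[G mG FG] D0.
have := @measurable_Rintegral2 _ _ _ _ _ (@mu2 R) _ mG.
move=> /(measurable_funS measurableT (@subsetT _ D)); apply: eq_measurable_fun => t.
rewrite inE => Dt; apply: eq_Rintegral => x _.
by rewrite FG//; exact: D0.
Qed.

Lemma bump_energy (delta s : R) (e : R -> R) : flat_bump delta e ->
  (\int[@mu2 R]_x ((s * tensor e e x) ^+ 2)%:E = (s ^+ 2)%:E)%E.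
Proof.
move=> [a [b [se _ e1 _ _]]]; have me := smooth1_measurable se.
have -> : (fun x => ((s * tensor e e x) ^+ 2)%:E) =
    (fun x => (tensor (fun y => s * e y) e x ^+ 2)%:E).
  by apply/funext => x; rewrite /tensor mulrA.
rewrite integral_tensor_sqr//; last exact: measurable_funM.
rewrite e1 mule1; under eq_integral do rewrite exprMn EFinM.
rewrite ge0_integralZl//.
- by rewrite e1 mule1.
- by apply/measurable_EFinP; exact: measurable_funX.
- by move=> x _; rewrite lee_fin sqr_ge0.
- by rewrite lee_fin sqr_ge0.
Qed.

Lemma bump_measurable (delta s : R) (e : R -> R) : flat_bump delta e ->
  measurable_fun setT (fun x : plane R => s * tensor e e x).
Proof.
move=> [a [b [se _ _ _ _]]]; have me := smooth1_measurable se; apply: measurable_funM => //.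
by apply: measurable_funM; exact: measurableT_comp.
Qed.

Lemma bump_norm (delta s : R) (e : R -> R) : flat_bump delta e ->
  0 <= s -> L2norm (fun x => s * tensor e e x) = s%:E.
Proof. by move=> be s0; apply: L2norm_eq => //; exact: bump_energy be. Qed.

Lemma bump_Lfun (delta s : R) (e : R -> R) : flat_bump delta e ->
  0 <= s -> (fun x => s * tensor e e x) \in Lfun (leb2 R) 2%:E.
Proof.
move=> be s0; apply: (@Lfun2_of_norm _ _ s); first exact: bump_measurable be.
by rewrite (bump_norm be s0).
Qed.

Lemma solution_energy_le (alpha r : R) (th0 : R * R -> R)
    (th : R -> R * R -> R) (t : R) :
  0 < r -> th0 \in Lfun (leb2 R) 2%:E -> L2norm th0 = r%:E ->
  qg_solution alpha th0 th -> 0 <= t ->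
  (\int[@mu2 R]_x (th t x ^+ 2)%:E <= (r ^+ 2)%:E)%E.
Proof.
move=> r0 th0L th0r sol t0; rewrite -L2norm_le ?(ltW r0)// -th0r.
by apply: (qg_maximum_principle sol) => //; rewrite lte_fin ltr1n.
Qed.

(** In the equation tested with chi(t) e(x1) e(x2), the derivative of [chi] has total
    mass -1 and is carried by an interval after [T] so short that the pairing stays
    within [delta] of its value at [T]; the other terms are at most [delta] times a
    constant at each time. *)
Lemma pairing_persists (alpha r delta T : R) (e : R -> R)
    (th : R -> R * R -> R) :
  1 / 2 < alpha <= 1 -> 0 < r -> 0 < delta -> 0 < T -> flat_bump delta e ->
  qg_solution alpha (fun x => r * tensor e e x) th ->
  r - delta * (1 + (6 * r ^+ 2 + 16) * (T + 1)) <= \int[@mu2 R]_x (th T x * tensor e e x).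
Proof.
move=> halpha r0 d0 T0 be sol.
have th0L := bump_Lfun be (ltW r0); have th0r := bump_norm be (ltW r0).
have [a [b [se ve e1 [eb eb'] [e2 e3]]]] := be.
pose A t := \int[@mu2 R]_x (th t x * tensor e e x).
have EL : (tensor e e : plane R -> R) \in Lfun (leb2 R) 2%:E.
  rewrite (_ : tensor e e = (fun x => 1 * tensor e e x)); first exact: bump_Lfun be _.
  by apply/funext => x; rewrite mul1r.
have [d /andP[dd0 dd1] Ad] : exists2 d, 0 < d <= 1 &
    forall t, T <= t <= T + d -> `|A t - A T| <= delta.
  apply: continuous_half_line_close => //.
  exact: (qg_weakly_continuous sol EL).
have [chi [schi vchi chi01 [chi0 chiB] [chi' chi'0]]] := time_cutoff_exists T0 dd0.
have [mQ QZ Qe] := frac_laplacian_energy halpha se ve e1 e2 e3.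
pose Q := frac_laplacian alpha (tensor e e).
have [u1 [u2 [mu1 mu2' vel eq]]] := qg_equation sol.
pose W t := \int[@mu2 R]_x (th t x * (derive1 chi t * tensor e e x +
   u1 t x * (chi t * tensor (derive1 e) e x) +
   u2 t x * (chi t * tensor e (derive1 e) x) - chi t * Q x)).
pose B := T + d; have B0 : 0 < B by rewrite addr_gt0.
have W0 t : B < t -> W t = 0.
  move=> Bt; have c0 : ~~ (-2 <= t <= T + d) by rewrite negb_and -!ltNge Bt orbT.
  rewrite /W (vchi _ c0) (vanish_outside_derive1 vchi c0).
  transitivity (\int[@mu2 R]_x (fun=> 0 : R) x); last by rewrite Rintegral_cst// mul0r.
  by apply: eq_Rintegral => x _; rewrite !mul0r !mulr0 !addr0 subr0 mulr0.
(* the weak equation, whose initial term is the energy of the profile times [r] *)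
have balance : \int[leb R]_(t in `[0, B]) W t = - r.
  pose phi z := chi z.1 * tensor e e z.2.
  have tphi : test_function phi by exact (tensor3_test_function schi se se vchi ve ve).
  have := eq phi tphi.
  have -> : \int[leb2 R]_x (r * tensor e e x * phi (0, x)) = r.
    rewrite /phi /= chi0.
    transitivity (fine (\int[@mu2 R]_x (r%:E * ((1 * tensor e e x) ^+ 2)%:E))%E).
      rewrite /Rintegral; congr fine; apply: (@eq_integral _ _ _ (@mu2 R)) => x _.
      by rewrite -EFinM; congr (_%:E); move: (tensor e e x) => y; ring.
    rewrite ge0_integralZl//.
    - by rewrite (bump_energy _ be) expr1n mule1.
    - apply/measurable_EFinP; apply: measurable_funX; exact: bump_measurable be.
    - by move=> x _; rewrite lee_fin sqr_ge0.
    - by rewrite lee_fin ltW.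
  rewrite (_ : (fun t => \int[leb2 R]_x _) = W); last first.
    apply/funext => t; rewrite /W; apply: (@eq_Rintegral _ _ _ (@mu2 R)) => x _.
    have [-> -> ->] := @tensor3_derivatives R chi e e (t, x) schi se se.
    by rewrite -QZ.
  by rewrite (Rintegral_half_line_cut W0) => /eqP; rewrite addr_eq0 => /eqP.
have mW : measurable_fun (`[0, B] : set (measurableTypeR R)) W.
  pose A0 := [set z : (measurableTypeR R * plane R)%type | 0 <= z.1].
  have m1 (f : R -> R) : smooth1 f -> measurable_fun A0 (fun z => f z.1).
    move=> sf; apply: measurable_funTS.
    by apply: measurableT_comp; first exact: smooth1_measurable.
  have m2 (f : plane R -> R) : measurable_fun setT f -> measurable_fun A0 (fun z => f z.2).
    by move=> mf; apply: measurable_funTS; exact: measurableT_comp.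
  have mT (f g : R -> R) : smooth1 f -> smooth1 g ->
      measurable_fun setT (tensor f g : plane R -> R).
    move=> /smooth1_measurable mf /smooth1_measurable mg.
    by apply: measurable_funM; apply: measurableT_comp.
  have se' := smooth1_derive1 se.
  apply: (@measurable_section_integral (fun z => th z.1 z.2 *
      (derive1 chi z.1 * tensor e e z.2 + u1 z.1 z.2 * (chi z.1 * tensor (derive1 e) e z.2) +
       u2 z.1 z.2 * (chi z.1 * tensor e (derive1 e) z.2) - chi z.1 * Q z.2))) => //.
    apply: measurable_funM; first exact: (qg_measurable sol).
    apply: measurable_funB; last first.
      by apply: measurable_funM; [exact: m1|exact: m2].
    apply: measurable_funD; last first.
      apply: measurable_funM => //; apply: measurable_funM; first exact: m1.
      by apply: m2; exact: mT.
    apply: measurable_funD; last first.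
      apply: measurable_funM => //; apply: measurable_funM; first exact: m1.
      by apply: m2; exact: mT.
    apply: measurable_funM; first by apply: m1; exact: smooth1_derive1.
    by apply: m2; exact: mT.
  by move=> t /=; rewrite in_itv/= => /andP[].
pose C := 6 * r ^+ 2 + 16; have C0 : 0 <= C by rewrite addr_ge0// mulr_ge0 ?sqr_ge0.
pose U t := (- delta) * derive1 chi t + delta * C.
have ic' : (leb R).-integrable `[0, B] (EFin \o derive1 chi).
  by apply: integrable_smooth1_segment; exact: smooth1_derive1.
have sZ (k : R) : smooth1 (fun t => k * derive1 chi t).
  by apply: smooth1M; [exact: smooth1_cst|exact: smooth1_derive1].
have iY : (leb R).-integrable `[0, B] (EFin \o (fun t => A T * derive1 chi t)).
  by apply: integrable_smooth1_segment.
have iV : (leb R).-integrable `[0, B] (EFin \o (fun t => - delta * derive1 chi t)).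
  by apply: integrable_smooth1_segment.
have iK : (leb R).-integrable `[0, B] (EFin \o (fun _ : R => delta * C)).
  by apply: integrable_smooth1_segment; exact: smooth1_cst.
have iU : (leb R).-integrable `[0, B] (EFin \o U).
  by apply: integrable_smooth1_segment; apply: smooth1D => //; exact: smooth1_cst.
have mD : measurable (`[0, B] : set (measurableTypeR R)) by exact: measurable_itv.
have fall : \int[leb R]_(t in `[0, B]) derive1 chi t = - 1.
  by rewrite smooth1_FTC// chi0 chiB sub0r.
have UV : \int[leb R]_(t in `[0, B]) U t = delta + delta * C * B.
  rewrite (RintegralD mD iV iK) (RintegralZl _ mD ic').
  rewrite fall mulrN1 opprK; congr (_ + _).
  have lB : leb R `[0, B] = B%:E.
    by rewrite lebesgue_measure_itv/= lte_fin B0 oppr0 adde0.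
  by rewrite (Rintegral_cst _ mD); congr (_ * _); exact: (congr1 (@fine R) lB).
have close : {ae leb R, forall t, t \in `[0, B] ->
    `|W t - A T * derive1 chi t| <= U t}.
  have nonzero : {ae leb R, forall t, t != 0}.
    exists [set 0]; split => //; first exact: lebesgue_measure_set1.
    by move=> t /= /negP; rewrite negbK => /eqP.
  apply: (ae_impl2 nonzero vel) => t tn0 vt; rewrite in_itv/= => /andP[t0 tB].
  have velt := vt (ltac:(by rewrite lt_neqAle eq_sym tn0)).
  have thL : th t \in Lfun (leb2 R) 2%:E by case: velt => ? [? [? [? [[]]]]].
  have energy := solution_energy_le r0 th0L th0r sol t0.
  have /andP[c0 c1] := chi01 t.
  have h := pairing_derivative_le (derive1 chi t) r0 d0 c0 se e1 eb eb' mQ Qe thL energy velt.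
  have {}h : `|W t - derive1 chi t * A t| <= delta * C.
    apply: (le_trans h); rewrite -[leRHS]mul1r; apply: ler_wpM2r => //.
    by rewrite mulr_ge0// ltW.
  have h' : `|derive1 chi t * A t - A T * derive1 chi t| <= - delta * derive1 chi t.
    rewrite (mulrC (A T)) -mulrBr normrM mulNr -mulrN mulrC.
    have [tT|Tt] := ltP t T; first by rewrite chi'0 ?t0// normr0 oppr0 !mulr0.
    rewrite (ler0_norm (chi' _ t0)); apply: ler_wpM2r; first by rewrite oppr_ge0 chi'.
    by apply: Ad; rewrite Tt.
  rewrite -(subrK (derive1 chi t * A t) (W t)) -addrA /U addrC.
  by apply: (le_trans (ler_normD _ _)); exact: lerD.
have U0 t : t \in `[0, B] -> 0 <= U t.
  rewrite in_itv/= => /andP[t0 _]; rewrite /U mulNr -mulrN.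
  by apply: addr_ge0; apply: mulr_ge0; rewrite ?(ltW d0)// oppr_ge0 chi'.
have := Rintegral_ae_close mD mW iY iU U0 close.
rewrite balance UV (RintegralZl _ mD ic') fall mulrN1 opprK addrC ler_norml => /andP[low _].
have dCB : delta * C * B <= delta * C * (T + 1).
  by rewrite ler_wpM2l ?lerD2l// mulr_ge0// ltW.
rewrite -/(A T) -/C mulrDr mulr1 mulrA; lra.
Qed.

(** For eps <= 1 the claim is squared: [n ^+ 2] is at least r^2 (1 - eps), and 1 - eps
    is at least its own square. *)
Lemma norm_from_pairing (r eps n A : R) : 0 < r -> 0 < eps -> 0 <= n ->
  r - eps * r / 2 <= A -> r * A <= (r ^+ 2 + n ^+ 2) / 2 -> 1 - eps <= n / r.
Proof.
move=> r0 eps0 n0 hA hn; rewrite ler_pdivlMr//.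
have [e1|e1] := leP 1 eps.
  by apply: le_trans n0; apply: mulr_le0_ge0; [rewrite subr_le0|exact: ltW].
have e0 : 0 <= 1 - eps by rewrite subr_ge0 ltW.
have e10 : 0 <= (1 - eps) * r by apply: mulr_ge0 => //; exact: ltW.
rewrite -(@ler_pXn2r _ 2)// ?nnegrE//.
have h : r * (r - eps * r / 2) <= r * A by rewrite ler_wpM2l// ltW.
have h2 : 0 <= r ^+ 2 * (eps * (1 - eps)) by rewrite mulr_ge0 ?sqr_ge0// mulr_ge0// ltW.
have -> : ((1 - eps) * r) ^+ 2 = 2 * (r * (r - eps * r / 2)) - r ^+ 2
    - r ^+ 2 * (eps * (1 - eps)) by field.
lra.
Qed.

End solutions.

Theorem theorem1p2 (R : realType) (alpha r eps T : R)
    (halpha : 1 / 2 < alpha <= 1) (hr : 0 < r) (heps : 0 < eps) (hT : 0 < T) :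
  exists th0 : R * R -> R,
    [/\ th0 \in Lfun (leb2 R) 2%:E,
        L2norm th0 = r%:E &
        forall th : R -> R * R -> R, qg_solution alpha th0 th ->
          1 - eps <= fine (L2norm (th T)) / fine (L2norm th0)].
Proof.
pose K := 1 + (6 * r ^+ 2 + 16) * (T + 1).
have K0 : 0 < K.
  by rewrite addr_gt0// mulr_gt0// addr_gt0// mulr_gt0// exprn_gt0.
(* a loss of eps r / 2 in the pairing is a loss of eps r^2 in the squared norm *)
pose delta := eps * r / 2 / K.
have d0 : 0 < delta by rewrite !divr_gt0// mulr_gt0.
have [e be] := flat_bump_exists d0.
have th0L := bump_Lfun be (ltW hr); have th0r := bump_norm be (ltW hr).
exists (fun x => r * tensor e e x); split => // th sol; rewrite th0r /=.
have energy := solution_energy_le hr th0L th0r sol (ltW hT).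
have mth : measurable_fun setT (th T : plane R -> R).
  by apply: (@measurable_section _ (fun z => th z.1 z.2)); [exact: qg_measurable sol|exact: ltW].
pose n := fine (L2norm (th T)).
have thn : L2norm (th T) = n%:E.
  rewrite fineK// ge0_fin_numE ?L2norm_ge0//.
  by apply: le_lt_trans (ltry r); rewrite L2norm_le// ltW.
have n0 : 0 <= n by rewrite -lee_fin -thn L2norm_ge0.
apply: (norm_from_pairing hr heps n0 (A := \int[@mu2 R]_x (th T x * tensor e e x))).
  have := pairing_persists halpha hr d0 hT be sol.
  by rewrite -/K /delta divfK// gt_eqF.
have [ith bth] : integrableR (@mu2 R) (fun x => th T x * (r * tensor e e x)) /\
    `|\int[@mu2 R]_x (th T x * (r * tensor e e x))| <= 1 * (n ^+ 2 + r ^+ 2) / 2.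
  apply: Rintegral_mul_le => //; first exact: bump_measurable be.
    by rewrite -L2norm_le// thn.
  by rewrite expr1n mul1r (bump_energy _ be).
have iA : integrableR (@mu2 R) (fun x => th T x * tensor e e x).
  have := integrableRZ r^-1 ith; apply: eq_integrable => // x _ /=.
  by congr EFin; field; rewrite gt_eqF.
rewrite -RintegralZl//; apply: le_trans (ler_norm _) _.
rewrite mul1r addrC in bth; apply: le_trans bth.
rewrite le_eqVlt; apply/orP; left; apply/eqP; congr (`|_|).
by apply: eq_Rintegral => x _; rewrite mulrCA.
Qed.
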